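(* Let $S\subset\mathbb{R}^n$ be a locally closed semialgebraic set with the zero-set property, and let $X\subset S$ be $S$-$\mathcal{AR}$-closed. (i) If $Y\subset X$ is $X$-$\mathcal{AR}$-closed, then $\mathcal{Z}_X(\mathcal{I}_X(Y))=Y$. (ii) If $I$ is an ideal in ${}^{a}\mathcal{A}(X)$, then $\mathcal{I}_X(\mathcal{Z}_X(I))=\mathrm{rad}_X(I)$.
   Context: For a semialgebraic set $S\subset\mathbb{R}^n$, an analytic arc $\gamma:(-1,1)\to S$ is a map into $S$ that is real analytic as a map into $\mathbb{R}^n$. A function $f:S\to\mathbb{R}$ is semialgebraic if its graph is semialgebraic, and arc-analytic if $f\circ\gamma$ is real analytic for every analytic arc $\gamma:(-1,1)\to S$. ${}^{a}\mathcal{A}(S)$ is the $\mathbb{R}$-algebra of all semialgebraic arc-analytic functions $S\to\mathbb{R}$. A semialgebraic subset $E\subset S$ is $S$-$\mathcal{AR}$-closed if it is arc-symmetric in $S$: for every analytic arc $\gamma:(-1,1)\to S$, $\gamma((-1,0))\subset E$ implies $\gamma((-1,1))\subset E$. $S$ has the zero-set property (ZSP) if for every $S$-$\mathcal{AR}$-closed $E\subset S$ there is $f\in{}^{a}\mathcal{A}(S)$ with $f^{-1}(0)=E$. For a semialgebraic set $X$: $\mathcal{Z}_X(I)\subset X$ is the set of common zeros of the elements of an ideal $I\subset{}^{a}\mathcal{A}(X)$; $\mathcal{I}_X(Y)$ is the ideal of functions in ${}^{a}\mathcal{A}(X)$ vanishing on $Y\subset X$; $\mathrm{rad}_X(I)$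 is the radical of $I$ in ${}^{a}\mathcal{A}(X)$. *)

(* Defs.v *)
From mathcomp Require Import all_boot all_order all_algebra.
From mathcomp Require mpoly.
From mathcomp Require Import all_classical all_reals all_analysis.

Set Implicit Arguments.
Unset Strict Implicit.
Unset Printing Implicit Defensive.

Import Order.TTheory GRing.Theory Num.Theory.
Import numFieldNormedType.Exports.

Local Open Scope classical_set_scope.
Local Open Scope ring_scope.

Section ArcAnalytic.
Variable R : realType.

(* The Boolean algebra of subsets of R^n generated by the sets {p > 0}, p a
   real polynomial (intersections and {p = 0} are obtained by complement). *)
Inductive semialgebraic (n : nat) : set 'rV[R]_n -> Prop :=
| semialgebraic_pos (p : mpoly.mpoly n R) :
    semialgebraic [set x : 'rV[R]_n | 0 < mpoly.meval (fun i => x ord0 i) p]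
| semialgebraicC (A : set 'rV[R]_n) : semialgebraic A -> semialgebraic (~` A)
| semialgebraicU (A B : set 'rV[R]_n) :
    semialgebraic A -> semialgebraic B -> semialgebraic (A `|` B).

Definition locally_closed (n : nat) (S : set 'rV[R]_n) : Prop :=
  exists U F : set 'rV[R]_n, [/\ open U, closed F & S = U `&` F].

Definition real_analytic_on (D : set R) (g : R -> R) : Prop :=
  forall a, D a -> exists c : R^nat,
    \forall t \near a, pseries c (t - a) @ \oo --> g t.

(* Maps (-1,1) -> S are represented by their extensions to R; only the values
   on (-1,1) are ever used, and an extension with values in S always exists. *)
Definition analytic_arc (n : nat) (S : set 'rV[R]_n) (gamma : R -> S) : Prop :=
  forall i : 'I_n, real_analytic_on `]-1, 1[ (fun t => set_val (gamma t) ord0 i).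

Definition semialgebraic_fun (n : nat) (S : set 'rV[R]_n) (f : S -> R) : Prop :=
  semialgebraic
    (range (fun x : S => row_mx (set_val x) (const_mx (f x) : 'rV[R]_1))).

Definition arc_analytic (n : nat) (S : set 'rV[R]_n) (f : S -> R) : Prop :=
  forall gamma : R -> S, analytic_arc gamma ->
    real_analytic_on `]-1, 1[ (f \o gamma).

Definition aA (n : nat) (S : set 'rV[R]_n) : set (S -> R) :=
  [set f | semialgebraic_fun f /\ arc_analytic f].

Definition AR_closed (n : nat) (S E : set 'rV[R]_n) : Prop :=
  [/\ semialgebraic E, E `<=` S &
      forall gamma : R -> S, analytic_arc gamma ->
        (forall t, t \in `]-1, 0[ -> E (set_val (gamma t))) ->
        (forall t, t \in `]-1, 1[ -> E (set_val (gamma t)))].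

Definition zero_set_property (n : nat) (S : set 'rV[R]_n) : Prop :=
  forall E, AR_closed S E ->
    exists2 f : S -> R, aA f & set_val @` [set x | f x = 0] = E.

(* Operations on functions X -> R are the pointwise ones. *)
Definition is_ideal (n : nat) (X : set 'rV[R]_n) (I : set (X -> R)) : Prop :=
  [/\ I `<=` @aA n X, I 0,
      forall f g, I f -> I g -> I (f + g) &
      forall f g, aA f -> I g -> I (f * g)].

Definition zeros (n : nat) (X : set 'rV[R]_n) (I : set (X -> R)) :
    set 'rV[R]_n :=
  set_val @` [set x : X | forall f, I f -> f x = 0].

Definition vanishing (n : nat) (X Y : set 'rV[R]_n) : set (X -> R) :=
  [set f | aA f /\ forall x : X, Y (set_val x) -> f x = 0].

Definition radical (n : nat) (X : set 'rV[R]_n) (I : set (X -> R)) :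
    set (X -> R) :=
  [set f | aA f /\ exists2 k : nat, (0 < k)%N & I (f ^+ k)].

End ArcAnalytic.

Arguments aA {R n} S _.
Arguments vanishing {R n} X Y _.

(* Main.v *)
Require Import Defs.
From mathcomp Require Import all_boot all_order all_algebra.
From mathcomp Require mpoly.
From mathcomp Require ordered_qelim qe_rcf polyrcf.
From mathcomp Require Import ring lra zify.
From mathcomp Require Import all_classical all_reals all_analysis.

Set Implicit Arguments.
Unset Strict Implicit.
Unset Printing Implicit Defensive.

Import Order.TTheory GRing.Theory Num.Theory.
Import numFieldNormedType.Exports.

Local Open Scope classical_set_scope.
Local Open Scope ring_scope.

(** Why the theorem holds.

    The first part is a formality: [Y] is arc-symmetric in [S] as well, so the
    zero set property gives a function on [S] with zero set [Y], and its
    restriction to [X] belongs to the ideal of [Y].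

    For the second part let [f] vanish on the zeros of the ideal [I].  Two facts
    are needed.

    - Some single [g] in [I] has the same zeros as [I] ([ideal_zero_set]).  The
      ring is not noetherian, but topologically it behaves as if it were: [X] is
      a finite union of images of spaces [R^k] under semialgebraic maps that
      preserve analytic arcs, and along such a map every function of the ring
      pulls back to a semialgebraic arc-analytic function on [R^k].  If that
      pullback does not vanish identically, its zeros have smaller dimension, in
      the sense that they are again a finite union of such images from spaces
      [R^j] with [j < k] ([decomposition]).  By induction on [k], finitely many
      elements of [I] suffice to cut out the zeros, and a sum of their squares
      is one element that does.

    - If [f] vanishes on the zeros of [g], then a power of [f] is a multiple of
      [g] ([power_divisible]).  A Lojasiewicz inequality [c |f| ^ N <= |g|] holds
      near each zero of [g], with [N] independent of the zero ([lojasiewicz]).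
      Along an analytic arc it compares orders of vanishing, so that
      [f ^ N.+1 / g], extended by zero, is analytic along the arc and hence in
      the ring.  The inequality comes from elimination of quantifiers: the set of
      values of [|f|] and bounds for [|g|] near a point is described by finitely
      many polynomials, and a positive root [v] of a polynomial whose
      coefficients are polynomials in a small [u > 0] is at least a constant
      times a power of [u] ([uniform_gap]).

    The inequality requires [f] and [g] to be continuous and [X] to be locally
    compact.  Continuity follows from curve selection ([curve_selection]), which
    combines definable choice ([sa_choice]) with Puiseux expansions of
    semialgebraic functions of one variable ([saf_puiseux]).  Local compactness
    passes from [S] to [X] because the zero set property makes [X] the zero set
    of a continuous function on [S].  The analytic tools, in one variable only,
    are closure properties of power series, the implicit function theorem
    ([implicit_function]) and the Newton method ([puiseux]); the semialgebraic
    ones rest on the elimination of quantifiers ([sa_proj]).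

    Generic regularity of semialgebraic functions is obtained without cell
    decompositions of class [C^k]: a semialgebraic function is a root of a
    polynomial, after differentiation a simple root, and a simple root is
    analytic along the arcs on which it is continuous.  The set of
    discontinuities has empty interior by a Baire category argument
    ([discont_no_interior]), hence is treated by induction on the dimension. *)

(** * Weighted norms of polynomials *)

Section WeightedNorm.
Variable R : realType.
Implicit Types (p q : {poly R}) (r : R).

(** The weighted [l1] norm of the coefficients. It is submultiplicative and
    monotone under substitution, and a power series converges absolutely in
    the closed disc of radius [r] exactly when the norms of its partial sums
    are bounded. *)
Definition pnorm r p : R := (map_poly Num.norm p).[r].

Lemma coef_abs p i : (map_poly Num.norm p)`_i = `|p`_i|.
Proof. by rewrite coef_map_id0 // normr0. Qed.

Lemma horner_le p q r : 0 <= r -> (forall i, p`_i <= q`_i) -> p.[r] <= q.[r].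
Proof.
move=> r0 pq; rewrite (@horner_coef_wide _ (maxn (size p) (size q)) p) ?leq_maxl//.
rewrite (@horner_coef_wide _ (maxn (size p) (size q)) q) ?leq_maxr//.
by apply: ler_sum => i _; rewrite ler_wpM2r // exprn_ge0.
Qed.

Lemma pnorm_le p q r : 0 <= r -> (forall i, `|p`_i| <= `|q`_i|) ->
  pnorm r p <= pnorm r q.
Proof. by move=> r0 pq; apply: horner_le => // i; rewrite !coef_abs. Qed.

Lemma pnorm_ge0 r p : 0 <= r -> 0 <= pnorm r p.
Proof.
move=> r0; rewrite -(horner0 r); apply: horner_le => // i.
by rewrite coef_abs coef0.
Qed.

Lemma pnormD r p q : 0 <= r -> pnorm r (p + q) <= pnorm r p + pnorm r q.
Proof.
move=> r0; rewrite -hornerD; apply: horner_le => // i.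
by rewrite coefD !coef_abs coefD ler_normD.
Qed.

Lemma pnormM r p q : 0 <= r -> pnorm r (p * q) <= pnorm r p * pnorm r q.
Proof.
move=> r0; rewrite -hornerM; apply: horner_le => // i.
rewrite coefM coef_abs coefM (le_trans (ler_norm_sum _ _ _)) //.
by apply: ler_sum => j _; rewrite !coef_abs normrM.
Qed.

Lemma pnormC r c : pnorm r c%:P = `|c|.
Proof.
rewrite /pnorm -[RHS](hornerC _ r); congr (_.[_]); apply/polyP => i.
by rewrite coef_abs !coefC; case: (_ == _); rewrite ?normr0.
Qed.

Lemma pnorm0 r : pnorm r 0 = 0.
Proof. by rewrite -[0 in LHS]/(0%:P) pnormC normr0. Qed.

Lemma pnorm1 r : pnorm r 1 = 1.
Proof. by rewrite -[1 in LHS]/(1%:P) pnormC normr1. Qed.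

Lemma pnormX r p n : 0 <= r -> pnorm r (p ^+ n) <= pnorm r p ^+ n.
Proof.
move=> r0; elim: n => [|n IH]; first by rewrite !expr0 pnorm1.
rewrite !exprS (le_trans (pnormM _ _ r0)) //.
by rewrite ler_wpM2l // pnorm_ge0.
Qed.

Lemma pnormXn r n : pnorm r 'X^n = r ^+ n.
Proof.
rewrite /pnorm -[RHS]hornerXn; congr (_.[_]); apply/polyP => i.
by rewrite coef_abs !coefXn; case: (_ == _); rewrite ?normr1 ?normr0.
Qed.

Lemma pnorm_sum r (I : Type) (s : seq I) (P : pred I) (F : I -> {poly R}) :
  0 <= r -> pnorm r (\sum_(i <- s | P i) F i) <= \sum_(i <- s | P i) pnorm r (F i).
Proof.
move=> r0; elim/big_ind2: _ => [|x1 x2 y1 y2 h1 h2|//]; first by rewrite pnorm0.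
by rewrite (le_trans (pnormD _ _ r0)) // lerD.
Qed.

Lemma pnorm_take r n p : 0 <= r -> pnorm r (take_poly n p) <= pnorm r p.
Proof.
move=> r0; apply: pnorm_le => // i; rewrite coef_take_poly.
by case: ifP => _; rewrite ?normr0.
Qed.

Lemma pnorm_sumE r p n : (size p <= n)%N ->
  pnorm r p = \sum_(i < n) `|p`_i| * r ^+ i.
Proof.
move=> sp; rewrite /pnorm (@horner_coef_wide _ n); last first.
  by apply: leq_trans sp; rewrite size_poly.
by apply: eq_bigr => i _; rewrite coef_abs.
Qed.

Lemma pnorm_le_r r r' p : 0 <= r -> r <= r' -> pnorm r p <= pnorm r' p.
Proof.
move=> r0 rr; rewrite !(pnorm_sumE _ (leqnn _)); apply: ler_sum => i _.
by rewrite ler_wpM2l // lerXn2r // nnegrE (le_trans r0).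
Qed.

Lemma pnorm_comp r p q : 0 <= r -> pnorm r (p \Po q) <= pnorm (pnorm r q) p.
Proof.
move=> r0; rewrite comp_polyE (le_trans (pnorm_sum _ _ _ r0)) //.
rewrite (pnorm_sumE _ (leqnn _)); apply: ler_sum => i _.
rewrite -mul_polyC (le_trans (pnormM _ _ r0)) // pnormC ler_wpM2l //.
exact: pnormX.
Qed.

Lemma normr_horner_le r p t : `|t| <= r -> `|p.[t]| <= pnorm r p.
Proof.
move=> tr; rewrite (pnorm_sumE _ (leqnn _)) horner_coef.
rewrite (le_trans (ler_norm_sum _ _ _)) //; apply: ler_sum => i _.
by rewrite normrM normrX ler_wpM2l // lerXn2r // nnegrE (le_trans _ tr).
Qed.

(** The terms of high degree are geometrically small inside the disc, with a
    bound that depends only on the norm; a limit of polynomials of bounded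
    norm can therefore be taken coefficient by coefficient. *)
Lemma horner_tail r p n t th : 0 <= r -> 0 <= th <= 1 -> `|t| <= th * r ->
  `|p.[t] - (take_poly n p).[t]| <= pnorm r p * th ^+ n.
Proof.
move=> r0 /andP[th0 th1] tr.
rewrite (@horner_coef_wide _ (size p) p) //.
rewrite (@horner_coef_wide _ (size p) (take_poly n p)); last first.
  apply/leq_sizeP => j hj; rewrite coef_take_poly nth_default //.
  by case: ifP.
rewrite -sumrB (le_trans (ler_norm_sum _ _ _)) // (pnorm_sumE _ (leqnn _)).
rewrite mulr_suml; apply: ler_sum => i _; rewrite coef_take_poly -mulrBl.
case: ltnP => hi.
  by rewrite subrr mul0r normr0 !mulr_ge0 // exprn_ge0.
rewrite subr0 normrM normrX -mulrA ler_wpM2l //.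
apply: (@le_trans _ _ ((th * r) ^+ i)).
  by rewrite lerXn2r // nnegrE // mulr_ge0.
by rewrite exprMn mulrC ler_wpM2l ?exprn_ge0 // ler_wiXn2l.
Qed.

End WeightedNorm.

(** * Real analytic functions of one variable *)

Section Analytic.
Variable R : realType.

Lemma cvg_sumR (T : Type) (F : set_system T) (FF : Filter F) (I : Type)
    (s : seq I) (P : pred I) (f : I -> T -> R) (a : I -> R) :
  (forall i, P i -> f i x @[x --> F] --> a i) ->
  \sum_(i <- s | P i) f i x @[x --> F] --> \sum_(i <- s | P i) a i.
Proof.
move=> fa; elim: s => [|i s IH].
  by rewrite big_nil; under eq_fun do rewrite big_nil; exact: cvg_cst.
rewrite big_cons; under eq_fun do rewrite big_cons.
by case: ifPn => // Pi; apply: cvgD => //; exact: fa.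
Qed.

Lemma cvg_exp (T : Type) (F : set_system T) (FF : Filter F) (f : T -> R) (l : R) n :
  f x @[x --> F] --> l -> f x ^+ n @[x --> F] --> l ^+ n.
Proof.
move=> h; elim: n => [|n IH].
  by rewrite expr0; under eq_fun do rewrite expr0; exact: cvg_cst.
by rewrite exprS; under eq_fun do rewrite exprS; apply: cvgM.
Qed.

Implicit Types (g h : R -> R) (a r rho t : R) (c : nat -> R).

(** Analyticity at one point, as in [real_analytic_on]. *)
Definition ana g a := exists c : R^nat,
  \forall t \near a, pseries c (t - a) @ \oo --> g t.

Definition psum c n : {poly R} := \poly_(i < n) c i.

Lemma pseriesE c x : pseries c x = (fun n => (psum c n).[x]).
Proof.
apply/funext => n; rewrite /pseries /series /= horner_poly big_mkord.
by apply: eq_bigr => i _.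
Qed.

Definition expansion c r rho g a :=
  [/\ 0 < r, forall n, pnorm r (psum c n) <= rho &
      forall t, `|t - a| < r -> (psum c n).[t - a] @[n --> \oo] --> g t].

Lemma expansion_ana c r rho g a : expansion c r rho g a -> ana g a.
Proof.
move=> [r0 _ h]; exists c; exists r => //= t /= tr.
by rewrite pseriesE; apply: h; rewrite distrC.
Qed.

Lemma expansion_shrink c r r' rho g a : 0 < r' -> r' <= r ->
  expansion c r rho g a -> expansion c r' rho g a.
Proof.
move=> r'0 rr [r0 h1 h2]; split=> //.
  by move=> n; apply: le_trans (h1 n); apply: pnorm_le_r => //; apply: ltW.
by move=> t tr; apply: h2; apply: lt_le_trans rr.
Qed.

Lemma expansion_weaken c r rho rho' g a : rho <= rho' ->
  expansion c r rho g a -> expansion c r rho' g a.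
Proof. by move=> rr [r0 h1 h2]; split=> // n; apply: le_trans rr. Qed.

(** A series that converges at distance [s] from its centre has terms bounded
    there, hence is dominated by a geometric series at distance [s / 2]. *)
Lemma ana_expansion g a : ana g a -> exists c r rho, expansion c r rho g a.
Proof.
move=> [c [e /= e0 he]].
have ht t : `|t - a| < e -> (psum c n).[t - a] @[n --> \oo] --> g t.
  move=> te; have := he t; rewrite /ball /= distrC => /(_ te).
  by rewrite pseriesE.
pose s := e / 2; have s0 : 0 < s by rewrite divr_gt0.
have := ht (a + s); rewrite addrAC subrr add0r gtr0_norm //.
move=> /(_ _) hs.
have {}hs : (psum c n).[s] @[n --> \oo] --> g (a + s).
  by apply: hs; rewrite /s ltr_pdivrMr // ltr_pMr // ltr1n.
have /cvg_seq_bounded [B [_ hB]] : cvgn (fun n => (psum c n).[s]) by apply/cvg_ex; exists (g (a + s)).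
have {}hB n : `|(psum c n).[s]| <= `|B| + 1.
  by apply: hB => //; rewrite (le_lt_trans (ler_norm B)) // ltrDl.
set K := `|B| + 1 in hB; have K0 : 0 <= K by rewrite /K addr_ge0.
have hc n : `|c n| * s ^+ n <= 2 * K.
  have -> : `|c n| * s ^+ n = `|(psum c n.+1).[s] - (psum c n).[s]|.
    rewrite !horner_poly big_ord_recr /= addrAC subrr add0r normrM normrX.
    by rewrite (gtr0_norm s0).
  by rewrite (le_trans (ler_normB _ _)) // mulr_natl mulr2n lerD.
exists c, (s / 2), (4 * K); split; first by rewrite divr_gt0.
  move=> n; rewrite (@pnorm_sumE _ _ _ n) ?size_poly //.
  have : \sum_(i < n) `|(psum c n)`_i| * (s / 2) ^+ i <=
         \sum_(i < n) 2 * K * (2^-1) ^+ i.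
    apply: ler_sum => i _; rewrite coef_poly ltn_ord exprMn mulrA.
    by rewrite ler_wpM2r // exprn_ge0.
  move=> /le_trans; apply; rewrite -mulr_sumr.
  have -> : 4 * K = 2 * K * 2 by ring.
  rewrite ler_wpM2l ?mulr_ge0 //.
  have -> : \sum_(i < n) (2^-1 : R) ^+ i = 2 * (1 - 2^-1 ^+ n).
    elim: (n) => [|k IH]; first by rewrite big_ord0 expr0 subrr mulr0.
    by rewrite big_ord_recr /= IH exprS; field.
  by rewrite ger_pMr // lerBlDr lerDl exprn_ge0.
move=> t ts; apply: ht; apply: lt_trans ts _.
by rewrite /s; lra.
Qed.

(** A sequence of polynomials of bounded norm that converges both
    coefficientwise and pointwise has an analytic limit. Sums, products,
    substitutions and recentring are instances: the same operation on partial
    sums gives the sequence. *)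
Lemma expansion_lim (W : nat -> {poly R}) c r rho g a : 0 < r ->
  (forall m, pnorm r (W m) <= rho) ->
  (forall k, (W m)`_k @[m --> \oo] --> c k) ->
  (forall t, `|t - a| < r -> (W m).[t - a] @[m --> \oo] --> g t) ->
  expansion c r rho g a.
Proof.
move=> r0 hW hc hg.
have htk n x : (take_poly n (W m)).[x] @[m --> \oo] --> (psum c n).[x].
  have -> : (fun m => (take_poly n (W m)).[x]) =
            (fun m => \sum_(i < n) (W m)`_i * x ^+ i).
    apply/funext => m; rewrite (@horner_coef_wide _ n) ?size_take_poly //.
    by apply: eq_bigr => i _; rewrite coef_take_poly ltn_ord.
  rewrite horner_poly; apply: cvg_sumR => i _.
  by apply: cvgMr_tmp; exact: hc.
have hnk n : pnorm r (take_poly n (W m)) @[m --> \oo] --> pnorm r (psum c n).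
  have -> : (fun m => pnorm r (take_poly n (W m))) =
            (fun m => \sum_(i < n) `|(W m)`_i| * r ^+ i).
    apply/funext => m; rewrite (@pnorm_sumE _ _ _ n) ?size_take_poly //.
    by apply: eq_bigr => i _; rewrite coef_take_poly ltn_ord.
  rewrite (@pnorm_sumE _ _ _ n) ?size_poly //.
  under eq_bigr do rewrite coef_poly ltn_ord.
  apply: cvg_sumR => i _; apply: cvgMr_tmp.
  by apply: cvg_norm; exact: hc.
split=> // [n|t tr].
  apply: (cvgr_to_le (hnk n)).
  by near=> m; apply: le_trans (hW m); apply: pnorm_take; apply: ltW.
have rho0 : 0 <= rho by apply: le_trans (hW 0%N); apply: pnorm_ge0; apply: ltW.
pose th := `|t - a| / r.
have th0 : 0 <= th by rewrite divr_ge0 // ltW.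
have th1 : th < 1 by rewrite ltr_pdivrMr // mul1r.
have hthr : `|t - a| <= th * r by rewrite divfK // gt_eqF.
have key n : `|g t - (psum c n).[t - a]| <= rho * th ^+ n.
  have hl : `|(W m).[t - a] - (take_poly n (W m)).[t - a]| @[m --> \oo] -->
     `|g t - (psum c n).[t - a]|.
    by apply: cvg_norm; apply: cvgB; [exact: hg|exact: htk].
  apply: (cvgr_to_le hl); near=> m.
  have := @horner_tail R r (W m) n (t - a) th (ltW r0) _ hthr.
  rewrite th0 (ltW th1) => /(_ isT) /le_trans; apply.
  by rewrite ler_wpM2r // exprn_ge0.
apply/cvgrPdist_le => /= e e0.
have hgeo : rho * th ^+ n @[n --> \oo] --> rho * 0.
  by apply: cvgMl_tmp; apply: cvg_expr; rewrite ger0_norm.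
rewrite mulr0 in hgeo.
have /cvgrPdist_le/(_ e e0) := hgeo; apply: filterS => n.
rewrite sub0r normrN => hn.
by apply: le_trans (key n) _; apply: le_trans hn; exact: ler_norm.
Unshelve. all: by end_near. Qed.

Lemma expansion_rho_ge0 c r rho g a : expansion c r rho g a -> 0 <= rho.
Proof. by move=> [r0 h _]; apply: le_trans (h 0%N); apply: pnorm_ge0; apply: ltW. Qed.

Lemma take_psum c m n : (n <= m)%N -> take_poly n (psum c m) = psum c n.
Proof.
move=> nm; apply/polyP => i; rewrite coef_take_poly !coef_poly.
by case: ltnP => // h; rewrite (leq_trans h nm).
Qed.

Lemma expansion_tail c r rho g a t n : expansion c r rho g a -> `|t - a| < r ->
  `|g t - (psum c n).[t - a]| <= rho * (`|t - a| / r) ^+ n.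
Proof.
move=> H tr; have [r0 h1 h2] := H.
have hl : `|(psum c m).[t - a] - (psum c n).[t - a]| @[m --> \oo] -->
     `|g t - (psum c n).[t - a]|.
  by apply: cvg_norm; apply: cvgB; [exact: h2|exact: cvg_cst].
apply: (cvgr_to_le hl); near=> m.
have nm : (n <= m)%N by near: m; exact: nbhs_infty_ge.
rewrite -(take_psum c nm).
have th0 : 0 <= `|t - a| / r by rewrite divr_ge0 // ltW.
have th1 : `|t - a| / r <= 1 by rewrite ler_pdivrMr // mul1r ltW.
have := @horner_tail R r (psum c m) n (t - a) (`|t - a| / r) (ltW r0).
rewrite th0 th1 divfK ?gt_eqF // => /(_ isT (lexx _)) /le_trans; apply.
by rewrite ler_wpM2r // exprn_ge0.
Unshelve. all: by end_near. Qed.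

Lemma psum_coef_cvg c k : (psum c m)`_k @[m --> \oo] --> c k.
Proof.
apply: cvg_near_cst; near=> m; rewrite coef_poly ifT //.
by near: m; exact: nbhs_infty_gt.
Unshelve. all: by end_near. Qed.

Lemma expansion0 c r rho g a : expansion c r rho g a -> g a = c 0%N.
Proof.
move=> [r0 _ /(_ a)]; rewrite subrr normr0 => /(_ r0) h.
apply: (cvg_unique _ h) => //; apply: cvg_near_cst; near=> m.
rewrite horner_coef0 coef_poly ifT //.
by near: m; exact: nbhs_infty_gt.
Unshelve. all: by end_near. Qed.

Lemma ana_near g h a : (\forall t \near a, g t = h t) -> ana g a -> ana h a.
Proof.
move=> gh [c hc]; exists c; near=> t.
have <- : g t = h t by near: t.
by near: t.
Unshelve. all: by end_near. Qed.

Lemma ana_ext g h a : (forall t, g t = h t) -> ana g a -> ana h a.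
Proof. by move=> gh; have -> : h = g by apply/funext. Qed.

Lemma near_dist a r : 0 < r -> \forall t \near a, `|t - a| < r.
Proof. by move=> r0; exists r => //= t; rewrite /ball /= distrC. Qed.

Lemma ana_cvg g a : ana g a -> g t @[t --> a] --> g a.
Proof.
move=> /ana_expansion [c [r [rho H]]]; have [r0 _ _] := H.
have rho0 := expansion_rho_ge0 H.
apply/cvgrPdist_le => e e0.
have d0 : 0 < e * r / (rho + 1) by rewrite divr_gt0 ?mulr_gt0 // ltr_wpDl.
near=> t.
have tr : `|t - a| < r by near: t; exact: (near_dist a).
have td : `|t - a| <= e * r / (rho + 1).
  by apply: ltW; near: t; exact: (near_dist a).
have := expansion_tail 1 H tr; rewrite (expansion0 H) distrC expr1.
rewrite horner_poly big_ord1 expr0 mulr1 => /le_trans; apply.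
rewrite mulrA ler_pdivrMr //.
have : rho * `|t - a| <= (rho + 1) * `|t - a| by rewrite ler_wpM2r // lerDl.
move=> /le_trans; apply.
by move: td; rewrite ler_pdivlMr ?ltr_wpDl // mulrC.
Unshelve. all: by end_near. Qed.

Lemma ana_cst k a : ana (fun _ => k) a.
Proof.
apply: (@expansion_ana (fun i => if i == 0%N then k else 0) 1 `|k|).
apply: (@expansion_lim (fun _ => k%:P)) => //.
- by move=> m; rewrite pnormC.
- by move=> i; rewrite coefC; exact: cvg_cst.
- by move=> t _; rewrite hornerC; exact: cvg_cst.
Qed.

Lemma ana_id a : ana (fun t => t) a.
Proof.
apply: (@expansion_ana (fun i => ('X + a%:P : {poly R})`_i) 1 (pnorm 1 ('X + a%:P))).
apply: (@expansion_lim (fun _ => 'X + a%:P)) => //.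
- by move=> i; exact: cvg_cst.
- by move=> t _; rewrite hornerD hornerX hornerC subrK; exact: cvg_cst.
Qed.

Lemma ana_expansion_fin (N : nat) (f : nat -> R -> R) a :
  (forall i, (i < N)%N -> ana (f i) a) ->
  exists (C : nat -> nat -> R) r rho,
    [/\ 0 < r, 0 <= rho & forall i, (i < N)%N -> expansion (C i) r rho (f i) a].
Proof.
elim: N => [_|N IH H]; first by exists (fun _ _ => 0), 1, 0.
have [|C [r [rho [r0 rho0 hC]]]] := IH.
  by move=> i iN; apply: H; rewrite ltnS ltnW.
have /ana_expansion [c [r' [rho' Hc]]] := H N (ltnSn N).
have [r'0 _ _] := Hc.
exists (fun i => if i == N then c else C i), (Num.min r r'), (Num.max rho rho').
have m0 : 0 < Num.min r r' by rewrite lt_min r0.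
split => //; first by rewrite le_max rho0.
move=> i; rewrite ltnS leq_eqVlt; case: eqVneq => [->|_ /= iN].
  by move=> _; apply: expansion_weaken (expansion_shrink m0 _ Hc);
     rewrite ?le_max ?ge_min ?lexx ?orbT.
by apply: expansion_weaken (expansion_shrink m0 _ (hC i iN));
     rewrite ?le_max ?ge_min ?lexx.
Qed.

Lemma ana_expansion2 g h a : ana g a -> ana h a ->
  exists c d r rho, expansion c r rho g a /\ expansion d r rho h a.
Proof.
move=> Hg Hh.
have [|C [r [rho [_ _ HC]]]] := @ana_expansion_fin 2 (fun i => if i == 0%N then g else h) a.
  by case=> [|[|]].
by exists (C 0%N), (C 1%N), r, rho; split; [exact: (HC 0%N)|exact: (HC 1%N)].
Qed.

Lemma anaD g h a : ana g a -> ana h a -> ana (fun t => g t + h t) a.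
Proof.
move=> Hg Hh; have [c [d [r [rho [[r0 c1 c2] [_ d1 d2]]]]]] := ana_expansion2 Hg Hh.
apply: (@expansion_ana (fun i => c i + d i) r (rho + rho)).
apply: (@expansion_lim (fun m => psum c m + psum d m)) => //.
- by move=> m; apply: le_trans (pnormD _ _ (ltW r0)) _; apply: lerD.
- move=> k; under eq_fun do rewrite coefD.
  by apply: cvgD; exact: psum_coef_cvg.
- move=> t tr; under eq_fun do rewrite hornerD.
  by apply: cvgD; [exact: c2|exact: d2].
Qed.

Lemma anaM g h a : ana g a -> ana h a -> ana (fun t => g t * h t) a.
Proof.
move=> Hg Hh; have [c [d [r [rho [H [_ d1 d2]]]]]] := ana_expansion2 Hg Hh.
have rho0 := expansion_rho_ge0 H; have [r0 c1 c2] := H.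
apply: (@expansion_ana (fun k => \sum_(j < k.+1) c j * d (k - j)%N) r (rho * rho)).
apply: (@expansion_lim (fun m => psum c m * psum d m)) => //.
- move=> m; apply: le_trans (pnormM _ _ (ltW r0)) _.
  by apply: ler_pM => //; apply: pnorm_ge0; apply: ltW.
- move=> k; under eq_fun do rewrite coefM.
  by apply: cvg_sumR => i _; apply: cvgM; exact: psum_coef_cvg.
- move=> t tr; under eq_fun do rewrite hornerM.
  by apply: cvgM; [exact: c2|exact: d2].
Qed.

Lemma anaZ k g a : ana g a -> ana (fun t => k * g t) a.
Proof. by move=> Hg; apply: anaM Hg; exact: ana_cst. Qed.

Lemma anaN g a : ana g a -> ana (fun t => - g t) a.
Proof.
move=> /(anaZ (-1)) H; apply: ana_ext H => t; by rewrite mulN1r.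
Qed.

Lemma anaB g h a : ana g a -> ana h a -> ana (fun t => g t - h t) a.
Proof. by move=> Hg Hh; apply: anaD => //; apply: anaN. Qed.

Lemma anaX g n a : ana g a -> ana (fun t => g t ^+ n) a.
Proof.
move=> Hg; elim: n => [|n IH].
  by apply: ana_ext (ana_cst 1 a) => t; rewrite expr0.
by apply: ana_ext (anaM Hg IH) => t; rewrite exprS.
Qed.

Lemma ana_sum (I : Type) (s : seq I) (P : pred I) (f : I -> R -> R) a :
  (forall i, P i -> ana (f i) a) -> ana (fun t => \sum_(i <- s | P i) f i t) a.
Proof.
move=> H; elim: s => [|i s IH].
  by apply: ana_ext (ana_cst 0 a) => t; rewrite big_nil.
case: (boolP (P i)) => Pi.
  apply: ana_ext (anaD (H i Pi) IH) => t.
  by rewrite big_cons Pi.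
by apply: ana_ext IH => t; rewrite big_cons (negbTE Pi).
Qed.

(** Substituting ['X + h] in a polynomial costs at most the replacement of the
    radius [r - |h|] by [r] in the norm, so a power series can be expanded
    again at any point of its disc of absolute convergence. *)
Lemma ana_recenter g a : ana g a -> \forall b \near a, ana g b.
Proof.
move=> /ana_expansion [c [r [rho H]]]; have [r0 c1 c2] := H.
have rho0 := expansion_rho_ge0 H.
exists r => //= b /= ab; pose h := b - a.
have hr : `|h| < r by rewrite /h distrC.
pose r' := r - `|h|; have r'0 : 0 < r' by rewrite subr_gt0.
pose X1 : {poly R} := 'X + h%:P.
have nX1 : pnorm r' X1 <= r.
  apply: le_trans (pnormD _ _ (ltW r'0)) _.
  by rewrite pnormC -['X]expr1 pnormXn expr1 subrK.
pose W m := psum c m \Po X1.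
have hW m : pnorm r' (W m) <= rho.
  apply: le_trans (pnorm_comp _ _ (ltW r'0)) _; apply: le_trans (c1 m).
  by apply: pnorm_le_r => //; apply: pnorm_ge0; apply: ltW.
have Wk m k : (W m)`_k = \sum_(j < m) c j * (X1 ^+ j)`_k.
  rewrite /W /psum poly_def rmorph_sum /= coef_sum; apply: eq_bigr => i _.
  by rewrite comp_polyZ comp_Xn_poly coefZ.
have hk k : cvgn (fun m => (W m)`_k).
  have -> : (fun m => (W m)`_k) = series (fun j => c j * (X1 ^+ j)`_k).
    by apply/funext => m; rewrite Wk /series /= big_mkord.
  apply: normed_cvg; apply: nondecreasing_is_cvgn.
    apply/nondecreasing_seqP => n; rewrite /= seriesSr.
    by rewrite lerDl.
  exists (rho / r' ^+ k) => _ [m _ <-]; rewrite /= seriesEord /=.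
  rewrite ler_pdivlMr ?exprn_gt0 // mulr_suml; apply: le_trans (c1 m).
  rewrite (@pnorm_sumE _ _ _ m) ?size_poly //; apply: ler_sum => i _.
  rewrite coef_poly ltn_ord normrM -mulrA ler_wpM2l //.
  apply: (@le_trans _ _ (pnorm r' (X1 ^+ i))).
    rewrite (@pnorm_sumE _ _ _ (maxn (size (X1 ^+ i)) k.+1)) ?leq_maxl //.
    have kk : (k < maxn (size (X1 ^+ i)) k.+1)%N by rewrite leq_maxr.
    rewrite (bigD1 (Ordinal kk)) //= lerDl; apply: sumr_ge0 => j _.
    by rewrite mulr_ge0 // exprn_ge0 // ltW.
  apply: le_trans (pnormX _ _ (ltW r'0)) _.
  by rewrite lerXn2r // nnegrE ?pnorm_ge0 // ltW.
apply: (@expansion_ana (fun k => limn (fun m => (W m)`_k)) r' rho).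
apply: (@expansion_lim W) => // t tb.
have -> : (fun m => (W m).[t - b]) = (fun m => (psum c m).[t - a]).
  apply/funext => m; rewrite /W horner_comp hornerD hornerX hornerC.
  by congr (_.[_]); rewrite /h; ring.
have ta : `|t - a| < r.
  have -> : t - a = (t - b) + h by rewrite /h addrA subrK.
  apply: le_lt_trans (ler_normD _ _) _.
  by rewrite -ltrBrDr.
exact: c2.
Qed.

Lemma ana_comp_exp g q : (0 < q)%N -> ana g 0 -> ana (fun t => g (t ^+ q)) 0.
Proof.
move=> q0 /ana_expansion [c [r [rho [r0 c1 c2]]]].
pose r' := Num.min r 1.
have r'0 : 0 < r' by rewrite lt_min r0 ltr01.
have r'1 : r' <= 1 by rewrite ge_min lexx orbT.
have r'q : r' ^+ q <= r.
  apply: (@le_trans _ _ (r' ^+ 1)); first by rewrite ler_wiXn2l // ltW.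
  by rewrite expr1 ge_min lexx.
apply: (@expansion_ana (fun k => if (q %| k)%N then c (k %/ q)%N else 0) r' rho).
apply: (@expansion_lim (fun m => psum c m \Po 'X^q)) => //.
- move=> m; apply: le_trans (pnorm_comp _ _ (ltW r'0)) _; apply: le_trans (c1 m).
  by rewrite pnormXn; apply: pnorm_le_r => //; apply: exprn_ge0; apply: ltW.
- move=> k; under eq_fun do rewrite coef_comp_poly_Xn //.
  by case: ifP => _; [exact: psum_coef_cvg|exact: cvg_cst].
- move=> t tr; under eq_fun do rewrite horner_comp hornerXn.
  have tq : `|t ^+ q - 0| < r.
    move: tr; rewrite !subr0 normrX => tr; apply: lt_le_trans r'q.
    by rewrite ltrXn2r // -?lt0n // nnegrE ltW.
  have := c2 _ tq; rewrite subr0.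
  by under eq_fun do rewrite -[t in (t ^+ q)]subr0.
Qed.

Lemma ana_affine g al be b : ana g (al * b + be) -> ana (fun t => g (al * t + be)) b.
Proof.
move=> /ana_expansion [c [r [rho [r0 c1 c2]]]].
have al0 : 0 < `|al| + 1 by rewrite ltr_wpDl.
pose r' := r / (`|al| + 1); have r'0 : 0 < r' by rewrite divr_gt0.
have r'r : `|al| * r' <= r.
  rewrite /r' mulrA ler_pdivrMr // mulrC ler_wpM2l ?(ltW r0) //.
  by rewrite lerDl.
apply: (@expansion_ana (fun k => al ^+ k * c k) r' rho).
apply: (@expansion_lim (fun m => psum c m \Po (al *: 'X))) => //.
- move=> m; apply: le_trans (pnorm_comp _ _ (ltW r'0)) _; apply: le_trans (c1 m).
  apply: pnorm_le_r; first by apply: pnorm_ge0; apply: ltW.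
  rewrite -mul_polyC; apply: le_trans (pnormM _ _ (ltW r'0)) _.
  by rewrite pnormC -['X]expr1 pnormXn expr1.
- move=> k.
  have -> : (fun m => (psum c m \Po (al *: 'X))`_k) =
            (fun m => (psum (fun i => al ^+ i * c i) m)`_k).
    apply/funext => m; congr (_`_k); rewrite /psum !poly_def raddf_sum /=.
    rewrite (eq_bigr (fun i : 'I_m => (al ^+ i * c i) *: 'X^i)) // => i _.
    by rewrite comp_polyZ comp_Xn_poly exprZn scalerA mulrC.
  exact: psum_coef_cvg.
- move=> t tr.
  have tq : `|(al * t + be) - (al * b + be)| < r.
    have -> : (al * t + be) - (al * b + be) = al * (t - b) by ring.
    rewrite normrM; apply: (@le_lt_trans _ _ ((`|al| + 1) * `|t - b|)).
      by rewrite ler_wpM2r // lerDl.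
    by move: tr; rewrite /r' ltr_pdivlMr // mulrC.
  have := c2 _ tq.
  have -> : (al * t + be) - (al * b + be) = al * (t - b) by ring.
  by under [X in _ -> X @ _ --> _]eq_fun do rewrite horner_comp hornerZ hornerX.
Qed.

(** A power series that is not zero is divided by its lowest monomial. *)
Lemma ana_order g a : ana g a ->
  (\forall t \near a, g t = 0) \/
  exists m u, [/\ ana u a, u a != 0 & \forall t \near a, g t = (t - a) ^+ m * u t].
Proof.
move=> /ana_expansion [c [r [rho H]]]; have [r0 c1 c2] := H.
have [[m hm]|hn] := pselect (exists m, c m != 0); last first.
  left; exists r => //= t; rewrite /ball /= distrC => tr.
  apply: (cvg_unique _ (c2 t tr)) => //.
  apply: cvg_near_cst; apply: nearW => n; rewrite horner_poly big1 // => i _.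
  have -> : c i = 0 by apply: contrapT => /eqP h; apply: hn; exists i.
  by rewrite mul0r.
right; have hex : exists m, c m != 0 by exists m.
case: (ex_minnP hex) => k ck kmin {m hm hex}.
pose u t := if t == a then c k else g t / (t - a) ^+ k.
suff hu : ana u a.
  exists k, u; split => //; first by rewrite /u eqxx.
  suff hgu t : g t = (t - a) ^+ k * u t by near=> t; exact: hgu.
  rewrite /u; case: eqVneq => [->|ta].
    rewrite subrr expr0n; case: eqVneq => [k0|k0].
      by rewrite mul1r (expansion0 H) k0.
    rewrite mul0r (expansion0 H); apply/eqP/negPn/negP => /kmin.
    by rewrite leqn0 (negbTE k0).
  by rewrite mulrCA divff ?mulr1 // expf_neq0 // subr_eq0.
have hp n : psum c (k + n) = 'X^k * psum (fun i => c (k + i)%N) n.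
  apply/polyP => i; rewrite coefXnM !coef_poly; case: (ltnP i k) => ik.
    case: ifP => // _; apply/eqP; apply: contraT => /kmin.
    by rewrite leqNgt ik.
  by rewrite ltn_subLR // subnKC.
apply: (@expansion_ana (fun i => c (k + i)%N) r (rho / r ^+ k)); split => //.
  move=> n; rewrite ler_pdivlMr ?exprn_gt0 //; apply: le_trans (c1 (k + n)%N).
  rewrite (@pnorm_sumE _ _ _ n) ?size_poly // mulr_suml.
  rewrite (@pnorm_sumE _ _ _ (k + n)%N) ?size_poly // big_split_ord /=.
  rewrite addrC -[leLHS]addr0; apply: lerD.
    apply: ler_sum => i _; rewrite !coef_poly ltn_ord ltn_add2l ltn_ord.
    by rewrite -mulrA -exprD addnC.
  by apply: sumr_ge0 => i _; rewrite mulr_ge0 // exprn_ge0 // ltW.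
move=> t tr; rewrite /u; case: eqVneq => [->|ta].
  rewrite subrr; apply: cvg_near_cst; near=> n.
  rewrite horner_coef0 coef_poly addn0 ifT //.
  by near: n; exact: nbhs_infty_gt.
have tak : (t - a) ^+ k != 0 by rewrite expf_neq0 // subr_eq0.
have -> : (fun n => (psum (fun i => c (k + i)%N) n).[t - a]) =
  (fun n => (psum c (n + k)%N).[t - a] / (t - a) ^+ k).
  apply/funext => n; rewrite addnC hp hornerM hornerXn mulrAC divff ?mul1r //.
apply: cvgMr_tmp.
have := c2 t tr; rewrite -(cvg_shiftn k); exact.
Unshelve. all: by end_near. Qed.

End Analytic.

(** * Analytic implicit functions *)

Section ImplicitFunction.
Variable R : realType.
Implicit Types (g h y z : R -> R) (a r rho t : R) (c : nat -> R).

(** A vanishing constant term gains the factor by which the radius shrinks;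
    this makes the constant and linear terms of the fixed point equation below
    small. *)
Lemma pnorm_shrink r k (p : {poly R}) : 0 <= r -> 0 <= k <= 1 -> p`_0 = 0 ->
  pnorm (k * r) p <= k * pnorm r p.
Proof.
move=> r0 /andP[k0 k1] p0; rewrite !(pnorm_sumE _ (leqnn _)) mulr_sumr.
apply: ler_sum => -[[|i] hi] _ /=; first by rewrite p0 normr0 !mul0r mulr0.
rewrite mulrCA ler_wpM2l // exprMn ler_wpM2r ?exprn_ge0 // exprS.
by rewrite ler_piMr // exprn_ile1.
Qed.

Lemma psum_cvg c r rho x : (forall n, pnorm r (psum c n) <= rho) -> `|x| <= r ->
  cvgn (fun n => (psum c n).[x]).
Proof.
move=> hc xr.
have -> : (fun n => (psum c n).[x]) = series (fun j => c j * x ^+ j).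
  by apply/funext => n; rewrite /series /= big_mkord horner_poly.
apply: normed_cvg; apply: nondecreasing_is_cvgn.
  by apply/nondecreasing_seqP => n; rewrite /= seriesSr lerDl.
exists rho => _ [m _ <-]; rewrite /= seriesEord /=.
apply: le_trans (hc m); rewrite (@pnorm_sumE _ _ _ m) ?size_poly //.
apply: ler_sum => i _; rewrite coef_poly ltn_ord normrM normrX ler_wpM2l //.
by rewrite lerXn2r // nnegrE (le_trans _ xr).
Qed.

(** The right-hand side of the equation [y = sum of e_i(t) y^i], on partial
    sums of the power series of the [e_i]. *)
Definition picard (C : nat -> nat -> R) N n (Z : {poly R}) : {poly R} :=
  \sum_(i < N) psum (C i) n * Z ^+ i.

Fixpoint picard_iter (C : nat -> nat -> R) N k : {poly R} :=
  if k is k'.+1 then take_poly k (picard C N k (picard_iter C N k')) else 0.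

Lemma picard_iter0 C N k : C 0%N 0%N = 0 -> C 1%N 0%N = 0 ->
  (picard_iter C N k)`_0 = 0.
Proof.
move=> C0 C1; elim: k => [|k IH]; first by rewrite coef0.
rewrite /= coef_take_poly /= /picard coef_sum big1 // => -[[|[|i]] hi] _ /=.
- by rewrite expr0 mulr1 coef_poly C0.
- by rewrite expr1 coefM big_ord1 coef_poly /= C1 mul0r.
- by rewrite exprS mulrCA coefM big_ord1 IH mul0r.
Qed.

Lemma dvdXn_sub_take n (p : {poly R}) : dvdp 'X^n (p - take_poly n p).
Proof.
by rewrite -{1}(poly_take_drop n p) addrC addKr dvdp_mull.
Qed.

Lemma dvdXn_coef n (p : {poly R}) i : dvdp 'X^n (p) -> (i < n)%N -> p`_i = 0.
Proof. by move=> /dvdpP[q ->] i_n; rewrite coefMXn i_n. Qed.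

Lemma coef0_dvdX (p : {poly R}) : p`_0 = 0 -> dvdp 'X (p).
Proof.
move=> p0; have := dvdXn_sub_take 1 p.
have -> : take_poly 1 p = 0.
  by apply/polyP => -[|i]; rewrite coef_take_poly coef0.
by rewrite subr0 expr1.
Qed.

(** Each Picard step gains one correct coefficient, because the linear term of
    the equation vanishes at the centre and the other terms are at least
    quadratic in an unknown that vanishes there. *)
Lemma picard_iter_stable C N k : C 0%N 0%N = 0 -> C 1%N 0%N = 0 ->
  dvdp 'X^k (picard_iter C N k.+1 - picard_iter C N k).
Proof.
move=> C0 C1; elim: k => [|k IH]; first by rewrite expr0 dvd1p.
set Z1 := picard_iter C N k.+1 in IH *; set Z0 := picard_iter C N k in IH *.
have H1 : dvdp 'X^(k.+1) (picard C N k.+2 Z1 - picard_iter C N k.+2).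
  have h := dvdXn_sub_take k.+2 (picard C N k.+2 Z1).
  exact: (dvdp_trans (dvdp_exp2l _ (leqnSn _)) h).
have H0 : dvdp 'X^(k.+1) (picard C N k.+1 Z0 - Z1) by exact: dvdXn_sub_take.
have H : dvdp 'X^(k.+1) (picard C N k.+2 Z1 - picard C N k.+1 Z0).
  rewrite /picard -sumrB; apply: (big_ind (dvdp 'X^(k.+1))) => [|p q|i _]; rewrite ?dvdp0 //.
    exact: dvdp_add.
  have -> : psum (C i) k.+2 * Z1 ^+ i - psum (C i) k.+1 * Z0 ^+ i =
    (psum (C i) k.+2 - psum (C i) k.+1) * Z1 ^+ i +
    psum (C i) k.+1 * (Z1 ^+ i - Z0 ^+ i) by ring.
  apply: dvdp_add.
    by apply: dvdp_mulr; rewrite -(take_psum (C i) (leqnSn k.+1)) dvdXn_sub_take.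
  case: i => -[|[|i]] hi /=.
  - by rewrite !expr0 subrr mulr0 dvdp0.
  - rewrite !expr1 exprS; apply: dvdp_mul => //; apply: coef0_dvdX.
    by rewrite coef_poly C1.
  - apply: dvdp_mull; rewrite subrXX mulrC exprS; apply: dvdp_mul => //.
    have XZ1 : dvdp 'X (Z1) by apply: coef0_dvdX; exact: picard_iter0.
    have XZ0 : dvdp 'X (Z0) by apply: coef0_dvdX; exact: picard_iter0.
    apply: (big_ind (dvdp 'X)) => [|p q|[j hj] _]; rewrite ?dvdp0 //; first exact: dvdp_add.
    rewrite /=; case: j hj => [|j] hj.
      by rewrite subn0 /= exprS dvdp_mulr // dvdp_mulr.
    by rewrite exprS; apply: dvdp_mull; rewrite dvdp_mulr.
have -> : picard_iter C N k.+2 - Z1 =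
  (picard C N k.+2 Z1 - picard C N k.+1 Z0) + (picard C N k.+1 Z0 - Z1)
  - (picard C N k.+2 Z1 - picard_iter C N k.+2) by ring.
by rewrite dvdp_sub // dvdp_add.
Qed.

Lemma picard_iter_coef C N k m : C 0%N 0%N = 0 -> C 1%N 0%N = 0 -> (k < m)%N ->
  (picard_iter C N m)`_k = (picard_iter C N k.+1)`_k.
Proof.
move=> C0 C1; elim: m => // m IH; rewrite ltnS leq_eqVlt.
case: eqVneq => [-> //|_ /= km]; rewrite -IH //.
have /dvdXn_coef := picard_iter_stable N m C0 C1.
by move=> /(_ _ km); rewrite coefB => /eqP; rewrite subr_eq0 => /eqP.
Qed.

(** The iterates stay in a small ball of the weighted norm and their
    coefficients are eventually constant, so their limit is analytic; it
    solves the equation because the right-hand side at an iterate differs from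
    the next iterate only by terms of high degree, which tend to zero. *)
Lemma analytic_fixpoint N (e : nat -> R -> R) a :
  (forall i, (i < N)%N -> ana (e i) a) -> e 0%N a = 0 -> e 1%N a = 0 ->
  (1 < N)%N ->
  exists z, [/\ ana z a, z a = 0 &
    \forall t \near a, z t = \sum_(i < N) e i t * z t ^+ i].
Proof.
move=> He e0 e1 N1; have [C [r0 [E [r00 E0 HC]]]] := ana_expansion_fin He.
have C0 : C 0%N 0%N = 0 by rewrite -(expansion0 (HC 0%N (ltnW N1))).
have C1 : C 1%N 0%N = 0 by rewrite -(expansion0 (HC 1%N N1)).
(* The ball of radius rho is stable under the iteration once the quadratic
   terms contribute at most rho / 3 and the radius r is small enough for the
   constant and linear terms to contribute at most rho / 3 each. *)
pose rho := (3 * N%:R * E + 1)^-1.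
have D0 : 0 < 3 * N%:R * E + 1 by rewrite ltr_wpDl // !mulr_ge0.
have rho0 : 0 < rho by rewrite invr_gt0.
have rho1 : rho <= 1 by rewrite invf_le1 // lerDr !mulr_ge0.
have NE : N%:R * E * rho <= 3^-1.
  rewrite ler_pdivrMr // mulrDr mulr1 -!mulrA mulKf ?pnatr_eq0 //.
  by rewrite lerDl invr_ge0.
pose k := rho / (3 * (E + 1)).
have E1 : 0 < E + 1 by rewrite ltr_wpDl.
have k0 : 0 < k by rewrite divr_gt0 // mulr_gt0.
have kE : k * E <= rho / 3.
  have -> : k * E = rho / 3 * (E / (E + 1)) by rewrite /k; field; rewrite gt_eqF.
  by rewrite ler_piMr ?divr_ge0 ?(ltW rho0) // ler_pdivrMr // mul1r lerDl.
have k1 : k <= 1.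
  rewrite ler_pdivrMr ?mulr_gt0 // mul1r (le_trans rho1) // mulrDr mulr1.
  by rewrite ler_wpDl ?mulr_ge0 // ler1n.
pose r := k * r0; have r_gt0 : 0 < r by rewrite mulr_gt0.
have r_ge0 := ltW r_gt0.
have rr0 : r <= r0 by rewrite ler_piMl // ltW.
pose Z := picard_iter C N.
have HC2 i n : (i < N)%N -> pnorm r (psum (C i) n) * rho ^+ i <=
    (i == 0%N)%:R * (rho / 3) + (i == 1%N)%:R * (rho / 3) + E * rho ^+ 2.
  move=> iN; have [_ hC _] := HC i iN.
  have small : (psum (C i) n)`_0 = 0 -> pnorm r (psum (C i) n) <= rho / 3.
    move=> h0; apply: le_trans (pnorm_shrink (ltW r00) _ h0) _.
      by rewrite k1 ltW.
    by apply: le_trans kE; rewrite ler_wpM2l // ltW.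
  have E2 : 0 <= E * rho ^+ 2 by rewrite mulr_ge0 // exprn_ge0 // ltW.
  case: i iN hC small => [|[|i]] iN hC small /=.
  - rewrite expr0 mulr1 mul1r mul0r addr0 ler_wpDr //; apply: small.
    by rewrite coef_poly C0 if_same.
  - rewrite mul0r add0r mul1r ler_wpDr //; have h1 : (psum (C 1%N) n)`_0 = 0 by rewrite coef_poly C1 if_same.
    apply: le_trans (small h1).
    by rewrite expr1 ler_piMr // pnorm_ge0.
  - rewrite !mul0r !add0r; apply: ler_pM => //.
    + exact: pnorm_ge0.
    + by rewrite exprn_ge0 // ltW.
    + by apply: le_trans (hC n); exact: pnorm_le_r.
    + by rewrite ler_wiXn2l // ltW.
have Hpic n P : pnorm r P <= rho -> pnorm r (picard C N n P) <= rho.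
  move=> hP; rewrite /picard.
  apply: le_trans (pnorm_sum _ _ _ r_ge0) _.
  apply: (@le_trans _ _ (\sum_(i < N) ((i == 0%N :> nat)%:R * (rho / 3) +
       (i == 1%N :> nat)%:R * (rho / 3) + E * rho ^+ 2))).
    apply: ler_sum => i _; apply: le_trans (HC2 i n (ltn_ord i)).
    apply: le_trans (pnormM _ _ r_ge0) _; apply: ler_wpM2l.
      exact: pnorm_ge0.
    apply: le_trans (pnormX _ _ r_ge0) _.
    by rewrite lerXn2r // nnegrE ?pnorm_ge0 // ltW.
  rewrite !big_split /= -!mulr_suml sumr_const card_ord.
  have ind j : \sum_(i < N) (i == j :> nat)%:R <= 1 :> R.
    case: (ltnP j N) => jN.
      rewrite (bigD1 (Ordinal jN)) //= eqxx big1 ?addr0 // => i /negbTE.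
      by rewrite -val_eqE /= => ->.
    by rewrite big1 // => i _; rewrite ltn_eqF // (leq_trans (ltn_ord i)).
  have r3 : 0 <= rho / 3 by rewrite divr_ge0 // ltW.
  have h0 := ler_wpM2r r3 (ind 0%N); have h1 := ler_wpM2r r3 (ind 1%N).
  have h2 : (E * rho ^+ 2) *+ N <= rho / 3.
    rewrite -mulr_natl expr2 mulrA mulrA [leRHS]mulrC.
    by rewrite ler_wpM2r // ltW.
  by move: h0 h1 h2; rewrite !mul1r; lra.
have HZ m : pnorm r (Z m) <= rho.
  elim: m => [|m IH]; first by rewrite pnorm0 ltW.
  by apply: le_trans (pnorm_take _ _ r_ge0) _; exact: Hpic.
pose zc j := (Z j.+1)`_j.
have Zpsum m : psum zc m = Z m.
  apply/polyP => j; rewrite coef_poly; case: ltnP => jm.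
    by rewrite /zc /Z (picard_iter_coef N C0 C1 jm).
  case: m jm => [|m] jm; first by rewrite coef0.
  by rewrite /Z /= coef_take_poly ltnNge jm.
pose z t := limn (fun n => (psum zc n).[t - a]).
have zexp : expansion zc r rho z a.
  split=> // [n|t tr]; first by rewrite Zpsum.
  by apply: (@psum_cvg zc r rho) => [n|]; [rewrite Zpsum|exact: ltW].
exists z; split; first exact: expansion_ana zexp.
  by rewrite (expansion0 zexp) /zc picard_iter0.
have := near_dist a r_gt0; apply: filterS => t tr; have [_ _ hz] := zexp.
have tr0 : `|t - a| < r0 by apply: lt_le_trans rr0.
pose th := `|t - a| / r.
have th0 : 0 <= th by rewrite divr_ge0.
have th1 : th < 1 by rewrite ltr_pdivrMr // mul1r.
have lim1 : (picard C N n.+1 (Z n)).[t - a] @[n --> \oo] -->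
            \sum_(i < N) e i t * z t ^+ i.
  have -> : (fun n => (picard C N n.+1 (Z n)).[t - a]) = (fun n =>
     \sum_(i < N) (psum (C i) (n + 1)%N).[t - a] * (psum zc n).[t - a] ^+ i).
    apply/funext => n; rewrite /picard horner_sum; apply: eq_bigr => i _.
    by rewrite hornerM horner_exp Zpsum addn1.
  apply: cvg_sumR => i _; apply: cvgM.
    have [_ _ /(_ _ tr0)] := HC i (ltn_ord i).
    by rewrite -(cvg_shiftn 1).
  by apply: cvg_exp; exact: hz.
have lim2 : (picard C N n.+1 (Z n)).[t - a] @[n --> \oo] --> z t.
  have -> : (fun n => (picard C N n.+1 (Z n)).[t - a]) = (fun n =>
     ((picard C N n.+1 (Z n)).[t - a] - (Z (n + 1)%N).[t - a])
     + (psum zc (n + 1)%N).[t - a]).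
    by apply/funext => n; rewrite Zpsum subrK.
  rewrite -[z t]add0r; apply: cvgD; last first.
    by have := hz t tr; rewrite -(cvg_shiftn 1).
  apply/norm_cvg0P.
  apply: (squeeze_cvgr (f := fun _ => 0) (h := fun n => rho * th ^+ n)).
  - apply: nearW => n /=; rewrite normr_ge0 addn1 /=.
    have := @horner_tail R r (picard C N n.+1 (Z n)) n.+1 (t - a) th r_ge0.
    rewrite th0 (ltW th1) /th divfK ?gt_eqF // => /(_ isT (lexx _)) /le_trans.
    apply; rewrite -/th; apply: ler_pM; rewrite ?pnorm_ge0 ?exprn_ge0 ?Hpic //.
    by rewrite exprS ler_piMl ?exprn_ge0 // ltW.
  - exact: cvg_cst.
  - rewrite -[0](mulr0 rho); apply: cvgMl_tmp; apply: cvg_expr.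
    by rewrite ger0_norm.
exact: (cvg_unique _ lim2 lim1).
Qed.

(** Polynomials in [y] with coefficients analytic in [t]. The bound on the
    degrees makes evaluation and composition finite sums of products of germs.
    *)
Definition pana (A : R -> {poly R}) a :=
  (exists N, forall t, (size (A t) <= N)%N) /\
  forall i, ana (fun t => (A t)`_i) a.

Lemma pana_near_cvg A a i : pana A a -> (A t)`_i @[t --> a] --> (A a)`_i.
Proof. by move=> [_ hA]; exact: (ana_cvg (hA i)). Qed.

Lemma panaC g a : ana g a -> pana (fun t => (g t)%:P) a.
Proof.
move=> Hg; split; first by exists 1%N => t; exact: size_polyC_leq1.
move=> i; apply: (@ana_ext _ (fun t => if i == 0%N then g t else 0)).
  by move=> t; rewrite coefC.
by case: (i == 0%N); [exact: Hg|exact: ana_cst].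
Qed.

Lemma pana_cst p a : pana (fun _ => p) a.
Proof. by split; [exists (size p)|move=> i; exact: ana_cst]. Qed.

Lemma panaD A B a : pana A a -> pana B a -> pana (fun t => A t + B t) a.
Proof.
move=> [[M hM] hA] [[N hN] hB]; split.
  exists (maxn M N) => t; apply: leq_trans (size_polyD _ _) _.
  by rewrite geq_max !leq_max hM hN orbT.
move=> i; apply: ana_ext (anaD (hA i) (hB i)) => t; by rewrite coefD.
Qed.

Lemma panaM A B a : pana A a -> pana B a -> pana (fun t => A t * B t) a.
Proof.
move=> [[M hM] hA] [[N hN] hB]; split.
  exists (M + N)%N => t; apply: leq_trans (size_polyMleq _ _) _.
  by apply: leq_trans (leq_pred _) _; exact: leq_add.
move=> i; apply: (@ana_ext _ (fun t => \sum_(j < i.+1) (A t)`_j * (B t)`_(i - j))).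
  by move=> t; rewrite coefM.
by apply: ana_sum => j _; apply: anaM.
Qed.

Lemma pana_sum (I : Type) (s : seq I) (P : pred I) (A : I -> R -> {poly R}) a :
  (forall i, P i -> pana (A i) a) -> pana (fun t => \sum_(i <- s | P i) A i t) a.
Proof.
move=> H; elim: s => [|i s IH].
  have -> : (fun t => \sum_(i <- [::] | P i) A i t) = (fun _ => 0).
    by apply/funext => t; rewrite big_nil.
  exact: pana_cst.
have -> : (fun t => \sum_(j <- i :: s | P j) A j t) =
  (fun t => (if P i then A i t else 0) + \sum_(j <- s | P j) A j t).
  by apply/funext => t; rewrite big_cons; case: (P i); rewrite ?add0r.
apply: panaD IH; case: (boolP (P i)) => Pi; first exact: H.
exact: pana_cst.
Qed.

Lemma panaX A n a : pana A a -> pana (fun t => A t ^+ n) a.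
Proof.
move=> hA; elim: n => [|n IH].
  have -> : (fun t => A t ^+ 0) = (fun _ => 1) by apply/funext => t; rewrite expr0.
  exact: pana_cst.
have -> : (fun t => A t ^+ n.+1) = (fun t => A t * A t ^+ n).
  by apply/funext => t; rewrite exprS.
exact: panaM.
Qed.

Lemma pana_comp A B a : pana A a -> pana B a -> pana (fun t => A t \Po B t) a.
Proof.
move=> [[N hN] hA] hB.
have -> : (fun t => A t \Po B t) =
   (fun t => \sum_(i < N) ((A t)`_i)%:P * B t ^+ i).
  apply/funext => t; rewrite comp_polyE.
  rewrite (big_ord_widen N (fun i => (A t)`_i *: B t ^+ i)) // big_mkcond /=.
  apply: eq_bigr => i _; case: ltnP => hi; first by rewrite mul_polyC.
  by rewrite nth_default // mul0r.
by apply: pana_sum => i _; apply: panaM; [exact: panaC|exact: panaX].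
Qed.

Lemma cvg_horner_coef (F : set_system R) (FF : Filter F) N (A : R -> {poly R}) (P : {poly R}) y (y0 : R) :
  (forall t, (size (A t) <= N)%N) -> (size P <= N)%N ->
  (forall i, (A t)`_i @[t --> F] --> P`_i) -> y t @[t --> F] --> y0 ->
  (A t).[y t] @[t --> F] --> P.[y0].
Proof.
move=> hN PN hA hy; rewrite (@horner_coef_wide _ N) //.
have -> : (fun t => (A t).[y t]) = (fun t => \sum_(i < N) (A t)`_i * y t ^+ i).
  by apply/funext => t; rewrite (@horner_coef_wide _ N).
by apply: cvg_sumR => i _; apply: cvgM => //; exact: cvg_exp.
Qed.

(** The divided difference of a polynomial tends to its derivative, so near a
    simple root there is only one root. *)
Lemma simple_root_unique (F : set_system R) (FF : ProperFilter F) N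
    (A : R -> {poly R}) (P : {poly R}) y z (y0 : R) :
  (forall t, (size (A t) <= N)%N) -> (size P <= N)%N ->
  (forall i, (A t)`_i @[t --> F] --> P`_i) ->
  y t @[t --> F] --> y0 -> z t @[t --> F] --> y0 -> P^`().[y0] != 0 ->
  (\forall t \near F, (A t).[y t] = 0) -> (\forall t \near F, (A t).[z t] = 0) ->
  \forall t \near F, y t = z t.
Proof.
move=> hN PN hA hy hz P1 Ay Az.
pose G t := \sum_(i < N) (A t)`_i * \sum_(j < i) y t ^+ (i.-1 - j) * z t ^+ j.
have Gfac t : (A t).[y t] - (A t).[z t] = (y t - z t) * G t.
  rewrite !(@horner_coef_wide _ N (A t)) // -sumrB /G mulr_sumr.
  by apply: eq_bigr => i _; rewrite -mulrBr subrXX mulrCA.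
have hG : G t @[t --> F] --> P^`().[y0].
  have -> : P^`().[y0] = \sum_(i < N) P`_i * \sum_(j < i) y0 ^+ (i.-1 - j) * y0 ^+ j.
    have -> : P = \sum_(i < N) P`_i *: 'X^i.
      rewrite -poly_def; apply/polyP => i; rewrite coef_poly; case: ltnP => // h.
      by rewrite nth_default // (leq_trans PN).
    rewrite raddf_sum /= horner_sum; apply: eq_bigr => i _.
    rewrite derivZ derivXn hornerZ hornerMn hornerXn.
    have -> : (\sum_(i0 < N) P`_i0 *: 'X^i0)`_i = P`_i.
      rewrite coef_sum (bigD1 i) //= coefZ coefXn eqxx mulr1 big1 ?addr0 //.
      move=> j ji; rewrite coefZ coefXn (_ : (i == j :> nat) = false) ?mulr0 //.
      by rewrite eq_sym; exact: negbTE.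
    congr (_ * _); rewrite -[LHS]mulr_natl.
    transitivity (\sum_(j < i) y0 ^+ i.-1).
      by rewrite sumr_const card_ord mulr_natl.
    apply: eq_bigr => j _; rewrite -exprD subnK //.
    by case: (nat_of_ord i) j => [[]//|k] j /=; rewrite -ltnS.
  apply: cvg_sumR => i _; apply: cvgM => //.
  by apply: cvg_sumR => j _; apply: cvgM; exact: cvg_exp.
near=> t.
have G0 : G t != 0.
  by near: t; apply: (@cvgr_neq0 _ _ _ _ _ _ _ hG).
have : (y t - z t) * G t == 0.
  rewrite -Gfac.
  have -> : (A t).[y t] = 0 by near: t.
  have -> : (A t).[z t] = 0 by near: t.
  by rewrite subrr.
by rewrite mulf_eq0 (negbTE G0) orbF subr_eq0 => /eqP.
Unshelve. all: by end_near. Qed.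

(** Translating the root to zero and dividing by the derivative there turns
    the equation into a fixed point equation whose constant and linear
    coefficients vanish at the centre. *)
Theorem implicit_function A a (y0 : R) : pana A a -> (A a).[y0] = 0 ->
  (A a)^`().[y0] != 0 ->
  exists z, [/\ ana z a, z a = y0 & \forall t \near a, (A t).[z t] = 0].
Proof.
move=> hA Ay0 Ad; set b := (A a)^`().[y0] in Ad.
pose B t := A t \Po ('X + y0%:P).
have [[N hN] hB] : pana B a by apply: pana_comp => //; exact: pana_cst.
have B0 : (B a)`_0 = 0.
  by rewrite -horner_coef0 horner_comp hornerD hornerX hornerC add0r.
have B1 : (B a)`_1 = b.
  rewrite -[LHS]mulr1n -(coef_deriv (B a) 0) -horner_coef0 deriv_comp.
  rewrite derivD derivX derivC addr0 mulr1 horner_comp.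
  by rewrite hornerD hornerX hornerC add0r.
pose e i t := if i == 1%N then 1 - (B t)`_1 / b else - ((B t)`_i / b).
have [|||z [z1 z2 z3]] := @analytic_fixpoint N.+2 e a _ _ _ isT.
- move=> i _; rewrite /e; case: eqP => _.
    by apply: anaB; [exact: ana_cst|apply: anaM (ana_cst _ _)].
  by apply: anaN; apply: anaM (ana_cst _ _).
- by rewrite /e /= B0 mul0r oppr0.
- by rewrite /e /= B1 divff // subrr.
exists (fun t => z t + y0); split.
- by apply: anaD => //; exact: ana_cst.
- by rewrite z2 add0r.
apply: filterS z3 => t zt.
have -> : (A t).[z t + y0] = (B t).[z t] by rewrite horner_comp hornerD hornerX hornerC.
rewrite (@horner_coef_wide _ N.+2); last by rewrite (leq_trans (hN t)) // ltnW.
have key : \sum_(i < N.+2) e i t * z t ^+ i =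
           z t - (\sum_(i < N.+2) (B t)`_i * z t ^+ i) / b.
  have dz : \sum_(i < N.+2) (i == 1%N :> nat)%:R * z t ^+ i = z t.
    rewrite (bigD1 (lift ord0 ord0)) //= mul1r expr1 big1 ?addr0 // => j.
    by rewrite -val_eqE /= => /negbTE ->; rewrite mul0r.
  rewrite -[X in _ = X - _]dz mulr_suml -sumrB; apply: eq_bigr => i _.
  rewrite /e; case: eqP => [->|_] /=; rewrite ?mul1r ?mul0r; ring.
move: zt; rewrite key => /eqP; rewrite eq_sym -subr_eq0 addrAC subrr add0r.
by rewrite oppr_eq0 mulf_eq0 invr_eq0 (negbTE Ad) orbF => /eqP.
Qed.

(** A continuous simple root coincides with the analytic one by local
    uniqueness. *)
Theorem simple_root_ana A a y : pana A a -> y t @[t --> a] --> y a ->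
  (\forall t \near a, (A t).[y t] = 0) -> (A a)^`().[y a] != 0 -> ana y a.
Proof.
move=> hA hy Ay Ad; have Aa : (A a).[y a] = 0 by exact: nbhs_singleton Ay.
have [z [z1 z2 z3]] := implicit_function hA Aa Ad.
have [[N hN] _] := hA; apply: (ana_near _ (z1)).
apply: (@simple_root_unique (nbhs a) _ N A (A a) z y (y a)) => //.
- by move=> i; exact: (pana_near_cvg hA).
- by rewrite -z2; exact: (ana_cvg z1).
Qed.

(** The inverse of [g] is the simple root of [g y - 1]. *)
Lemma anaV g a : ana g a -> g a != 0 -> ana (fun t => (g t)^-1) a.
Proof.
move=> hg ga; apply: (@simple_root_ana (fun t => (g t)%:P * 'X - 1)).
- apply: panaD; last exact: pana_cst.
  by apply: panaM; [exact: panaC|exact: pana_cst].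
- by apply: cvgV => //; exact: ana_cvg.
- have : \forall t \near a, g t != 0 by exact: (cvgr_neq0 _ (ana_cvg hg) ga).
  apply: filterS => t gt.
  by rewrite hornerD hornerM hornerC hornerX hornerN hornerC divff // subrr.
- rewrite derivB derivM derivC derivX mul0r add0r mulr1 -[1]/(1%:P) derivC.
  by rewrite subr0 hornerC.
Qed.

Lemma ana_div g h a : ana g a -> ana h a -> h a != 0 -> ana (fun t => g t / h t) a.
Proof. by move=> Hg Hh ha; apply: anaM => //; exact: anaV. Qed.

Lemma ana_punctured g a : ana g a -> (\forall t \near a, g t = 0) \/
  exists2 d, 0 < d & forall t, 0 < `|t - a| < d -> g t != 0.
Proof.
move=> /ana_order[|[m [u [hu ua hg]]]]; [by left|right].
have hu' : \forall t \near a, u t != 0 by exact: (cvgr_neq0 _ (ana_cvg hu) ua).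
have [d d0 hd] : \forall t \near a, g t = (t - a) ^+ m * u t /\ u t != 0.
  by near=> t; split; near: t.
exists d => // t /andP[ta td].
have [-> ut] : g t = (t - a) ^+ m * u t /\ u t != 0 by apply: hd; rewrite /ball /= distrC.
by rewrite mulf_neq0 // expf_neq0 // -normr_gt0.
Unshelve. all: by end_near. Qed.

(** The points near which an analytic function vanishes identically form a set
    that is open and, since zeros of a nonzero germ are isolated, closed. *)
Lemma ana_identity g u v s : (forall t, u < t < v -> ana g t) -> u < s < v ->
  (\forall t \near s, g t = 0) -> forall t, u < t < v -> \forall x \near t, g x = 0.
Proof.
move=> hg hs gs t ht.
pose Z := [set x : R | \forall y \near x, g y = 0].
pose W := [set x : R | \forall y \near x, ~ Z y].
pose I := `[Num.min s t, Num.max s t]%classic.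
have II x : I x -> u < x < v.
  rewrite /I /= in_itv /= ge_min le_max => /andP[h1 h2].
  apply/andP; split.
    by move: hs ht => /andP[us _] /andP[ut _]; case/orP: h1; apply: lt_le_trans.
  by move: hs ht => /andP[_ us] /andP[_ ut]; case/orP: h2 => /le_lt_trans; apply.
have ZW x : I x -> ~ Z x -> W x.
  move=> /II/hg/ana_punctured[//|[d d0 hd]] nZ; exists d => // y xy Zy.
  have [yx|yx] := eqVneq y x; first by apply: nZ; rewrite -yx.
  have : 0 < `|y - x| < d by rewrite normr_gt0 subr_eq0 yx distrC.
  by move=> /hd /eqP; apply; exact: nbhs_singleton Zy.
have IZ : I `&` Z = I.
  apply: (@segment_connected R (Num.min s t) (Num.max s t) (I `&` Z)).
  - exists s; split => //; rewrite /I /= in_itv /=.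
    by rewrite ge_min le_max !lexx.
  - by exists Z => //; exact: open_interior.
  - exists (~` W); first by apply: open_closedC; exact: open_interior.
    rewrite predeqE => x; split => [[Ix Zx]|[Ix Wx]]; split => //.
      by move=> /nbhs_singleton.
    by apply: contrapT => nZ; apply: Wx; exact: ZW.
have : I t by rewrite /I /= in_itv /= ge_min le_max !lexx !orbT.
by rewrite -IZ => -[].
Qed.

Lemma ana_identityT g (s : R) : (forall t, ana g t) -> (\forall t \near s, g t = 0) ->
  forall t, g t = 0.
Proof.
move=> hg hs t; apply: (@nbhs_singleton R t (fun x => g x = 0)).
apply: (@ana_identity g (Num.min s t - 1) (Num.max s t + 1) s) => //.
  by rewrite ltrBlDr gt_min ltrDl ltr01 /= (@le_lt_trans _ _ (Num.max s t)) ?le_max ?lexx // ltrDl.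
by rewrite ltrBlDr gt_min ltrDl ltr01 orbT /= (@le_lt_trans _ _ (Num.max s t)) ?le_max ?lexx ?orbT // ltrDl.
Qed.

End ImplicitFunction.

(** * Semialgebraic conditions *)

Section Semialgebraic.
Variable R : realType.

(** Points of all the spaces [R^d] at once: a subset or a function of [R^d] is
    represented by one on sequences that depends on the first [d] entries.
    Adding, fixing or eliminating a variable then needs no change of type. *)
Definition env := nat -> R.
Implicit Types (e u : env) (P Q : env -> Prop) (f g : env -> R) (F : nat -> env -> R).

Definition upd e (d : nat) (y : R) : env := fun i => if i == d then y else e i.
Definition trunc k e : env := fun i => if (i < k)%N then e i else 0.
Definition shift k e : env := fun i => e (i + k)%N.
Definition unshift k e : env := fun i => if (i < k)%N then 0 else e (i - k)%N.
Definition dep (T : Type) k (f : env -> T) :=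
  forall e e', (forall i, (i < k)%N -> e i = e' i) -> f e = f e'.

Inductive polyf : (env -> R) -> Prop :=
| polyf_cst c : polyf (fun _ => c)
| polyf_var i : polyf (fun e => e i)
| polyfD f g : polyf f -> polyf g -> polyf (fun e => f e + g e)
| polyfM f g : polyf f -> polyf g -> polyf (fun e => f e * g e).

Inductive sa : (env -> Prop) -> Prop :=
| sa_pos f : polyf f -> sa (fun e => 0 < f e)
| sa_not P : sa P -> sa (fun e => ~ P e)
| sa_or P Q : sa P -> sa Q -> sa (fun e => P e \/ Q e).

Lemma upd_same e d y : upd e d y d = y.
Proof. by rewrite /upd eqxx. Qed.

Lemma upd_id e d : upd e d (e d) = e.
Proof. by apply/funext => i; rewrite /upd; case: eqP => // ->. Qed.

Lemma shift_unshift k e : shift k (unshift k e) = e.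
Proof.
apply/funext => i; rewrite /shift /unshift.
by rewrite ltnNge leq_addl /= addnK.
Qed.

Lemma dep_le (T : Type) k l (f : env -> T) : (k <= l)%N -> dep k f -> dep l f.
Proof. by move=> kl hf e e' h; apply: hf => i ik; apply: h; apply: leq_trans kl. Qed.

Lemma dep_trunc (T : Type) k (f : env -> T) e : dep k f -> f (trunc k e) = f e.
Proof. by apply => i ik; rewrite /trunc ik. Qed.

Lemma dep_of_trunc (T : Type) k (f : env -> T) : dep k (fun e => f (trunc k e)).
Proof.
move=> e e' h; congr f; apply/funext => i; rewrite /trunc.
by case: ifP => // /h.
Qed.

Lemma dep_upd (T : Type) k (f : env -> T) e y : dep k f -> f (upd e k y) = f e.
Proof. by apply => i ik; rewrite /upd ltn_eqF. Qed.

Lemma polyfN f : polyf f -> polyf (fun e => - f e).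
Proof.
move=> hf; have -> : (fun e => - f e) = (fun e => -1 * f e).
  by apply/funext => e; rewrite mulN1r.
by apply: polyfM => //; exact: polyf_cst.
Qed.

Lemma polyfB f g : polyf f -> polyf g -> polyf (fun e => f e - g e).
Proof. by move=> hf hg; apply: polyfD => //; apply: polyfN. Qed.

Lemma polyfX f n : polyf f -> polyf (fun e => f e ^+ n).
Proof.
move=> hf; elim: n => [|n IH].
  have -> : (fun e => f e ^+ 0) = (fun _ => 1) by apply/funext => e; rewrite expr0.
  exact: polyf_cst.
have -> : (fun e => f e ^+ n.+1) = (fun e => f e * f e ^+ n).
  by apply/funext => e; rewrite exprS.
exact: polyfM.
Qed.

Lemma polyf_sum (I : Type) (s : seq I) (p : pred I) (H : I -> env -> R) :
  (forall i, polyf (H i)) -> polyf (fun e => \sum_(i <- s | p i) H i e).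
Proof.
move=> h; elim: s => [|i s IH].
  have -> : (fun e => \sum_(i <- [::] | p i) H i e) = (fun _ => 0).
    by apply/funext => e; rewrite big_nil.
  exact: polyf_cst.
have -> : (fun e => \sum_(j <- i :: s | p j) H j e) =
   (fun e => (if p i then H i e else 0) + \sum_(j <- s | p j) H j e).
  by apply/funext => e; rewrite big_cons; case: (p i); rewrite ?add0r.
by apply: polyfD => //; case: (p i) => //; exact: polyf_cst.
Qed.

Lemma polyf_subst f F : polyf f -> (forall i, polyf (F i)) ->
  polyf (fun e => f (fun i => F i e)).
Proof.
move=> hf hF; elim: hf => [c|i|g h _ hg _ hh|g h _ hg _ hh].
- exact: polyf_cst.
- exact: hF.
- exact: polyfD hg hh.
- exact: polyfM hg hh.
Qed.

Lemma sa_subst P F : sa P -> (forall i, polyf (F i)) ->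
  sa (fun e => P (fun i => F i e)).
Proof.
move=> hP hF; elim: hP => [f hf|Q _ hQ|Q Q' _ hQ _ hQ'].
- by apply: sa_pos; exact: polyf_subst.
- exact: sa_not hQ.
- exact: sa_or hQ hQ'.
Qed.

Lemma polyf_dep f : polyf f -> exists N, dep N f.
Proof.
elim => [c|i|g h _ [M hM] _ [N hN]|g h _ [M hM] _ [N hN]].
- by exists 0%N.
- by exists i.+1 => e e' h; rewrite h.
- exists (maxn M N) => e e' h1; rewrite (hM e e') ?(hN e e') // => i hi;
    by apply: h1; rewrite leq_max hi ?orbT.
- exists (maxn M N) => e e' h1; rewrite (hM e e') ?(hN e e') // => i hi;
    by apply: h1; rewrite leq_max hi ?orbT.
Qed.

Lemma sa_dep P : sa P -> exists N, dep N P.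
Proof.
elim => [f /polyf_dep [N hN]|Q _ [N hN]|Q Q' _ [M hM] _ [N hN]].
- by exists N => e e' h; rewrite (hN e e').
- by exists N => e e' h; rewrite (hN e e').
- exists (maxn M N) => e e' h1; rewrite (hM e e') ?(hN e e') // => i hi;
    by apply: h1; rewrite leq_max hi ?orbT.
Qed.

Lemma sa_ext P Q : (forall e, P e <-> Q e) -> sa P -> sa Q.
Proof. by move=> h; have -> : Q = P by apply/funext => e; apply/propext; split=> /h. Qed.

Lemma sa_and P Q : sa P -> sa Q -> sa (fun e => P e /\ Q e).
Proof.
move=> hP hQ; apply: sa_ext (sa_not (sa_or (sa_not hP) (sa_not hQ))) => e.
by rewrite not_orE !notE.
Qed.

Lemma sa_imp P Q : sa P -> sa Q -> sa (fun e => P e -> Q e).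
Proof.
move=> hP hQ; apply: sa_ext (sa_or (sa_not hP) hQ) => e.
by rewrite implyE.
Qed.

Lemma sa_cst (p : Prop) : sa (fun _ => p).
Proof.
have [hp|hp] := pselect p.
  apply: sa_ext (sa_pos (polyf_cst 1)) => e; split=> // _; exact: ltr01.
by apply: sa_ext (sa_pos (polyf_cst 0)) => e; rewrite ltxx.
Qed.

Lemma sa_lt_poly f g : polyf f -> polyf g -> sa (fun e => f e < g e).
Proof.
by move=> hf hg; apply: sa_ext (sa_pos (polyfB hg hf)) => e; rewrite subr_gt0.
Qed.

Lemma sa_eq_poly f g : polyf f -> polyf g -> sa (fun e => f e = g e).
Proof.
move=> hf hg; apply: sa_ext (sa_not (sa_or (sa_lt_poly hf hg) (sa_lt_poly hg hf))).
move=> e; split => [/not_orP[/negP h1 /negP h2]|->].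
  by apply/eqP; rewrite eq_le !leNgt h1 h2.
by rewrite ltxx => -[].
Qed.

Lemma sa_exists_fin (I : finType) (H : I -> env -> Prop) :
  (forall i, sa (H i)) -> sa (fun e => exists i, H i e).
Proof.
move=> hH; suff : sa (fun e => exists2 i, i \in enum I & H i e).
  by apply: sa_ext => e; split => [[i _ Hi]|[i Hi]]; exists i; rewrite ?mem_enum.
elim: (enum I) => [|i s IH].
  by apply: sa_ext (sa_cst False) => e; split => // -[].
apply: sa_ext (sa_or (hH i) IH) => e; split.
  by case => [Hi|[j js Hj]]; [exists i|exists j]; rewrite ?inE ?eqxx ?js ?orbT.
by move=> [j]; rewrite inE => /orP[/eqP->|js] Hj; [left|right; exists j].
Qed.

(** * Quantifier elimination *)

Lemma polyf_term f : polyf f -> exists2 t : GRing.term R, GRing.rterm t &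
  forall s : seq R, GRing.eval s t = f (nth 0 s).
Proof.
elim => [c|i|g h _ [t ht Et] _ [t' ht' Et']|g h _ [t ht Et] _ [t' ht' Et']].
- by exists (GRing.Const c).
- by exists (GRing.Var R i).
- by exists (GRing.Add t t') => [|s]; rewrite /= ?ht // Et Et'.
- by exists (GRing.Mul t t') => [|s]; rewrite /= ?ht // Et Et'.
Qed.

Lemma sa_formula P : sa P -> exists2 phi : ordered_qelim.ord.formula R,
  ordered_qelim.ord.rformula phi &
  forall s : seq R, ordered_qelim.ord.holds s phi <-> P (nth 0 s).
Proof.
elim => [f /polyf_term [t ht Et]|Q _ [t ht Et]|Q Q' _ [t ht Et] _ [t' ht' Et']].
- by exists (ordered_qelim.ord.Lt (GRing.Const 0) t) => // s; rewrite /= Et.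
- by exists (ordered_qelim.ord.Not t) => // s; rewrite /= Et.
- by exists (ordered_qelim.ord.Or t t') => [|s]; rewrite /= ?ht // Et Et'.
Qed.

Lemma term_polyf (t : GRing.term R) N : GRing.rterm t ->
  polyf (fun e => GRing.eval (mkseq e N) t).
Proof.
elim: t => //=.
- move=> n _; case: (ltnP n N) => nN.
    have -> : (fun e => (mkseq e N)`_n) = (fun e => e n).
      by apply/funext => e; rewrite nth_mkseq.
    exact: polyf_var.
  have -> : (fun e => (mkseq e N)`_n) = (fun _ => 0).
    by apply/funext => e; rewrite nth_default // size_mkseq.
  exact: polyf_cst.
- by move=> c _; exact: polyf_cst.
- by move=> c _; exact: polyf_cst.
- by move=> t1 IH1 t2 IH2 /andP[/IH1 h1 /IH2 h2]; exact: polyfD.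
- by move=> t IH /IH; exact: polyfN.
- move=> t IH n /IH h.
  have -> : (fun e => GRing.eval (mkseq e N) t *+ n) =
            (fun e => n%:R * GRing.eval (mkseq e N) t).
    by apply/funext => e; rewrite mulr_natl.
  by apply: polyfM => //; exact: polyf_cst.
- by move=> t1 IH1 t2 IH2 /andP[/IH1 h1 /IH2 h2]; exact: polyfM.
- by move=> t IH n /IH h; exact: polyfX.
Qed.

Lemma formula_sa (phi : ordered_qelim.ord.formula R) N :
  ordered_qelim.ord.qf_form phi -> ordered_qelim.ord.rformula phi ->
  sa (fun e => ordered_qelim.ord.qf_eval (mkseq e N) phi).
Proof.
elim: phi => //=.
- by move=> b _ _; exact: sa_cst.
- move=> t1 t2 _ /andP[/(term_polyf N) h1 /(term_polyf N) h2].
  by apply: sa_ext (sa_eq_poly h1 h2) => e; split => /eqP.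
- move=> t1 t2 _ /andP[/(term_polyf N) h1 /(term_polyf N) h2].
  exact: sa_lt_poly.
- move=> t1 t2 _ /andP[/(term_polyf N) h1 /(term_polyf N) h2].
  by apply: sa_ext (sa_not (sa_lt_poly h2 h1)) => e; rewrite leNgt; split => /negP.
- move=> f1 IH1 f2 IH2 /andP[q1 q2] /andP[r1 r2].
  by apply: sa_ext (sa_and (IH1 q1 r1) (IH2 q2 r2)) => e; split => /andP.
- move=> f1 IH1 f2 IH2 /andP[q1 q2] /andP[r1 r2].
  by apply: sa_ext (sa_or (IH1 q1 r1) (IH2 q2 r2)) => e; split => /orP.
- move=> f1 IH1 f2 IH2 /andP[q1 q2] /andP[r1 r2].
  by apply: sa_ext (sa_imp (IH1 q1 r1) (IH2 q2 r2)) => e; split => /implyP.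
- move=> f1 IH1 q1 r1.
  by apply: sa_ext (sa_not (IH1 q1 r1)) => e; split => /negP.
Qed.

(** Tarski and Seidenberg: conditions are translated to first-order formulas
    over a real closed field and back, and the quantifier is eliminated there.
    *)
Theorem sa_proj P d : sa P -> sa (fun e => exists y, P (upd e d y)).
Proof.
move=> hP; have [phi rphi Ephi] := sa_formula hP.
have [N0 hN0] := sa_dep hP; pose N := maxn N0 d.+1.
have hN : dep N P by apply: dep_le hN0; exact: leq_maxl.
pose psi := ordered_qelim.ord.quantifier_elim
  (fun n s => qe_rcf.qfr_to_formula (@qe_rcf.wproj R n s))
  (ordered_qelim.ord.Exists d phi).
have rE : ordered_qelim.ord.rformula (ordered_qelim.ord.Exists d phi) by [].
have /andP[qpsi rpsi] := ordered_qelim.ord.quantifier_elim_wf (@qe_rcf.wf_QE_wproj R) rE.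
apply: sa_ext (formula_sa N qpsi rpsi) => e.
have hE := ordered_qelim.ord.quantifier_elim_rformP
  (@qe_rcf.wf_QE_wproj R) (@qe_rcf.valid_QE_wproj R) (mkseq e N) rE.
have H y : ordered_qelim.ord.holds (set_nth 0 (mkseq e N) d y) phi <-> P (upd e d y).
  rewrite Ephi; suff -> : P (nth 0 (set_nth 0 (mkseq e N) d y)) = P (upd e d y) by [].
  by apply: hN => i iN; rewrite nth_set_nth /= /upd; case: eqP => // _; rewrite nth_mkseq.
split => [/hE[y /H hy]|[y /H hy]]; first by exists y.
by apply/hE; exists y.
Qed.

Lemma polyf_upd_shift d i : polyf (fun e => upd (shift 1 e) d (e 0%N) i).
Proof. by rewrite /upd; case: (i == d); exact: polyf_var. Qed.

(** The bound variable may be placed in entry [0], with the free ones shifted,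
    so that conditions can be written with abstractions instead of numbered
    variables. *)
Lemma sa_exists (Q : R -> env -> Prop) :
  sa (fun e => Q (e 0%N) (shift 1 e)) -> sa (fun e => exists y, Q y e).
Proof.
move=> /(sa_proj 0) H0; have H := @sa_subst _ (fun i e => unshift 1 e i) H0.
apply: sa_ext (H _) => [e|i]; last first.
  by rewrite /unshift; case: (i < 1)%N; [exact: polyf_cst|exact: polyf_var].
have E y : shift 1 (upd (fun i => unshift 1 e i) 0 y) = e.
  apply/funext => i; rewrite /shift /upd /unshift addn1 /=.
  by rewrite subn1.
by split => -[y hy]; exists y; move: hy; rewrite E upd_same.
Qed.

Lemma sa_forall (Q : R -> env -> Prop) :
  sa (fun e => Q (e 0%N) (shift 1 e)) -> sa (fun e => forall y, Q y e).
Proof.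
move=> /sa_not /(@sa_exists (fun y e => ~ Q y e)) /sa_not.
by apply: sa_ext => e; rewrite -forallNE; split => h y; have := h y; rewrite notE.
Qed.

Lemma sa_exists_block k P :
  sa P -> sa (fun e => exists u : env, P (fun i => if (i < k)%N then u i else e i)).
Proof.
move=> hP; elim: k => [|k /(sa_proj k) IH].
  by apply: sa_ext hP => e; split => [h|[u]//]; exists e.
apply: sa_ext IH => e; split => [[y [u hu]]|[u hu]].
  exists (upd u k y); move: hu; congr P; apply/funext => i; rewrite /upd ltnS.
  by case: (ltngtP i k).
exists (u k), u; move: hu; congr P; apply/funext => i; rewrite /upd ltnS.
by case: (ltngtP i k) => // ->.
Qed.

Lemma sa_exists_env k (Q : env -> env -> Prop) :
  sa (fun e => Q (trunc k e) (shift k e)) ->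
  sa (fun e => exists u, Q (trunc k u) e).
Proof.
move=> /(sa_exists_block k) H0.
have H := @sa_subst _ (fun i e => unshift k e i) H0.
apply: sa_ext (H _) => [e|i]; last first.
  by rewrite /unshift; case: (i < k)%N; [exact: polyf_cst|exact: polyf_var].
have E u : shift k (fun i => if (i < k)%N then u i else unshift k e i) = e.
  apply/funext => i; rewrite -[in RHS](shift_unshift k e) /shift.
  by rewrite ltnNge leq_addl.
have E' u : trunc k (fun i => if (i < k)%N then u i else unshift k e i) = trunc k u.
  by apply/funext => i; rewrite /trunc; case: (i < k)%N.
by split => -[u hu]; exists u; move: hu; rewrite E E'.
Qed.

(** * Semialgebraic functions *)

(** The graph is semialgebraic; the value is placed in entry [0] and the
    argument is shifted. *)
Definition saf f := sa (fun e => e 0%N = f (shift 1 e)).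

(** Entries below [N] receive the values of the functions one at a time, by a
    projection each, while the arguments of these functions are kept in the
    entries from [N] on. *)
Lemma sa_comp P F : sa P -> (forall i, saf (F i)) ->
  sa (fun e => P (fun i => F i e)).
Proof.
move=> hP hF; have [N hN] := sa_dep hP.
have step k : (k <= N)%N ->
  sa (fun e => P (fun i => if (i < k)%N then F i (shift N e) else e i)).
  elim: k => [_|k IH kN]; first by apply: sa_ext hP.
  have hk : sa (fun e => e k = F k (shift N e)).
    apply: sa_ext (@sa_subst _ (fun i e => if i == 0%N then e k else e (i.-1 + N)%N) (hF k) _).
      by move=> e; rewrite /shift /=; under eq_fun do rewrite addn1 /=.
    by move=> i; case: (i == 0%N); exact: polyf_var.
  apply: sa_ext (sa_proj k (sa_and hk (IH (ltnW kN)))) => e.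
  have E y : shift N (upd e k y) = shift N e.
    apply/funext => i; rewrite /shift /upd gtn_eqF //.
    by rewrite (leq_trans kN) // leq_addl.
  split => [[y [hy]]|h].
    rewrite E; congr P; apply/funext => i; rewrite /upd ltnS.
    by move: hy; rewrite upd_same E => ->; case: (ltngtP i k) => // ->.
  exists (F k (shift N e)); rewrite upd_same E; split => //.
  move: h; congr P; apply/funext => i; rewrite /upd ltnS.
  by case: (ltngtP i k) => // ->.
apply: sa_ext (@sa_subst _ (fun i e => unshift N e i) (step N (leqnn N)) _) => [e|i].
  have -> : shift N (fun i => unshift N e i) = e by exact: shift_unshift.
  by rewrite (hN _ (fun i => F i e)) // => i ->.
by rewrite /unshift; case: (i < N)%N; [exact: polyf_cst|exact: polyf_var].
Qed.

Lemma saf_poly f : polyf f -> saf f.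
Proof.
move=> hf; apply: sa_eq_poly; first exact: polyf_var.
by apply: polyf_subst => // i; exact: polyf_var.
Qed.

Lemma saf_shift f k : saf f -> saf (fun e => f (shift k e)).
Proof.
move=> hf; apply: sa_ext (@sa_subst _ (fun i e => if i == 0%N then e 0%N else e (i + k)%N) hf _).
  move=> e /=; have -> // : shift 1 (fun i => if i == 0%N then e 0%N else e (i + k)%N) =
    shift k (shift 1 e).
  by apply/funext => i; rewrite /shift addn1 /= addn1 addSn.
by move=> i; case: (i == 0%N); exact: polyf_var.
Qed.

Lemma saf_comp f F : saf f -> (forall i, saf (F i)) -> saf (fun e => f (fun i => F i e)).
Proof.
move=> hf hF; pose F' i e := if i is j.+1 then F j (shift 1 e) else e 0%N.
apply: sa_ext (@sa_comp _ F' hf _) => [e|i].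
  by rewrite /shift /F' /=; under eq_fun do rewrite addn1.
case: i => [|i]; first by apply: saf_poly; exact: polyf_var.
exact: (@saf_shift (F i) 1 (hF i)).
Qed.

Lemma saf_comp1 (h : R -> R) f : saf (fun e => h (e 0%N)) -> saf f ->
  saf (fun e => h (f e)).
Proof. by move=> hh hf; exact: (@saf_comp _ (fun _ => f) hh (fun _ => hf)). Qed.

Lemma saf_comp2 (h : R -> R -> R) f g : saf (fun e => h (e 0%N) (e 1%N)) ->
  saf f -> saf g -> saf (fun e => h (f e) (g e)).
Proof.
move=> hh hf hg; have := @saf_comp _ (fun i => if i == 0%N then f else g) hh.
by apply => i; case: ifP.
Qed.

Lemma safD f g : saf f -> saf g -> saf (fun e => f e + g e).
Proof.
apply: (@saf_comp2 (fun x y => x + y)); apply: saf_poly.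
by apply: polyfD; exact: polyf_var.
Qed.

Lemma safM f g : saf f -> saf g -> saf (fun e => f e * g e).
Proof.
apply: (@saf_comp2 (fun x y => x * y)); apply: saf_poly.
by apply: polyfM; exact: polyf_var.
Qed.

Lemma saf_cst c : saf (fun _ => c).
Proof. by apply: saf_poly; exact: polyf_cst. Qed.

Lemma saf_var i : saf (fun e => e i).
Proof. by apply: saf_poly; exact: polyf_var. Qed.

Lemma safN f : saf f -> saf (fun e => - f e).
Proof.
apply: (@saf_comp1 (fun x => - x)); apply: saf_poly.
by apply: polyfN; exact: polyf_var.
Qed.

Lemma safB f g : saf f -> saf g -> saf (fun e => f e - g e).
Proof. by move=> hf hg; apply: safD => //; apply: safN. Qed.

Lemma sa_rel2 (p : R -> R -> Prop) f g : sa (fun e => p (e 0%N) (e 1%N)) ->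
  saf f -> saf g -> sa (fun e => p (f e) (g e)).
Proof.
move=> hp hf hg; have := @sa_comp _ (fun i => if i == 0%N then f else g) hp.
by apply => i; case: ifP.
Qed.

Lemma sa_lt f g : saf f -> saf g -> sa (fun e => f e < g e).
Proof. by apply: (@sa_rel2 (fun x y => x < y)); apply: sa_lt_poly; exact: polyf_var. Qed.

Lemma sa_le f g : saf f -> saf g -> sa (fun e => f e <= g e).
Proof.
move=> hf hg; apply: sa_ext (sa_not (sa_lt hg hf)) => e.
by rewrite leNgt; split => /negP.
Qed.

Lemma sa_eq f g : saf f -> saf g -> sa (fun e => f e = g e).
Proof. by apply: (@sa_rel2 (fun x y => x = y)); apply: sa_eq_poly; exact: polyf_var. Qed.

(** Functions defined by description, with value zero where the description is
    not satisfied. *)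
Lemma saf_xget (B : R -> env -> Prop) :
  sa (fun e => B (e 0%N) (shift 1 e)) ->
  (forall e y z, B y e -> B z e -> y = z) ->
  saf (fun e => xget 0 [set y | B y e]).
Proof.
move=> hB uB.
have hE : sa (fun e => exists y, B y (shift 1 e)).
  apply: (@sa_exists (fun y e => B y (shift 1 e))).
  apply: sa_ext (@sa_subst _ (fun i e => if i == 0%N then e 0%N else e i.+1) hB _).
    move=> e /=; have -> // : shift 1 (fun i => if i == 0%N then e 0%N else e i.+1) =
      shift 1 (shift 1 e).
    by apply/funext => i; rewrite /shift !addn1.
  by move=> i; case: (i == 0%N); exact: polyf_var.
have h0 : sa (fun e => e 0%N = 0) by apply: sa_eq; [exact: saf_var|exact: saf_cst].
apply: sa_ext (sa_or hB (sa_and (sa_not hE) h0)) => e; split.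
  case => [h|[h ->]].
    by case: xgetP => [y _ hy|/(_ (e 0%N))//]; exact: uB h hy.
  by case: xgetP => // y _ hy; exfalso; apply: h; exists y.
case: xgetP => [y _ hy ->|h ->]; [by left|right; split => // -[y]].
exact: h.
Qed.

Lemma saf_if P f g : sa P -> saf f -> saf g ->
  saf (fun e => if `[< P e >] then f e else g e).
Proof.
move=> hP hf hg.
have hP1 : sa (fun e => P (shift 1 e)) by apply: sa_subst => // i; exact: polyf_var.
apply: sa_ext (sa_or (sa_and hP1 hf) (sa_and (sa_not hP1) hg)) => e.
split => [[[h ->]|[h ->]]|].
- by rewrite (asboolT h).
- by rewrite (asboolF h).
- by case: asboolP; [left|right].
Qed.

Lemma safV f : saf f -> saf (fun e => (f e)^-1).
Proof.
apply: (@saf_comp1 (fun x => x^-1)).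
have h1 : sa (fun e => e 1%N * e 0%N = 1).
  by apply: sa_eq; [apply: safM; exact: saf_var|exact: saf_cst].
have h2 : sa (fun e => e 1%N = 0) by apply: sa_eq; [exact: saf_var|exact: saf_cst].
have h3 : sa (fun e => e 0%N = 0) by apply: sa_eq; [exact: saf_var|exact: saf_cst].
apply: sa_ext (sa_or h1 (sa_and h2 h3)) => e; rewrite /shift add0n; split.
  move=> [h|[-> ->]]; last by rewrite invr0.
  have e1 : e 1%N != 0 by apply/eqP => e1; move: h; rewrite e1 mul0r => /eqP; rewrite eq_sym oner_eq0.
  by apply: (mulfI e1); rewrite divff.
move=> ->; have [->|e1] := eqVneq (e 1%N) 0; first by rewrite invr0; right.
by left; rewrite divff.
Qed.

Lemma saf_abs f : saf f -> saf (fun e => `|f e|).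
Proof.
move=> hf; have := saf_if (sa_lt hf (saf_cst 0)) (safN hf) hf.
congr saf; apply/funext => e; case: asboolP => [h|/negP].
  by rewrite ltr0_norm.
by rewrite -leNgt => h; rewrite ger0_norm.
Qed.

Lemma safX f n : saf f -> saf (fun e => f e ^+ n).
Proof.
apply: (@saf_comp1 (fun x => x ^+ n)); apply: saf_poly.
by apply: polyfX; exact: polyf_var.
Qed.

End Semialgebraic.

Hint Resolve saf_cst saf_var polyf_cst polyf_var : core.

(** * Semialgebraic sets along a line *)

Section Lines.
Variable R : realType.
Notation env := (env R).
Implicit Types (e u : env) (P Q : env -> Prop) (f g xi : env -> R) (A B : env -> {poly R}).

(** Polynomials in one variable of bounded degree whose coefficients are
    polynomials in the parameters. *)
Definition pX A := (forall i, polyf (fun e => (A e)`_i)) /\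
  exists N, forall e, (size (A e) <= N)%N.

Lemma pXC f : polyf f -> pX (fun e => (f e)%:P).
Proof.
move=> hf; split; last by exists 1%N => e; exact: size_polyC_leq1.
move=> i; have -> : (fun e => (f e)%:P`_i) = (fun e => if i == 0%N then f e else 0).
  by apply/funext => e; rewrite coefC.
by case: (i == 0%N); [exact: hf|exact: polyf_cst].
Qed.

Lemma pX_cst p : pX (fun _ => p).
Proof. by split; [move=> i; exact: polyf_cst|exists (size p)]. Qed.

Lemma pXD A B : pX A -> pX B -> pX (fun e => A e + B e).
Proof.
move=> [hA [M hM]] [hB [N hN]]; split => [i|].
  by under eq_fun do rewrite coefD; exact: polyfD.
exists (maxn M N) => e; apply: leq_trans (size_polyD _ _) _.
by rewrite geq_max !leq_max hM hN orbT.
Qed.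

Lemma pXM A B : pX A -> pX B -> pX (fun e => A e * B e).
Proof.
move=> [hA [M hM]] [hB [N hN]]; split => [i|].
  by under eq_fun do rewrite coefM; apply: polyf_sum => j; exact: polyfM.
exists (M + N)%N => e; apply: leq_trans (size_polyMleq _ _) _.
by apply: leq_trans (leq_pred _) _; exact: leq_add.
Qed.

Lemma pX_subst A (F : nat -> env -> R) : pX A -> (forall i, polyf (F i)) ->
  pX (fun e => A (fun i => F i e)).
Proof.
move=> [hA [N hN]] hF; split; last by exists N.
by move=> i; apply: (@polyf_subst _ (fun e => (A e)`_i)).
Qed.

Lemma pX_deriv A n : pX A -> pX (fun e => (A e)^`(n)).
Proof.
move=> [hA [N hN]]; split => [i|].
  under eq_fun do rewrite coef_derivn -mulr_natl.
  by apply: polyfM => //; exact: polyf_cst.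
exists N => e; apply: leq_trans (hN e).
elim: n => [|n IH]; rewrite ?derivn0 // derivnS.
apply: leq_trans IH; have [->|p0] := eqVneq (A e)^`(n) 0.
  by rewrite deriv0.
by apply: ltnW; exact: lt_size_deriv.
Qed.

Lemma pX_horner A f : pX A -> polyf f -> polyf (fun e => (A e).[f e]).
Proof.
move=> [hA [N hN]] hf.
have -> : (fun e => (A e).[f e]) = (fun e => \sum_(i < N) (A e)`_i * f e ^+ i).
  by apply/funext => e; rewrite (@horner_coef_wide _ N).
by apply: polyf_sum => i; apply: polyfM => //; exact: polyfX.
Qed.

(** A nonzero coefficient is sought in a finite range, thanks to the bound on
    the degree. *)
Lemma sa_neq0 A : pX A -> sa (fun e => A e != 0).
Proof.
move=> [c [N hN]].
have : sa (fun e => exists j : 'I_N, (A e)`_j <> 0).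
  by apply: sa_exists_fin => j; apply: sa_not; apply: sa_eq_poly.
apply: sa_ext => e; split => [[j hj]|h].
  by apply/eqP => h; apply: hj; rewrite h coef0.
apply: contrapT => hn; move/eqP: h; apply; apply/polyP => j; rewrite coef0.
case: (ltnP j N) => jN; last by rewrite nth_default // (leq_trans (hN e)).
by apply: contrapT => hj; apply: hn; exists (Ordinal jN).
Qed.

Lemma saf_horner A xi : pX A -> saf xi -> saf (fun e => (A e).[xi e]).
Proof.
move=> hA sxi; pose F i e : R := if i is j.+1 then e j else xi e.
have H : saf (fun e => (A (shift 1 e)).[e 0%N]).
  apply: saf_poly; apply: pX_horner => //.
  by apply: (@pX_subst A (fun j e => shift 1 e j)) => // j; exact: polyf_var.
have : saf (fun e => (A (shift 1 (fun j => F j e))).[xi e]).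
  by apply: (saf_comp (F := F) H) => -[|j]; rewrite /F.
congr saf; apply/funext => e; congr (_.[_]); congr (A _).
by apply/funext => j; rewrite /shift addn1.
Qed.

Lemma polyf_uni d f : polyf f -> exists A,
  [/\ pX A, forall e y, A (upd e d y) = A e & forall e y, f (upd e d y) = (A e).[y]].
Proof.
elim => [c|i|g h _ [A [A1 A2 A3]] _ [B [B1 B2 B3]]|
         g h _ [A [A1 A2 A3]] _ [B [B1 B2 B3]]].
- exists (fun _ => c%:P); split => [||e y]; rewrite ?hornerC //; exact: pX_cst.
- exists (fun e => if i == d then 'X else (e i)%:P); split.
  + case: (i == d); first exact: pX_cst.
    by apply: pXC; exact: polyf_var.
  + by move=> e y; rewrite /upd; case: (i == d).
  + by move=> e y; rewrite /upd; case: (i == d); rewrite ?hornerX ?hornerC.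
- exists (fun e => A e + B e); split; first exact: pXD.
    by move=> e y; rewrite A2 B2.
  by move=> e y; rewrite A3 B3 hornerD.
- exists (fun e => A e * B e); split; first exact: pXM.
    by move=> e y; rewrite A2 B2.
  by move=> e y; rewrite A3 B3 hornerM.
Qed.

Lemma sa_signs P : sa P -> exists n (ps : nat -> env -> R),
  (forall i, polyf (ps i)) /\
  forall e e', (forall i, (i < n)%N -> Num.sg (ps i e) = Num.sg (ps i e')) -> P e = P e'.
Proof.
elim => [f hf|Q _ [n [ps [h1 h2]]]|Q Q' _ [n [ps [h1 h2]]] _ [n' [ps' [h1' h2']]]].
- exists 1%N, (fun _ => f); split => // e e' h.
  by rewrite -(sgr_gt0 (f e)) -(sgr_gt0 (f e')) (h 0%N).
- by exists n, ps; split => // e e' h; rewrite (h2 e e').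
- exists (n + n')%N, (fun i => if (i < n)%N then ps i else ps' (i - n)%N).
  split=> [i|e e' h]; first by case: (i < n)%N.
  rewrite (h2 e e') ?(h2' e e') // => i hi.
    have E : (n + i < n)%N = false by rewrite ltnNge leq_addr.
    by have := h (n + i)%N; rewrite ltn_add2l E addKn; apply.
  by have := h i; rewrite hi; apply; rewrite ltn_addr.
Qed.

Lemma sg_eq_no_root (p : {poly R}) y z : y <= z ->
  (forall x, y <= x <= z -> p.[x] != 0) -> Num.sg p.[y] = Num.sg p.[z].
Proof.
move=> yz hp; have [h|h] := lerP (p.[y] * p.[z]) 0.
  have [x xyz /eqP px] := polyrcf.poly_ivt yz h.
  by move: (hp x); rewrite px eqxx -[y <= x <= z]/(x \in `[y, z]) xyz => /(_ isT).
have y0 : p.[y] != 0 by apply: hp; rewrite lexx.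
have z0 : p.[z] != 0 by apply: hp; rewrite lexx andbT.
move: h; have [p1|p1|/eqP] := ltgtP p.[y] 0; last by rewrite (negbTE y0).
  by rewrite nmulr_rgt0 // => p2; rewrite !ltr0_sg.
by rewrite pmulr_rgt0 // => p2; rewrite !gtr0_sg.
Qed.

(** Membership depends on the signs of finitely many polynomials, and along a
    line the sign of a polynomial changes only at its roots. *)
Lemma sa_line d P : sa P -> dep d.+1 P -> exists n (A : nat -> env -> {poly R}),
  [/\ forall i, pX (A i), forall i, dep d (A i) &
   forall e y z, y <= z ->
   (forall i, (i < n)%N -> A i e != 0 -> forall x, y <= x <= z -> (A i e).[x] != 0) ->
   P (upd e d y) = P (upd e d z)].
Proof.
move=> hP dP; have [n [ps [h1 h2]]] := sa_signs hP.
have [A hA] := choice (fun i => polyf_uni d (h1 i)).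
exists n, (fun i e => A i (trunc d e)); split.
- move=> i; apply: (@pX_subst _ (fun j e => trunc d e j)).
    by have [] := hA i.
  by move=> j; rewrite /trunc; case: (j < d)%N; [exact: polyf_var|exact: polyf_cst].
- by move=> i; exact: dep_of_trunc.
have dPt e y : P (upd e d y) = P (upd (trunc d e) d y).
  by apply: dP => i; rewrite ltnS /upd /trunc; case: (ltngtP i d).
move=> e y z yz H; rewrite (dPt e y) (dPt e z); apply: h2 => i iN.
have [_ _ h] := hA i; rewrite !h.
have [->|A0] := eqVneq (A i (trunc d e)) 0; first by rewrite !horner0.
by apply: sg_eq_no_root => // x; exact: (H i iN A0).
Qed.

Lemma poly_roots_seq (p : {poly R}) : p != 0 ->
  exists2 s : seq R, (size s <= size p)%N & forall x, p.[x] = 0 -> x \in s.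
Proof.
elim: {p}(size p) {-2}p (leqnn (size p)) => [|n IH] p sp p0.
  by move: sp p0; rewrite leqn0 size_poly_eq0 => ->.
have [[x /eqP px]|hn] := pselect (exists x, p.[x] = 0); last first.
  by exists [::] => // x px; exfalso; apply: hn; exists x.
have /factor_theorem [q pq] : root p x by [].
have q0 : q != 0 by apply: contraNneq p0 => q0; rewrite pq q0 mul0r.
have sq : size p = (size q).+1 by rewrite pq size_Mmonic ?monicXsubC // size_XsubC addn2.
have [|s ss hs] := IH q _ q0; first by move: sp; rewrite sq.
exists (x :: s); first by rewrite sq.
move=> y /eqP; rewrite pq hornerM mulf_eq0 hornerXsubC subr_eq0 inE.
by case/orP => [/eqP/hs -> |->]; rewrite ?orbT.
Qed.

Lemma seq_min (p : R -> Prop) (s : seq R) : (exists2 y, y \in s & p y) ->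
  exists2 y, p y & forall z, z \in s -> p z -> y <= z.
Proof.
elim: s => [[]//|x s IH [y ys py]].
have [h|h] := pselect (exists2 y, y \in s & p y).
  have [m pm hm] := IH h.
  have [[px xm]|nx] := pselect (p x /\ x <= m).
    exists x => // z; rewrite inE => /orP[/eqP -> //|zs pz].
    by apply: le_trans xm (hm z zs pz).
  exists m => // z; rewrite inE => /orP[/eqP ->|zs pz]; last exact: hm.
  by move=> px; rewrite leNgt; apply/negP => xm; apply: nx; split=> //; exact: ltW.
exists y => // z; rewrite inE => /orP[/eqP ->|zs pz].
  move: ys; rewrite inE => /orP[/eqP ->//|ys].
  by exfalso; apply: h; exists y.
by exfalso; apply: h; exists z.
Qed.

Lemma seq_max (p : R -> Prop) (s : seq R) : (exists2 y, y \in s & p y) ->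
  exists2 y, p y & forall z, z \in s -> p z -> z <= y.
Proof.
move=> [y ys py].
have [|m pm hm] := @seq_min (fun x => p (- x)) (map -%R s).
  by exists (- y); rewrite ?opprK // map_f.
exists (- m) => // z zs pz; rewrite lerNr; apply: hm; rewrite ?opprK //.
by rewrite map_f.
Qed.

Lemma saf_upd d f i : saf f -> saf (fun e => upd e d (f e) i).
Proof. by move=> hf; rewrite /upd; case: (i == d). Qed.

Lemma sa_upd P d f : sa P -> saf f -> sa (fun e => P (upd e d (f e))).
Proof. by move=> hP hf; apply: (sa_comp hP) => i; exact: saf_upd. Qed.

Lemma sa_shift P k : sa P -> sa (fun e => P (shift k e)).
Proof. by move=> hP; apply: (sa_subst hP) => i; exact: polyf_var. Qed.

Definition fibre_min Q d e :=
  xget 0 [set y | Q (upd e d y) /\ forall z, Q (upd e d z) -> y <= z].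

Lemma saf_fibre_min Q d : sa Q -> saf (fibre_min Q d).
Proof.
move=> hQ.
apply: (@saf_xget _ (fun y e => Q (upd e d y) /\ forall z, Q (upd e d z) -> y <= z)).
  have h1 : sa (fun e => Q (upd (shift 1 e) d (e 0%N))).
    by apply: (sa_subst hQ) => i; exact: polyf_upd_shift.
  apply: sa_and => //.
  apply: (@sa_forall _ (fun z e => Q (upd (shift 1 e) d z) -> e 0%N <= z)).
  apply: sa_imp; last by apply: sa_le => //; exact: (saf_var _ 1%N).
  apply: (sa_subst hQ) => i; rewrite /upd; case: (i == d); exact: polyf_var.
move=> e y z [Qy ymin] [Qz zmin].
by apply/eqP; rewrite eq_le ymin // zmin.
Qed.

Lemma dep_fibre_min Q d : dep d.+1 Q -> dep d (fibre_min Q d).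
Proof.
move=> dQ e e' h; rewrite /fibre_min; congr (xget 0 _).
have E y : Q (upd e d y) = Q (upd e' d y).
  by apply: dQ => i; rewrite ltnS /upd; case: (ltngtP i d) => // id _; exact: h.
apply/funext => y; rewrite /mkset E; congr (_ /\ _).
by apply/propext; split => H z; [rewrite -E|rewrite E]; exact: H.
Qed.

(** The least point of each fibre is a semialgebraic function; removing it
    decreases the size of the fibres. *)
Lemma finite_fibres_sections N d Q : sa Q -> dep d.+1 Q ->
  (forall e, exists2 s : seq R, (size s <= N)%N & forall y, Q (upd e d y) -> y \in s) ->
  exists n (al : nat -> env -> R),
    [/\ forall i, saf (al i), forall i, dep d (al i) &
     forall e y, Q (upd e d y) -> exists2 i, (i < n)%N & y = al i e].
Proof.
elim: N Q => [|N IH] Q hQ dQ H.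
  exists 0%N, (fun _ _ => 0); split => // e y Qy.
  by have [[|//] _ /(_ y Qy)] := H e.
pose a := fibre_min Q d.
have sa_a : saf a := saf_fibre_min d hQ.
have dep_a : dep d a by exact: dep_fibre_min.
have [||e|n [al [h1 h2 h3]]] := IH (fun e => Q e /\ e d <> a e).
- by apply: sa_and => //; apply: sa_not; apply: sa_eq.
- move=> e e' h; rewrite (dQ e e') // (h d) // (dep_a e e') // => i id.
  by apply: h; rewrite ltnS ltnW.
- have [s ss hs] := H e.
  have [[y Qy]|hn] := pselect (exists y, Q (upd e d y)); last first.
    by exists [::] => // y [Qy]; exfalso; apply: hn; exists y.
  have [|m Qm hm] := @seq_min (fun y => Q (upd e d y)) s; first by exists y; rewrite ?hs.
  have am : Q (upd e d (a e)).
    rewrite /a /fibre_min; case: xgetP => [z _ [] //|/(_ m)]; case.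
    by split => // z Qz; apply: hm => //; exact: hs.
  exists (rem (a e) s); first by rewrite size_rem ?hs // -ltnS (leq_trans _ ss) // ltn_predL; case: (s) (hs _ am).
  move=> z; rewrite upd_same (dep_upd _ _ dep_a) => -[/hs zs za].
  have := perm_to_rem (hs _ am) => /perm_mem/(_ z); rewrite zs inE => /esym.
  by case/orP => // /eqP.
exists n.+1, (fun i => if i is j.+1 then al j else a); split.
- by case.
- by case.
move=> e y Qy; have [->|/eqP ya] := eqVneq y (a e); first by exists 0%N.
have [|i iN ->] := h3 e y; last by exists i.+1.
by rewrite upd_same (dep_upd _ _ dep_a).
Qed.

(** The points where membership may change along the line in direction [d] are
    roots of finitely many polynomials, hence values of finitely many
    semialgebraic functions. A point of the set lies either on one of these
    sections or in an interval between neighbouring ones, where membership is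
    constant. *)
Lemma line_cells d P : sa P -> dep d.+1 P ->
  exists m (al : nat -> env -> R),
  [/\ forall i, saf (al i), forall i, dep d (al i) &
   forall e y, P (upd e d y) ->
   (exists2 i, (i < m)%N & y = al i e) \/
   [\/ exists i j, [/\ (i < m)%N, (j < m)%N, al i e < y < al j e &
                  forall z, al i e < z < al j e -> P (upd e d z)],
       exists i, [/\ (i < m)%N, al i e < y & forall z, al i e < z -> P (upd e d z)],
       exists j, [/\ (j < m)%N, y < al j e & forall z, z < al j e -> P (upd e d z)] |
       forall z, P (upd e d z)]].
Proof.
move=> hP dP; have [n [A [A1 A2 A3]]] := sa_line hP dP.
pose Q e := exists i : 'I_n, A i e != 0 /\ (A i e).[e d] = 0.
have hQ : sa Q.
  apply: sa_exists_fin => i; apply: sa_and; first exact: sa_neq0.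
  by apply: sa_eq_poly; [apply: pX_horner|].
have dQ : dep d.+1 Q.
  move=> e e' h; rewrite /Q; have E i : A i e = A i e' by apply: A2 => j jd; apply: h; rewrite ltnS ltnW.
  by rewrite (h d) //; under eq_exists do rewrite E.
have [N hN] : exists N, forall i : 'I_n, forall e, (size (A i e) <= N)%N.
  have [Ns hNs] := choice (fun i => (A1 i).2).
  exists (\max_(i < n) Ns i)%N => i e; apply: leq_trans (hNs i e) _.
  exact: (@leq_bigmax _ (fun i : 'I_n => Ns i)).
have [|m [al [h1 h2 h3]]] := @finite_fibres_sections (n * N) d Q hQ dQ.
  move=> e; have H i : exists s : seq R, (size s <= N)%N /\
      (A i e != 0 -> forall x, (A i e).[x] = 0 -> (i < n)%N -> x \in s).
    have [A0|A0] := eqVneq (A i e) 0; first by exists [::].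
    case: (ltnP i n) => iN; last by exists [::].
    have [s ss hs] := poly_roots_seq A0; exists s; split => [|_ x xs _]; last exact: hs.
    by apply: leq_trans ss (hN (Ordinal iN) e).
  have [s hs] := choice H.
  exists (flatten [seq s i | i <- iota 0 n]).
    rewrite size_flatten /shape -map_comp.
    have H' js : (sumn [seq (size \o s) i | i <- js] <= size js * N)%N.
      elim: js => //= j js IH; rewrite mulSn leq_add //.
      by have [] := hs j.
    by apply: leq_trans (H' _) _; rewrite size_iota.
  move=> y [i []]; rewrite upd_same (dep_upd _ _ (A2 i)) => A0 Ay.
  apply/flattenP; exists (s i); first by rewrite map_f // mem_iota /= add0n.
  by have [_] := hs i; apply.
exists m, al; split => // e y Py.
have noroot i x : (i < n)%N -> A i e != 0 -> (A i e).[x] = 0 ->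
    exists2 l, (l < m)%N & x = al l e.
  move=> iN A0 Ax; apply: h3; exists (Ordinal iN).
  by rewrite upd_same (dep_upd _ _ (A2 i)).
have cst z : (forall l, (l < m)%N -> ~ (Num.min y z <= al l e <= Num.max y z)) ->
    P (upd e d z).
  move=> H; suff : P (upd e d (Num.min y z)) = P (upd e d (Num.max y z)).
    by have [_|_] := leP y z => E; [rewrite -E|rewrite E].
  apply: A3; first by rewrite ge_min le_max !lexx.
  move=> i iN A0 x hx; apply/eqP => /(noroot _ _ iN A0)[l lm xl].
  by apply: (H l lm); rewrite -xl.
have [[i iN yi]|nroot] := pselect (exists2 i, (i < m)%N & y = al i e).
  by left; exists i.
right; pose s := [seq al i e | i <- iota 0 m].
have sP x : x \in s -> exists2 i, (i < m)%N & x = al i e.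
  by move=> /mapP[i]; rewrite mem_iota => hi ->; exists i.
have Ps i : (i < m)%N -> al i e \in s.
  by move=> hi; rewrite map_f // mem_iota.
have LO : (exists i, [/\ (i < m)%N, al i e < y & forall l, (l < m)%N -> al l e < y -> al l e <= al i e])
    \/ (forall l, (l < m)%N -> y < al l e).
  have [[x xs xy]|hn] := pselect (exists2 x, x \in s & x < y).
    have [|M My hM] := @seq_max (fun x => x < y /\ x \in s) s; first by exists x.
    have [My1 /sP [i im Mi]] := My.
    left; exists i; split => //; first by rewrite -Mi.
    by move=> l lm ly; rewrite -Mi; apply: hM; [exact: Ps|split => //; exact: Ps].
  right => l lm; rewrite ltNge le_eqVlt; apply/negP => /orP[/eqP h|h].
    by apply: nroot; exists l.
  by apply: hn; exists (al l e) => //; exact: Ps.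
have HI : (exists i, [/\ (i < m)%N, y < al i e & forall l, (l < m)%N -> y < al l e -> al i e <= al l e])
    \/ (forall l, (l < m)%N -> al l e < y).
  have [[x xs xy]|hn] := pselect (exists2 x, x \in s & y < x).
    have [|M My hM] := @seq_min (fun x => y < x /\ x \in s) s; first by exists x.
    have [My1 /sP [i im Mi]] := My.
    left; exists i; split => //; first by rewrite -Mi.
    by move=> l lm ly; rewrite -Mi; apply: hM; [exact: Ps|split => //; exact: Ps].
  right => l lm; rewrite ltNge le_eqVlt; apply/negP => /orP[/eqP h|h].
    by apply: nroot; exists l.
  by apply: hn; exists (al l e) => //; exact: Ps.
have key l z : (l < m)%N -> Num.min y z <= al l e <= Num.max y z ->
    (al l e < y /\ z <= al l e) \/ (y < al l e /\ al l e <= z).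
  move=> lm; rewrite ge_min le_max => /andP[h4 h5].
  have [h|h|h] := ltgtP (al l e) y.
  - by left; split => //; case/orP: h4 => // /(lt_le_trans h); rewrite ltxx.
  - by right; split => //; case/orP: h5 => // /(lt_le_trans h); rewrite ltxx.
  - by exfalso; apply: nroot; exists l.
case: LO => [[i [im iy imax]]|LO]; case: HI => [[j [jm jy jmin]]|HI].
- apply: Or41; exists i, j; split; rewrite ?iy ?jy // => z /andP[iz zj].
  apply: cst => l lm /(key l z lm) [[l1 l2]|[l1 l2]].
    by have := lt_le_trans iz (le_trans l2 (imax l lm l1)); rewrite ltxx.
  by have := le_lt_trans (le_trans (jmin l lm l1) l2) zj; rewrite ltxx.
- apply: Or42; exists i; split => // z iz.
  apply: cst => l lm /(key l z lm) [[l1 l2]|[l1 l2]].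
    by have := lt_le_trans iz (le_trans l2 (imax l lm l1)); rewrite ltxx.
  by have := lt_trans (HI l lm) l1; rewrite ltxx.
- apply: Or43; exists j; split => // z zj.
  apply: cst => l lm /(key l z lm) [[l1 l2]|[l1 l2]].
    by have := lt_trans (LO l lm) l1; rewrite ltxx.
  by have := le_lt_trans (le_trans (jmin l lm l1) l2) zj; rewrite ltxx.
- apply: Or44 => z; apply: cst => l lm /(key l z lm) [[l1 l2]|[l1 l2]].
    by have := lt_trans (LO l lm) l1; rewrite ltxx.
  by have := lt_trans (HI l lm) l1; rewrite ltxx.
Qed.

(** The candidates are tried in the order of the list; each trial is a
    semialgebraic case distinction. *)
Lemma saf_first (T : eqType) (s : seq T) d P (c : T -> env -> R) : sa P -> dep d.+1 P ->
  (forall i, saf (c i)) -> (forall i, dep d (c i)) ->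
  exists g, [/\ saf g, dep d g &
    forall e i, i \in s -> P (upd e d (c i e)) -> P (upd e d (g e))].
Proof.
move=> hP dP hc dc; elim: s => [|t s [g [g1 g2 g3]]].
  by exists (fun _ => 0); split => //.
exists (fun e => if `[< P (upd e d (c t e)) >] then c t e else g e); split.
- by apply: saf_if => //; exact: sa_upd.
- move=> e e' h; have -> : P (upd e d (c t e)) = P (upd e' d (c t e')).
    apply: dP => i; rewrite ltnS /upd (dc t e e') //.
    by case: (ltngtP i d) => // id _; exact: h.
  by rewrite (dc t e e') // (g2 e e').
move=> e i; case: asboolP => // nP; rewrite inE => /orP[/eqP -> //|].
exact: g3.
Qed.

(** Definable choice: each cell of a line contains one of finitely many sample
    points, namely an end point, the midpoint of two end points, an end point
    moved by one, or zero. *)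
Theorem sa_choice d P : sa P -> dep d.+1 P -> exists g,
  [/\ saf g, dep d g & forall e y, P (upd e d y) -> P (upd e d (g e))].
Proof.
move=> hP dP; have [m [al [h1 h2 h3]]] := line_cells hP dP.
(* The first component is the kind of sample point, the second the end points. *)
pose c (t : 'I_4 * (nat * nat)) e : R :=
  let i := t.2.1 in let j := t.2.2 in
  if t.1 == 0 :> nat then (al i e + al j e) * 2^-1 else
  if t.1 == 1 :> nat then al i e + 1 else
  if t.1 == 2 :> nat then al i e + -1 else 0.
have [] := @saf_first _ [seq (k, ij) | k <- enum 'I_4,
   ij <- [seq (i, j) | i <- iota 0 m, j <- iota 0 m] ++ [:: (0%N, 0%N)]] d P c hP dP.
- move=> [k [i j]]; rewrite /c /=; case: (k == 0 :> nat).
    by apply: safM => //; apply: safD.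
  by case: (k == 1 :> nat); [apply: safD|case: (k == 2 :> nat) => //; apply: safD].
- by move=> [k [i j]] e e' h; rewrite /c /= (h2 i e e') // (h2 j e e').
move=> g [g1 g2 g3]; exists g; split => // e y Py.
have mem (k : 'I_4) i j : (i < m)%N -> (j < m)%N -> P (upd e d (c (k, (i, j)) e)) -> P (upd e d (g e)).
  move=> im jm; apply: g3; apply/allpairsP; exists (k, (i, j)); split => //.
    by rewrite mem_enum.
  by rewrite mem_cat; apply/orP; left; apply/allpairsP; exists (i, j); rewrite /= !mem_iota.
have [[i im yi]|[]] := h3 e y Py.
- apply: (mem (@Ordinal 4 0 isT) i i) => //; rewrite /c /=.
  by have -> : (al i e + al i e) * 2^-1 = y by rewrite yi; field.
- move=> [i [j [im jm /andP[iy yj] H]]]; apply: (mem (@Ordinal 4 0 isT) i j) => //.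
  by apply: H; rewrite /c /=; move: iy yj; lra.
- move=> [i [im iy H]]; apply: (mem (@Ordinal 4 1 isT) i i) => //.
  by apply: H; rewrite /c /= ltrDl.
- move=> [i [im iy H]]; apply: (mem (@Ordinal 4 2 isT) i i) => //.
  by apply: H; rewrite /c /= gtrDl oppr_lt0.
- move=> H; apply: (g3 _ (@Ordinal 4 3 isT, (0%N, 0%N))); last exact: H.
  apply/allpairsP; exists (@Ordinal 4 3 isT, (0%N, 0%N)); split => //.
    by rewrite mem_enum.
  by rewrite mem_cat /= inE eqxx orbT.
Qed.

End Lines.

(** * Covers by images of arc-analytic maps *)

Section Covers.
Variable R : realType.
Notation env := (env R).
Implicit Types (e u v : env) (P Q : env -> Prop) (f g h xi : env -> R) (psi phi : env -> env).

(** Arcs through sequences are taken coordinatewise analytic in all entries,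
    so that the property is stable under composition. *)
Definition arcf f := forall (ga : R -> env) (t0 : R),
  (forall i, ana (fun t => ga t i) t0) -> ana (fun t => f (ga t)) t0.

Definition param k psi :=
  [/\ dep k psi, forall i, saf (fun e => psi e i) & forall i, arcf (fun e => psi e i)].

Definition agree d e u := forall i, (i < d)%N -> e i = u i.

Definition stable (Pr : (env -> env) -> Prop) :=
  forall k psi phi, param k phi -> Pr psi -> Pr (fun e => psi (phi e)).

(** Sets of dimension less than [k] in [R^d], in a form suited to arc-analytic
    functions: finite unions of images of spaces [R^j] with [j < k] under
    semialgebraic maps that send analytic arcs to analytic arcs. The pullback
    of an arc-analytic function along such a map is arc-analytic, so questions
    about its zeros can be settled by induction on the dimension of the
    source. The predicate [Pr] records further properties of the maps. *)
Inductive cov (Pr : (env -> env) -> Prop) (d k : nat) : (env -> Prop) -> Prop :=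
| cov_empty : cov Pr d k (fun _ => False)
| cov_img j psi : (j < k)%N -> param j psi -> Pr psi ->
    cov Pr d k (fun e => exists u, agree d e (psi u))
| covU P Q : cov Pr d k P -> cov Pr d k Q -> cov Pr d k (fun e => P e \/ Q e).

Definition anyp (psi : env -> env) := True.

Lemma cov_ext Pr d k P Q : (forall e, P e <-> Q e) -> cov Pr d k P -> cov Pr d k Q.
Proof. by move=> h; have -> : Q = P by apply/funext => e; apply/propext; split=> /h. Qed.

Lemma cov_mono Pr d k k' P : (k <= k')%N -> cov Pr d k P -> cov Pr d k' P.
Proof.
move=> kk; elim => [|j psi jk hpsi pr|A B _ hA _ hB].
- exact: cov_empty.
- by apply: cov_img (hpsi) pr; apply: leq_trans kk.
- exact: covU.
Qed.

Lemma cov_bigU Pr d k (P : nat -> env -> Prop) m :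
  (forall i, (i < m)%N -> cov Pr d k (P i)) ->
  cov Pr d k (fun e => exists2 i, (i < m)%N & P i e).
Proof.
elim: m => [_|m IH H].
  by apply: cov_ext (cov_empty _ _ _) => e; split => // -[].
apply: cov_ext (covU (IH (fun i im => H i (ltnW im))) (H m (ltnSn m))) => e.
split => [[[i im hi]|hm]|[i]].
- by exists i => //; exact: ltnW.
- by exists m.
- by rewrite ltnS leq_eqVlt => /orP[/eqP -> |im] hi; [right|left; exists i].
Qed.

Lemma arcf_cst (c : R) : arcf (fun _ => c).
Proof. by move=> ga t0 _; exact: ana_cst. Qed.

Lemma arcf_var i : arcf (fun e => e i).
Proof. by move=> ga t0; apply. Qed.

Lemma arcfD f g : arcf f -> arcf g -> arcf (fun e => f e + g e).
Proof. by move=> hf hg ga t0 H; apply: anaD; [exact: hf|exact: hg]. Qed.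

Lemma arcfM f g : arcf f -> arcf g -> arcf (fun e => f e * g e).
Proof. by move=> hf hg ga t0 H; apply: anaM; [exact: hf|exact: hg]. Qed.

Lemma arcf_comp f psi : arcf f -> (forall i, arcf (fun e => psi e i)) ->
  arcf (fun e => f (psi e)).
Proof. by move=> hf hp ga t0 H; apply: (hf (fun t => psi (ga t))) => i; exact: hp. Qed.

Lemma arcf_poly f : polyf f -> arcf f.
Proof.
elim => [c|i|a b _ ha _ hb|a b _ ha _ hb].
- exact: arcf_cst.
- exact: arcf_var.
- exact: arcfD.
- exact: arcfM.
Qed.

Lemma param_comp j l psi phi : param j psi -> param l phi ->
  param l (fun e => psi (phi e)).
Proof.
move=> [p1 p2 p3] [q1 q2 q3]; split.
- by move=> e e' H; rewrite (q1 e e').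
- by move=> i; exact: (saf_comp (p2 i) q2).
- by move=> i; exact: (arcf_comp (p3 i) q3).
Qed.

Lemma param_cst (u : env) : param 0 (fun _ => u).
Proof. by split => // i; exact: arcf_cst. Qed.

Lemma cov_in Pr d k A A' : cov Pr d k A -> (forall e, A e -> A' e) ->
  cov (fun psi => Pr psi /\ forall u, A' (psi u)) d k A.
Proof.
elim => [_|j psi jk hpsi pr H|P Q _ hP _ hQ H].
- exact: cov_empty.
- by apply: (cov_img d jk hpsi); split => // u; apply: H; exists u.
- by apply: covU; [apply: hP => e he; apply: H; left|apply: hQ => e he; apply: H; right].
Qed.

(** A cover of the source is pushed forward, and the properties required of
    the composite maps may use those of the inner ones. *)
Lemma cov_image Pr0 Pr d j k B psi : cov Pr0 j k B -> param j psi ->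
  (forall l phi, param l phi -> Pr0 phi -> Pr (fun e => psi (phi e))) ->
  cov Pr d k (fun e => exists2 u, B u & agree d e (psi u)).
Proof.
move=> hB hpsi H; elim: hB => [|l phi lk hphi pr|P Q _ hP _ hQ].
- by apply: cov_ext (cov_empty _ _ _) => e; split => // -[].
- apply: cov_ext (cov_img d lk (param_comp hpsi hphi) (H _ _ hphi pr)) => e.
  have [dpsi _ _] := hpsi.
  split => [[v hv]|[u [v uv] eu]].
    by exists (phi v) => //; exists v.
  by exists v => i id; rewrite eu // (dpsi u (phi v)).
- apply: cov_ext (covU hP hQ) => e.
  split => [[[u hu eu]|[u hu eu]]|[u [hu|hu] eu]].
  + by exists u => //; left.
  + by exists u => //; right.
  + by left; exists u.
  + by right; exists u.
Qed.

Definition decomposable d := forall A, sa A -> dep d A -> cov anyp d d.+1 A.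

Definition piecewise_arcf d := forall xi, saf xi -> dep d xi ->
  cov (fun psi => arcf (fun e => xi (psi e))) d d.+1 (fun _ => True).

Definition thin_zeros d := forall h, saf h -> dep d h -> arcf h ->
  (exists e, h e != 0) -> cov anyp d d (fun e => h e = 0).

(** The subset is pulled back to the sources of the maps and decomposed there.
    *)
Lemma cov_sub Pr d k A A' : stable Pr -> (forall j, (j < k)%N -> decomposable j) ->
  cov Pr d k A -> sa A' -> dep d A' -> (forall e, A' e -> A e) -> cov Pr d k A'.
Proof.
move=> sPr HD hA sA' dA' sub.
suff : cov Pr d k (fun e => A' e /\ A e).
  by apply: cov_ext => e; split => [[]//|h]; split => //; exact: sub.
elim: hA => [|j psi jk hpsi pr|P Q _ hP _ hQ].
- by apply: cov_ext (cov_empty _ _ _) => e; split => // -[].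
- have [p1 p2 p3] := hpsi.
  have h1 : sa (fun u => A' (psi u)) by exact: (sa_comp sA' p2).
  have h2 : dep j (fun u => A' (psi u)) by move=> e e' H; rewrite (p1 e e').
  have := @cov_image anyp Pr d j j.+1 _ psi (HD j jk _ h1 h2) hpsi.
  move=> /(_ (fun l phi hphi _ => sPr l _ _ hphi pr)) /(cov_mono jk).
  apply: cov_ext => e; split => [[u hu eu]|[he [u eu]]].
    split; last by exists u.
    by rewrite (dA' e (psi u)).
  by exists u => //; rewrite -(dA' e (psi u)).
- by apply: cov_ext (covU hP hQ) => e; tauto.
Qed.

(** Each map of the cover is composed with the maps that make the pullback of
    [xi] arc-analytic. *)
Lemma cov_refine Pr d k A xi : stable Pr -> (forall j, (j < k)%N -> piecewise_arcf j) ->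
  saf xi -> dep d xi -> cov Pr d k A ->
  cov (fun psi => Pr psi /\ arcf (fun e => xi (psi e))) d k A.
Proof.
move=> sPr HP hxi dxi; elim => [|j psi jk hpsi pr|P Q _ hP _ hQ].
- exact: cov_empty.
- have [p1 p2 p3] := hpsi.
  have h1 : saf (fun u => xi (psi u)) by exact: (saf_comp hxi p2).
  have h2 : dep j (fun u => xi (psi u)) by move=> e e' H; rewrite (p1 e e').
  have := @cov_image _ (fun psi => Pr psi /\ arcf (fun e => xi (psi e)))
    d j j.+1 _ psi (HP j jk _ h1 h2) hpsi.
  move=> /(_ (fun l phi hphi H => conj (sPr l _ _ hphi pr) H)).
  move=> /(cov_mono jk).
  by apply: cov_ext => e; split => [[u _ eu]|[u eu]]; exists u.
- exact: covU.
Qed.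

Lemma stable_anyp : stable anyp. Proof. by []. Qed.

Lemma stable_and (Pr Pr' : (env -> env) -> Prop) : stable Pr -> stable Pr' ->
  stable (fun psi => Pr psi /\ Pr' psi).
Proof.
by move=> h1 h2 k psi phi hphi [p1 p2]; split; [exact: (h1 k)|exact: (h2 k)].
Qed.

Lemma stable_arcf xi : stable (fun psi => arcf (fun e => xi (psi e))).
Proof. by move=> k psi phi [_ _ h] hpsi; exact: (arcf_comp hpsi h). Qed.

Lemma decomposable0 : decomposable 0.
Proof.
move=> A sA dA; have [h|h] := pselect (A (fun _ => 0)).
  apply: cov_ext (@cov_img anyp 0 1 0 _ isT (param_cst (fun _ => 0)) I) => e.
  split => _; last by exists e.
  by rewrite (dA e (fun _ => 0)).
apply: cov_ext (cov_empty _ _ _) => e; split => // he; apply: h.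
by rewrite -(dA e).
Qed.

Lemma thin_zeros0 : thin_zeros 0.
Proof.
move=> h _ dh _ [e0 h0]; apply: cov_ext (cov_empty _ _ _) => e; split => //.
by move=> /eqP; rewrite (dh e e0) // (negbTE h0).
Qed.

(** * Generic continuity of semialgebraic functions *)

Definition box k e r u := forall i, (i < k)%N -> `|u i - e i| < r.

Lemma arc_near_box k (ga : R -> env) (t0 del : R) :
  (forall i, (i < k)%N -> ana (fun t => ga t i) t0) -> 0 < del ->
  \forall t \near t0, box k (ga t0) del (ga t).
Proof.
move=> hga del0; elim: k hga => [|k IH] hga; first by near=> t.
have hk : \forall t \near t0, `|ga t k - ga t0 k| < del.
  have /cvgrPdist_lt/(_ del del0) := ana_cvg (hga k (ltnSn k)).
  by apply: filterS => t; rewrite distrC.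
have IHk := IH (fun i ik => hga i (ltnW ik)).
near=> t => i; rewrite ltnS leq_eqVlt => /orP[/eqP ->|]; first by near: t.
by move: i; rewrite -/(box k (ga t0) del (ga t)); near: t.
Unshelve. all: by end_near. Qed.

Lemma polyf_cont f e eps : polyf f -> 0 < eps -> exists2 del, 0 < del &
  forall u, (forall i, `|u i - e i| < del) -> `|f u - f e| < eps.
Proof.
move=> hf; elim: hf eps => [c|i|a b _ ha _ hb|a b _ ha _ hb] eps eps0.
- by exists 1 => // u _; rewrite subrr normr0.
- by exists eps.
- have [|d1 d10 h1] := ha (eps / 2); first by rewrite divr_gt0.
  have [|d2 d20 h2] := hb (eps / 2); first by rewrite divr_gt0.
  exists (Num.min d1 d2); first by rewrite lt_min d10.
  move=> u hu; have -> : a u + b u - (a e + b e) = (a u - a e) + (b u - b e) by ring.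
  apply: le_lt_trans (ler_normD _ _) _; rewrite (splitr eps) ltrD //.
    by apply: h1 => i; have := hu i; rewrite lt_min => /andP[].
  by apply: h2 => i; have := hu i; rewrite lt_min => /andP[].
- pose M := `|a e| + `|b e| + 1.
  have M0 : 0 < M by rewrite ltr_wpDl // addr_ge0.
  have m0 : 0 < Num.min 1 (eps / (2 * M)) by rewrite lt_min ltr01 divr_gt0 // mulr_gt0.
  have [d1 d10 h1] := ha _ m0; have [d2 d20 h2] := hb _ m0.
  exists (Num.min d1 d2); first by rewrite lt_min d10.
  move=> u hu.
  have /h1 : forall i, `|u i - e i| < d1 by move=> i; have := hu i; rewrite lt_min => /andP[].
  rewrite lt_min => /andP[a1 a2].
  have /h2 : forall i, `|u i - e i| < d2 by move=> i; have := hu i; rewrite lt_min => /andP[].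
  rewrite lt_min => /andP[b1 b2].
  have -> : a u * b u - a e * b e = (a u - a e) * (b u - b e) + (a u - a e) * b e + a e * (b u - b e).
    by ring.
  have H1 : `|(a u - a e) * (b u - b e)| <= `|a u - a e|.
    by rewrite normrM ler_piMr // ltW.
  apply: le_lt_trans (ler_normD _ _) _.
  apply: le_lt_trans (lerD (ler_normD _ _) (lexx _)) _.
  rewrite !normrM in H1 *.
  apply: (@le_lt_trans _ _ (`|a u - a e| * (1 + `|b e|) + `|a e| * `|b u - b e|)).
    by rewrite lerD2r mulrDr mulr1 lerD2r.
  apply: (@le_lt_trans _ _ (`|a u - a e| * M + M * `|b u - b e|)).
    apply: lerD; [apply: ler_wpM2l|apply: ler_wpM2r] => //; rewrite /M.
      by rewrite addrC lerD2r lerDr.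
    by rewrite -addrA lerDl addr_ge0.
  rewrite mulrC -mulrDr.
  have : `|a u - a e| + `|b u - b e| < eps / M.
    have -> : eps / M = eps / (2 * M) + eps / (2 * M) by field; rewrite gt_eqF.
    exact: ltrD.
  by rewrite ltr_pdivlMr // mulrC.
Qed.

Lemma polyf_sign_near k f e : polyf f -> dep k f -> f e != 0 ->
  exists2 del, 0 < del & forall u, box k e del u -> Num.sg (f u) = Num.sg (f e).
Proof.
move=> hf df fe; have nfe : 0 < `|f e| by rewrite normr_gt0.
have [del del0 hdel] := polyf_cont e hf nfe; exists del => // u hu.
have : `|f u - f e| < `|f e|.
  have -> : f u = f (fun i => if (i < k)%N then u i else e i) by apply: df => i ->.
  apply: hdel => i; case: ifP => ik; last by rewrite subrr normr0.
  exact: hu.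
move: fe; have [fe _|fe _|//] := ltgtP (f e) 0.
  rewrite (ltr0_norm fe) ltr_norml (ltr0_sg fe) => /andP[_ h].
  by rewrite ltr0_sg //; lra.
rewrite (gtr0_norm fe) ltr_norml (gtr0_sg fe) => /andP[h _].
by rewrite gtr0_sg //; lra.
Qed.

(** Either the polynomial vanishes on a whole box, or it is nonzero at some
    point and keeps its sign near that point. *)
Lemma polyf_sign_box k f e r : polyf f -> dep k f -> 0 < r -> exists v s,
  [/\ 0 < s, forall i, (i < k)%N -> `|v i - e i| + s < r &
   forall u, box k v s u -> Num.sg (f u) = Num.sg (f v)].
Proof.
move=> hf df r0.
have [[w we fw]|hn] := pselect (exists2 w, box k e (r / 2) w & f w != 0); last first.
  exists e, (r / 2 / 2); split; first by rewrite !divr_gt0.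
    by move=> i _; rewrite subrr normr0 add0r; lra.
  have z u : box k e (r / 2) u -> f u = 0.
    by move=> hu; apply: contrapT => /eqP fu; apply: hn; exists u.
  move=> u hu; rewrite !z // => i ik; first by rewrite subrr normr0 divr_gt0.
  by have := hu i ik; move: r0; lra.
have [del del0 hdel] := polyf_sign_near hf df fw.
exists w, (Num.min del (r / 2)); split.
- by rewrite lt_min del0 divr_gt0.
- move=> i ik; have := we i ik.
  have : Num.min del (r / 2) <= r / 2 by rewrite ge_min lexx orbT.
  by move: r0; lra.
move=> u hu; apply: hdel => i ik.
by have := hu i ik; rewrite lt_min => /andP[].
Qed.

Lemma sa_box k P e r : sa P -> dep k P -> 0 < r -> exists v s,
  [/\ 0 < s, forall i, (i < k)%N -> `|v i - e i| + s < r &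
   forall u, box k v s u -> P u = P v].
Proof.
move=> sP dP r0; have [n [ps [h1 h2]]] := sa_signs sP.
have [v [s [s0 hv hs]]] : exists v s,
  [/\ 0 < s, forall i, (i < k)%N -> `|v i - e i| + s < r &
   forall u, box k v s u -> forall j, (j < n)%N ->
     Num.sg (ps j (trunc k u)) = Num.sg (ps j (trunc k v))].
  elim: (n) => [|m [v [s [s0 hv hs]]]].
    by exists e, (r / 2); split; rewrite ?divr_gt0 // => i _; rewrite subrr normr0; lra.
  have pm : polyf (fun e => ps m (trunc k e)).
    apply: (@polyf_subst _ _ (fun i e => trunc k e i)) => // i.
    by rewrite /trunc; case: (i < k)%N.
  have [w [t [t0 hw ht]]] := polyf_sign_box v pm (@dep_of_trunc _ _ k (ps m)) s0.
  exists w, t; split => //.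
    move=> i ik; have := hv i ik; have := hw i ik.
    have -> : w i - e i = (w i - v i) + (v i - e i) by rewrite addrA subrK.
    by have := ler_normD (w i - v i) (v i - e i); lra.
  move=> u hu j; rewrite ltnS leq_eqVlt => /orP[/eqP ->|jm]; first exact: ht.
  have wv : box k v s w.
    by move=> i ik; have := hw i ik; move: t0; lra.
  rewrite (hs u) ?(hs w) // => i ik; have := hw i ik; have := hu i ik.
  have -> : u i - v i = (u i - w i) + (w i - v i) by rewrite addrA subrK.
  by have := ler_normD (u i - w i) (w i - v i); lra.
exists v, s; split => // u hu.
rewrite -[LHS](dep_trunc u dP) -[RHS](dep_trunc v dP).
by apply: h2 => j jn; exact: hs.
Qed.

(** Discontinuity as a function on [R^k]: truncation keeps the entries from
    [k] on out of the comparison. *)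
Definition discont k xi e := exists eps, 0 < eps /\
  forall del, 0 < del -> exists u, box k e del (trunc k u) /\ eps <= `|xi (trunc k u) - xi e|.

Lemma not_discont k xi e eps : dep k xi -> ~ discont k xi e -> 0 < eps ->
  exists2 del, 0 < del & forall u, box k e del u -> `|xi u - xi e| < eps.
Proof.
move=> dxi nd eps0; apply: contrapT => hn; apply: nd; exists eps; split => // del del0.
apply: contrapT => hn'; apply: hn; exists del => // u hu.
rewrite ltNge; apply/negP => h'; apply: hn'; exists u; rewrite (dep_trunc u dxi).
by split => // i ik; rewrite /trunc ik; exact: hu.
Qed.

Lemma sa_box_rel k (a b : nat -> env -> R) c : (forall i, saf (a i)) -> (forall i, saf (b i)) ->
  saf c -> sa (fun e => forall i, (i < k)%N -> `|a i e - b i e| < c e).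
Proof.
move=> ha hb hc; elim: k => [|k IH].
  by apply: sa_ext (sa_cst _ True) => e; split.
have h : sa (fun e => `|a k e - b k e| < c e).
  by apply: sa_lt => //; apply: saf_abs; exact: safB.
apply: sa_ext (sa_and IH h) => e; split => [[h1 h2] i|h1].
  by rewrite ltnS leq_eqVlt => /orP[/eqP ->|/h1].
by split => [i ik|]; apply: h1 => //; rewrite ltnW.
Qed.

Lemma saf_trunc k f : saf f -> saf (fun e => f (trunc k e)).
Proof.
move=> hf; apply: (saf_comp hf) => i; rewrite /trunc.
by case: (i < k)%N.
Qed.

Lemma sa_discont k xi : saf xi -> sa (discont k xi).
Proof.
move=> hxi.
apply: (@sa_exists _ (fun eps e => 0 < eps /\ forall del, 0 < del ->
   exists u, box k e del (trunc k u) /\ eps <= `|xi (trunc k u) - xi e|)).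
apply: sa_and; first by apply: sa_lt.
apply: (@sa_forall _ (fun del e => 0 < del -> exists u, box k (shift 1 e) del (trunc k u) /\
  e 0%N <= `|xi (trunc k u) - xi (shift 1 e)|)).
apply: sa_imp; first by apply: sa_lt.
apply: (@sa_exists_env _ k (fun u e => box k (shift 1 (shift 1 e)) (e 0%N) u /\
  shift 1 e 0%N <= `|xi u - xi (shift 1 (shift 1 e))|)).
apply: sa_and.
  apply: (@sa_box_rel k (fun i e => trunc k e i) (fun i e => shift 1 (shift 1 (shift k e)) i)
     (fun e => shift k e 0%N)) => [i|i|].
  - by rewrite /trunc; case: (i < k)%N.
  - exact: (saf_var _ (i + 1 + 1 + k)%N).
  - exact: (saf_var _ (0 + k)%N).
apply: sa_le; first exact: (saf_var _ (0 + 1 + k)%N).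
apply: saf_abs; apply: safB; first exact: saf_trunc.
by apply: (saf_comp hxi) => i; exact: (saf_var _ (i + 1 + 1 + k)%N).
Qed.

Lemma dep_discont k xi : dep k xi -> dep k (discont k xi).
Proof.
move=> dxi; have one e e' : (forall i, (i < k)%N -> e i = e' i) ->
    discont k xi e -> discont k xi e'.
  move=> H [eps [eps0 h]]; exists eps; split => // del /h [u [h1 h2]].
  exists u; rewrite -(dxi e e' H); split => // i ik.
  by rewrite -H //; exact: h1.
move=> e e' H; apply/propext; split; apply: one => // i ik.
by rewrite H.
Qed.

(** A Baire category argument: each condition [xi < q], with [q] rational, is
    constant on a smaller box, and nested boxes chosen for all [q] in turn
    shrink to a point of continuity. *)
Lemma discont_no_interior k xi e r : saf xi -> dep k xi -> 0 < r ->
  exists2 u, box k e r u & ~ discont k xi u.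
Proof.
move=> hxi dxi r0.
pose q n : R := if (unpickle n : option rat) is Some x then ratr x else 0.
pose rel (n : nat) (a b : env * R) := 0 < a.2 -> [/\ 0 < b.2,
   forall i, (i < k)%N -> `|b.1 i - a.1 i| + b.2 < a.2 &
   forall u, box k b.1 b.2 u -> (xi u < q n) = (xi b.1 < q n)].
have Hrel n a : exists b, rel n a b.
  have [a0|a0] := ltrP 0 a.2; last by exists a; move=> /lt_le_trans/(_ a0); rewrite ltxx.
  have [||v [s [s0 hv hs]]] := @sa_box k (fun u => xi u < q n) a.1 a.2 _ _ a0.
  - by apply: sa_lt.
  - by move=> u u' H; rewrite (dxi u u').
  exists (v, s) => _; split => // u /hs h.
  by apply/idP/idP => h'; [rewrite -h|rewrite h].
have [step hstep] := choice (fun na : nat * (env * R) => Hrel na.1 na.2).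
pose b := fix b n := if n is m.+1 then step (m, b m) else (e, r).
have b0 n : 0 < (b n).2.
  by elim: n => //= n IH; have [] := hstep (n, b n) IH.
have b1 n i : (i < k)%N -> `|(b n.+1).1 i - (b n).1 i| + (b n.+1).2 < (b n).2.
  by move=> ik; have [_ h _] := hstep (n, b n) (b0 n); exact: h.
have b2 n u : box k (b n.+1).1 (b n.+1).2 u -> (xi u < q n) = (xi (b n.+1).1 < q n).
  by have [_ _ h] := hstep (n, b n) (b0 n); exact: h.
have nest i m n : (i < k)%N -> (m <= n)%N ->
   (b m).1 i - (b m).2 <= (b n).1 i - (b n).2 /\ (b n).1 i + (b n).2 <= (b m).1 i + (b m).2.
  move=> ik; elim: n => [|n IH]; first by rewrite leqn0 => /eqP ->; rewrite !lexx.
  rewrite leq_eqVlt => /orP[/eqP -> //|]; rewrite ltnS => /IH [h1 h2].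
  have := b1 n i ik.
  have := ler_norm ((b n.+1).1 i - (b n).1 i).
  have := ler_norm (- ((b n.+1).1 i - (b n).1 i)); rewrite normrN.
  by move=> h3 h4 h5; split; lra.
pose E i := [set y | exists n, y = (b n).1 i - (b n).2].
pose x i := sup (E i).
have xE i n : (i < k)%N -> (b n).1 i - (b n).2 <= x i <= (b n).1 i + (b n).2.
  move=> ik; have ub m : ubound (E i) ((b m).1 i + (b m).2).
    move=> _ [l ->].
    have [_ h1] := nest i m (maxn m l) ik (leq_maxl _ _).
    have [h2 _] := nest i l (maxn m l) ik (leq_maxr _ _).
    by have := b0 (maxn m l); move: h1 h2; lra.
  apply/andP; split.
    by apply: ub_le_sup; [exists ((b 0).1 i + (b 0).2); exact: ub|exists n].
  by apply: ge_sup; [exists ((b 0).1 i - (b 0).2); exists 0%N|exact: ub].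
have xb n : box k (b n).1 (b n).2 x.
  move=> i ik; have /andP[h1 h2] := xE i n.+1 ik; have h3 := b1 n i ik.
  have : `|x i - (b n.+1).1 i| <= (b n.+1).2 by rewrite ler_norml; apply/andP; split; lra.
  have -> : x i - (b n).1 i = (x i - (b n.+1).1 i) + ((b n.+1).1 i - (b n).1 i).
    by rewrite addrA subrK.
  by have := ler_normD (x i - (b n.+1).1 i) ((b n.+1).1 i - (b n).1 i); lra.
exists x; first exact: (xb 0%N).
move=> [eps [eps0 hx]].
have near_q (y : R) : exists2 del, 0 < del & forall u, box k x del u ->
    forall n, y = q n -> (xi u < y) = (xi x < y).
  have [[n yn]|hn] := pselect (exists n, y = q n); last first.
    by exists 1 => // u _ n yn; exfalso; apply: hn; exists n.
  have [dl dl0 hdl] : exists2 dl, 0 < dl & forall i, (i < k)%N ->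
      `|x i - (b n.+1).1 i| + dl <= (b n.+1).2.
    elim: (k) (xb n.+1) => [_|l IH Hl]; first by exists 1.
    have [|dl dl0 hdl] := IH; first by move=> i il; apply: Hl; rewrite ltnW.
    exists (Num.min dl ((b n.+1).2 - `|x l - (b n.+1).1 l|)).
      by rewrite lt_min dl0 subr_gt0 Hl.
    move=> i; rewrite ltnS leq_eqVlt => /orP[/eqP ->|il].
      by rewrite -lerBrDl ge_min lexx orbT.
    by apply: le_trans (hdl i il); rewrite lerD2l ge_min lexx.
  exists dl => // u hu m ym; rewrite yn; apply: etrans (b2 n u _) (esym (b2 n x (xb n.+1))).
  move=> i ik; have := hu i ik; have := hdl i ik.
  have -> : u i - (b n.+1).1 i = (u i - x i) + (x i - (b n.+1).1 i) by rewrite addrA subrK.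
  by have := ler_normD (u i - x i) (x i - (b n.+1).1 i); lra.
have [|y1 hy1] := @rat_in_itvoo R (xi x - eps) (xi x); first by rewrite gtrBl.
have [|y2 hy2] := @rat_in_itvoo R (xi x) (xi x + eps); first by rewrite ltrDl.
move: hy1 hy2; rewrite !in_itv /= => /andP[l1 u1] /andP[l2 u2].
have q1 y : ratr y = q (pickle y) by rewrite /q pickleK.
have [d1 d10 H1] := near_q (ratr y1); have [d2 d20 H2] := near_q (ratr y2).
have [|u [ub uxi]] := hx (Num.min d1 d2); first by rewrite lt_min d10.
have c2 : xi (trunc k u) < ratr y2.
  rewrite (H2 (trunc k u) _ _ (q1 y2)) // => i ik.
  by have := ub i ik; rewrite lt_min => /andP[].
have c1 : ratr y1 <= xi (trunc k u).
  rewrite leNgt (H1 (trunc k u) _ _ (q1 y1)); first by rewrite -leNgt ltW.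
  by move=> i ik; have := ub i ik; rewrite lt_min => /andP[].
have : `|xi (trunc k u) - xi x| < eps by rewrite ltr_norml; apply/andP; split; lra.
by rewrite ltNge uxi.
Qed.

End Covers.

(** * Decomposition of semialgebraic sets *)

Section Decomposition.
Variable R : realType.
Notation env := (env R).
Implicit Types (e u v : env) (A B P Q : env -> Prop) (f g h xi : env -> R) (psi phi : env -> env).

Lemma poly_nonzero_near (p : {poly R}) y : p.[y] != 0 ->
  exists2 del, 0 < del & forall x, `|x - y| < del -> p.[x] != 0.
Proof.
move=> py.
have [del /= del0 h] := cvgr_neq0 _ (@continuous_horner R p y) py.
by exists del => // x xy; apply: h; rewrite /ball /= distrC.
Qed.

Lemma common_radius (n : nat) (p : nat -> R -> Prop) :
  (forall i, (i < n)%N -> exists2 del, 0 < del & forall x, 0 < x <= del -> p i x) ->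
  exists2 del, 0 < del & forall i, (i < n)%N -> p i del.
Proof.
move=> H; suff [del del0 h] : exists2 del, 0 < del &
    forall i, (i < n)%N -> forall x, 0 < x <= del -> p i x.
  by exists del => // i iN; apply: h; rewrite ?del0 /=.
elim: n H => [_|n IH H]; first by exists 1.
have [|d1 d10 h1] := IH; first by move=> i iN; apply: H; rewrite ltnW.
have [d2 d20 h2] := H n (ltnSn n).
exists (Num.min d1 d2); first by rewrite lt_min d10.
move=> i; rewrite ltnS leq_eqVlt => /orP[/eqP ->|iN] x /andP[x0];
  rewrite le_min => /andP[x1 x2]; [apply: h2|apply: h1] => //; exact/andP.
Qed.

(** Where none of the nonzero polynomials among those that define the set
    vanishes, their signs, hence membership, are locally constant. A set
    without interior therefore lies in the zero sets of these polynomials. *)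
Lemma thin_of_no_interior d A : thin_zeros R d -> (forall j, (j < d)%N -> decomposable R j) ->
  sa A -> dep d A -> (forall e r, 0 < r -> exists2 u, box d e r u & ~ A u) ->
  cov (@anyp R) d d A.
Proof.
move=> HT HD sA dA hA; have [n [ps [h1 h2]]] := sa_signs sA.
pose p j e := ps j (trunc d e).
have pp j : polyf (p j).
  apply: (@polyf_subst _ _ (fun i e => trunc d e i)) => // i.
  by rewrite /trunc; case: (i < d)%N.
have dp j : dep d (p j) by exact: dep_of_trunc.
have pA e u : (forall j, (j < n)%N -> Num.sg (p j e) = Num.sg (p j u)) -> A e = A u.
  by move=> H; rewrite -(dep_trunc e dA) -(dep_trunc u dA); exact: h2.
pose Z j e := (exists u, p j u != 0) /\ p j e = 0.
apply: (@cov_sub _ (@anyp R) d d (fun e => exists2 j, (j < n)%N & Z j e)) => //.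
  apply: cov_bigU => j jn; have [H|H] := pselect (exists u, p j u != 0).
    apply: cov_ext (HT (p j) (saf_poly (pp j)) (dp j) (arcf_poly (pp j)) H) => e.
    by split => [|[]].
  by apply: cov_ext (cov_empty _ _ _) => e; split => // -[].
move=> e Ae; apply: contrapT => hn.
have [|r r0 hr] := @common_radius n (fun j r => forall u, box d e r u ->
    Num.sg (p j u) = Num.sg (p j e)).
  move=> j jn; have [H|H] := pselect (exists u, p j u != 0); last first.
    have z u : p j u = 0 by apply: contrapT => /eqP hu; apply: H; exists u.
    by exists 1 => // x _ u _; rewrite !z.
  have pe : p j e != 0 by apply/eqP => pe; apply: hn; exists j.
  have [del del0 hdel] := polyf_sign_near (pp j) (dp j) pe.
  exists del => // x /andP[x0 xd] u hu; apply: hdel => i id.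
  exact: lt_le_trans (hu i id) xd.
have [u hu nAu] := hA e r r0; apply: nAu.
by rewrite (pA u e) // => j jn; exact: hr.
Qed.

Lemma near_all (p : R -> Prop) (a : R) : (forall t, p t) -> \forall t \near a, p t.
Proof. by move=> h; near=> t; exact: h. Unshelve. all: by end_near. Qed.

(** Membership in the graph changes between [xi e] and every nearby larger
    value, so one of the polynomials attached to the line vanishes at [xi e].
    *)
Lemma saf_root k xi : saf xi -> dep k xi -> exists n (A : nat -> env -> {poly R}),
  [/\ forall i, pX (A i), forall i, dep k (A i) &
   forall e, exists i, [/\ (i < n)%N, A i e != 0 & (A i e).[xi e] = 0]].
Proof.
move=> hxi dxi.
pose G e := e k = xi e.
have sG : sa G by exact: sa_eq.
have dG : dep k.+1 G.
by move=> e e' H; rewrite /G H // (dxi e e') // => i ik; apply: H; exact: ltnW.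
have [n [A [A1 A2 A3]]] := sa_line sG dG.
exists n, A; split => // e.
apply: contrapT => hn.
have [|del del0 hdel] := @common_radius n (fun i r => A i e != 0 ->
    forall x, xi e <= x <= xi e + r -> (A i e).[x] != 0).
  move=> i iN; have [A0|A0] := eqVneq (A i e) 0; first by exists 1.
  have Ax : (A i e).[xi e] != 0 by apply/eqP => Ax; apply: hn; exists i.
  have [del del0 h] := poly_nonzero_near Ax.
  exists (del / 2); first by rewrite divr_gt0.
  move=> x /andP[x0 xd] _ y /andP[y1 y2]; apply: h.
  by rewrite ger0_norm ?subr_ge0 //; lra.
have xd : xi e <= xi e + del by rewrite lerDl ltW.
have := A3 e _ _ xd hdel.
have E y : G (upd e k y) = (y = xi e) by rewrite /G upd_same (dep_upd _ _ dxi).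
rewrite !E => H; have : xi e + del = xi e by rewrite -H.
by move=> /eqP; rewrite -subr_eq0 addrAC subrr add0r gt_eqF.
Qed.

(** Functions to which the implicit function theorem applies at every point.
    *)
Definition simple_root_fun xi := exists q : env -> {poly R},
  [/\ exists N, forall e, (size (q e) <= N)%N, forall i, arcf (fun e => (q e)`_i) &
   forall e, (q e).[xi e] = 0 /\ (q e)^`().[xi e] != 0].

Lemma simple_root_fun_comp j xi psi : simple_root_fun xi -> param j psi ->
  simple_root_fun (fun e => xi (psi e)).
Proof.
move=> [q [[N hN] q2 q3]] [_ _ hpsi]; exists (fun e => q (psi e)); split => //.
- by exists N.
- by move=> i; exact: (arcf_comp (q2 i) hpsi).
Qed.

(** Along an arc that avoids the discontinuities, a simple root is continuous,
    hence analytic by the implicit function theorem. *)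
Lemma simple_root_fun_arcf k j xi psi : dep k xi -> simple_root_fun xi -> param j psi ->
  (forall u, ~ discont k xi (psi u)) -> arcf (fun e => xi (psi e)).
Proof.
move=> dxi [q [[N hN] q2 q3]] [_ _ hpsi] hd ga t0 hga.
pose de t := psi (ga t).
have hde i : ana (fun t => de t i) t0 by exact: (hpsi i ga t0 hga).
apply: (@simple_root_ana _ (fun t => q (de t)) t0 (fun t => xi (de t))).
- by split; [exists N|move=> i; exact: (q2 i de t0 hde)].
- apply/cvgrPdist_lt => eps eps0.
  have [del del0 hdel] := not_discont dxi (hd (ga t0)) eps0.
  have := arc_near_box (k := k) (fun i _ => hde i) del0.
  by apply: filterS => t ht; rewrite distrC; exact: hdel.
- by apply: (@near_all (fun t => (q (de t)).[xi (de t)] = 0)) => t; have [] := q3 (de t).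
- by have [] := q3 (de t0).
Qed.

(** The set of discontinuities has no interior, hence is covered by spaces of
    smaller dimension, on which the pullback of [xi] is again a simple root;
    off this set [xi] is arc-analytic. *)
Lemma piecewise_simple k xi : (forall j, (j <= k)%N -> decomposable R j) ->
  (forall j, (j <= k)%N -> thin_zeros R j) -> saf xi -> dep k xi -> simple_root_fun xi ->
  cov (fun psi => arcf (fun e => xi (psi e))) k k.+1 (fun _ => True).
Proof.
elim/ltn_ind: k xi => k IH xi HD HT hxi dxi sxi.
have sd := sa_discont k hxi; have dd := dep_discont dxi.
have thin : cov (@anyp R) k k (discont k xi).
  apply: thin_of_no_interior => //; first exact: HT.
    by move=> j jk; apply: HD; exact: ltnW.
  by move=> e r r0; exact: discont_no_interior.
have c1 : cov (fun psi => arcf (fun e => xi (psi e))) k k (discont k xi).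
  elim: thin => [|j psi jk hpsi _|P Q _ hP _ hQ].
  - exact: cov_empty.
  - have [p1 p2 p3] := hpsi.
    have := @cov_image _ _ (fun psi => arcf (fun e => xi (psi e))) k j j.+1 _ psi
      (IH j jk (fun u => xi (psi u)) _ _ _ _ _) hpsi.
    move=> /(_ _ _ _ _ _ (fun l phi hphi H => H)) /= H.
    apply: cov_ext (cov_mono jk (H _ _ _ _ _)).
    + by move=> e; split => [[u _ eu]|[u eu]]; exists u.
    + by move=> i ij; apply: HD; exact: leq_trans ij (ltnW jk).
    + by move=> i ij; apply: HT; exact: leq_trans ij (ltnW jk).
    + exact: (saf_comp hxi p2).
    + by move=> e e' E; rewrite (p1 e e').
    + exact: simple_root_fun_comp sxi hpsi.
  - exact: covU.
have c2 : cov (fun psi => arcf (fun e => xi (psi e))) k k.+1 (fun e => ~ discont k xi e).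
  have dn : dep k (fun e => ~ discont k xi e) by move=> e e' E; rewrite (dd e e').
  have := cov_in (HD k (leqnn k) _ (sa_not sd) dn) (fun e x => x).
  elim => [|j psi jk hpsi [_ pr]|P Q _ hP _ hQ].
  - exact: cov_empty.
  - by apply: (cov_img k jk hpsi); exact: simple_root_fun_arcf sxi hpsi pr.
  - exact: covU.
apply: cov_ext (covU (cov_mono (leqnSn k) c1) c2) => e; split => // _.
by have [h|h] := pselect (discont k xi e); [left|right].
Qed.

Lemma root_multiplicity (p : {poly R}) y : p != 0 -> p.[y] = 0 ->
  exists2 m, (m < size p)%N & p^`(m).[y] = 0 /\ p^`(m.+1).[y] != 0.
Proof.
move=> p0 py.
have ex : exists m, p^`(m).[y] != 0.
  exists (size p).-1.
  have -> : p^`((size p).-1) = (lead_coef p *+ (size p).-1`!)%:P.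
    apply/polyP => i; rewrite coef_derivn coefC; case: i => [|i].
      by rewrite addn0 ffactnn.
    rewrite nth_default ?mul0rn // addnS.
    by rewrite -(prednK (n := size p)) ?lt0n ?size_poly_eq0 // ltnS leq_addr.
  by rewrite hornerC -mulr_natl mulf_neq0 ?lead_coef_eq0 // pnatr_eq0 -lt0n fact_gt0.
case: (ex_minnP ex) => -[|m] hm hmin; first by move: hm; rewrite derivn0 py eqxx.
exists m.
  rewrite ltnNge; apply/negP => hs; move: hm.
  by rewrite derivn_poly0 ?horner0 ?eqxx // (leq_trans hs).
split => //; apply/eqP; apply: contraT => /hmin.
by rewrite ltnn.
Qed.

(** The space is divided according to the polynomial and the multiplicity with
    which [xi] is a root of it; a root of multiplicity [m + 1] is a simple
    root of the derivative of order [m]. *)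
Lemma piecewise_arcf_of d : (forall j, (j <= d)%N -> decomposable R j) ->
  (forall j, (j <= d)%N -> thin_zeros R j) -> piecewise_arcf R d.
Proof.
move=> HD HT xi hxi dxi.
have [n [A [A1 A2 hroot]]] := saf_root hxi dxi.
pose B i m e := (A i e)^`(m).[xi e] = 0 /\ (A i e)^`(m.+1).[xi e] <> 0.
have [N hN] := choice (fun i => (A1 i).2).
have sder i m : saf (fun e => (A i e)^`(m).[xi e]).
  by apply: (saf_horner (A := fun e => (A i e)^`(m))) => //; exact: pX_deriv.
have cB i m : (i < n)%N -> cov (fun psi => arcf (fun e => xi (psi e))) d d.+1 (B i m).
  move=> iN.
  have sB : sa (B i m).
    by apply: sa_and; [apply: sa_eq|apply: sa_not; apply: sa_eq].
  have dB : dep d (B i m) by move=> e e' H; rewrite /B (A2 i e e') // (dxi e e').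
  have := cov_in (HD d (leqnn d) _ sB dB) (fun e x => x).
  elim => [|j psi jd hpsi [_ pr]|P Q _ hP _ hQ].
  - exact: cov_empty.
  - have [p1 p2 p3] := hpsi.
    have H : cov (fun phi => arcf (fun e => xi (psi (phi e)))) j j.+1 (fun _ => True).
      apply: (@piecewise_simple j (fun u => xi (psi u))).
      + by move=> l lj; apply: HD; exact: leq_trans lj jd.
      + by move=> l lj; apply: HT; exact: leq_trans lj jd.
      + exact: (saf_comp hxi p2).
      + by move=> e e' E; rewrite (p1 e e').
      exists (fun u => (A i (psi u))^`(m)); split.
      + by have [_ [M hM]] := pX_deriv m (A1 i); exists M.
      + move=> l; have [h _] := pX_deriv m (A1 i).
        exact: (arcf_comp (arcf_poly (h l)) p3).
      + by move=> u; have [h1 /eqP h2] := pr u; rewrite -derivnS.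
    have := @cov_image _ _ (fun psi => arcf (fun e => xi (psi e))) d j j.+1 _ psi H hpsi.
    move=> /(_ (fun l phi hphi x => x)) /(cov_mono jd).
    by apply: cov_ext => e; split => [[u _ eu]|[u eu]]; exists u.
  - exact: covU.
apply: cov_ext (@cov_bigU _ _ d d.+1 (fun i e => exists2 m, (m < N i)%N & B i m e) n _).
  move=> e; split => // _; have [i [iN A0 Ai]] := hroot e.
  have [m ms [h1 /eqP h2]] := root_multiplicity A0 Ai.
  exists i => //; exists m; last by split.
  exact: leq_trans ms (hN i e).
by move=> i iN; apply: cov_bigU => m _; exact: cB.
Qed.

Lemma param_graph j d psi f : param j psi -> saf f -> dep d f ->
  arcf (fun e => f (psi e)) -> param j (fun e => upd (psi e) d (f (psi e))).
Proof.
move=> [p1 p2 p3] sf df hf; split.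
- by move=> e e' H; rewrite (p1 e e').
- move=> i; rewrite /upd; case: (i == d) => //; exact: (saf_comp sf p2).
- by move=> i; rewrite /upd; case: (i == d).
Qed.

(** After a refinement of the cover of the base, [f] is arc-analytic along the
    maps and can be used as an additional coordinate. *)
Lemma cov_graph d k B f : (forall j, (j < k)%N -> piecewise_arcf R j) ->
  saf f -> dep d f -> cov (@anyp R) d k B ->
  cov (@anyp R) d.+1 k (fun e => B e /\ e d = f e).
Proof.
move=> HP sf df /(cov_refine (@stable_anyp R) HP sf df).
elim => [|j psi jk hpsi [_ pr]|P Q _ hP _ hQ].
- by apply: cov_ext (cov_empty _ _ _) => e; split => // -[].
- apply: cov_ext (cov_img d.+1 jk (param_graph hpsi sf df pr) I) => e.
  split => [[u eu]|[[u eu] ed]].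
    have eu' : agree d e (psi u).
      by move=> i id; rewrite (eu i (leqW id)) /upd ltn_eqF.
    split; first by exists u.
    by rewrite eu // upd_same (df e (psi u)).
  exists u => i; rewrite ltnS leq_eqVlt /upd => /orP[/eqP ->|id].
    by rewrite eqxx ed (df e (psi u)).
  by rewrite ltn_eqF //; exact: eu.
- by apply: cov_ext (covU hP hQ) => e; tauto.
Qed.

(** The base and one more real variable parametrize the band swept by [c + w *
    rho]; the number of variables and the dimension both grow by one. *)
Lemma cov_band d k B (c w : env -> R) (rho : R -> R) : (forall j, (j < k)%N -> piecewise_arcf R j) ->
  saf c -> dep d c -> saf w -> dep d w -> saf (fun e => rho (e 0%N)) ->
  (forall (q : R -> R) t, ana q t -> ana (fun x => rho (q x)) t) ->
  cov (@anyp R) d k B ->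
  cov (@anyp R) d.+1 k.+1 (fun e => B e /\ exists s, e d = c e + w e * rho s).
Proof.
move=> HP sc dc sw dw srho arho hB.
have := cov_refine (@stable_anyp R) HP sc dc hB.
move=> /(cov_refine (stable_and (@stable_anyp R) (@stable_arcf R c)) HP sw dw).
elim => [|j psi jk hpsi [[_ prc] prw]|P Q _ hP _ hQ].
- by apply: cov_ext (cov_empty _ _ _) => e; split => // -[].
- have [p1 p2 p3] := hpsi.
  pose ch e := upd (psi e) d (c (psi e) + w (psi e) * rho (e j)).
  have hch : param j.+1 ch.
    split.
    + move=> e e' H; rewrite /ch H // (p1 e e') // => i ij.
      by apply: H; exact: ltnW.
    + move=> i; rewrite /ch /upd; case: (i == d) => //.
      apply: safD; first exact: (saf_comp sc p2).
      apply: safM; first exact: (saf_comp sw p2).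
      exact: (@saf_comp1 _ rho (fun e => e j) srho (saf_var _ j)).
    + move=> i; rewrite /ch /upd; case: (i == d) => //.
      apply: arcfD => //; apply: arcfM => // ga t0 hga.
      exact: arho.
  apply: cov_ext (cov_img d.+1 (_ : (j.+1 < k.+1)%N) hch I) => // e.
  split => [[u eu]|[[u eu] [s es]]].
    have eu' : agree d e (psi u).
      by move=> i id; rewrite (eu i (leqW id)) /ch /upd ltn_eqF.
    split; first by exists u.
    by exists (u j); rewrite eu // /ch upd_same (dc e (psi u)) // (dw e (psi u)).
  exists (upd u j s) => i.
  have -> : ch (upd u j s) = upd (psi u) d (c (psi u) + w (psi u) * rho s).
    by rewrite /ch (dep_upd _ _ p1) upd_same.
  rewrite ltnS leq_eqVlt /upd => /orP[/eqP ->|id].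
    by rewrite eqxx es (dc e (psi u)) // (dw e (psi u)).
  by rewrite ltn_eqF //; exact: eu.
- by apply: cov_ext (covU hP hQ) => e; tauto.
Qed.

Lemma rho_inv_range (y : R) : 0 < y <= 1 -> exists s, y = (1 + s ^+ 2)^-1.
Proof.
move=> /andP[y0 y1]; exists (Num.sqrt (y^-1 - 1)); rewrite sqr_sqrtr.
  by rewrite addrC subrK invrK.
by rewrite subr_ge0 invf_ge1.
Qed.

Lemma rho_inv_bound (s : R) : 0 < (1 + s ^+ 2)^-1 <= 1.
Proof.
have h : 0 <= s ^+ 2 by exact: sqr_ge0.
by rewrite invr_gt0 ltr_pwDl //= invf_le1 ?ltr_pwDl // lerDl.
Qed.

Lemma saf_rho_inv : saf (fun e : env => (1 + e 0%N ^+ 2)^-1).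
Proof. by apply: safV; apply: safD => //; exact: safX. Qed.

Lemma ana_rho_inv (g : R -> R) t : ana g t -> ana (fun x => (1 + g x ^+ 2)^-1) t.
Proof.
move=> hg; apply: anaV; first by apply: anaD; [exact: ana_cst|exact: anaX].
by rewrite gt_eqF // ltr_pwDl // sqr_ge0.
Qed.

Lemma dep_fibres d A : dep d.+1 A -> forall (f : env -> R), dep d f ->
  dep d (fun e => A (upd e d (f e))).
Proof.
move=> dA f df e e' H; apply: dA => i; rewrite ltnS /upd (df e e') //.
by case: (ltngtP i d) => // id _; exact: H.
Qed.

Lemma dep_forall_fibre d A (p : R -> env -> Prop) : dep d.+1 A ->
  (forall z, dep d (p z)) -> dep d (fun e => forall z, p z e -> A (upd e d z)).
Proof.
move=> dA dp e e' H; apply/propext.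
have E z : A (upd e d z) = A (upd e' d z).
  by apply: dA => i; rewrite ltnS /upd; case: (ltngtP i d) => // id _; exact: H.
by split => h' z hz; [rewrite -E|rewrite E]; apply: h'; move: hz; rewrite (dp z e e').
Qed.

Lemma sa_forall_fibre d A (p : R -> env -> Prop) : sa A ->
  sa (fun e => p (e 0%N) (shift 1 e)) -> sa (fun e => forall z, p z e -> A (upd e d z)).
Proof.
move=> sA sp; apply: (@sa_forall _ (fun z e => p z e -> A (upd e d z))).
by apply: sa_imp => //; apply: (sa_subst sA) => i; exact: polyf_upd_shift.
Qed.

(** The set is a union of graphs over the base and of bands between them. A
    bounded band is cut at its middle; each half is swept by [c + w / (1 +
    s^2)], which attains its middle but not the graph from which it starts. A
    half-line is swept by two such pieces, the second being [c + 1 + s^2] up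
    to sign. *)
Lemma decomposable_step d : (forall j, (j <= d)%N -> decomposable R j) ->
  (forall j, (j <= d)%N -> thin_zeros R j) -> decomposable R d.+1.
Proof.
move=> HD HT A sA dA.
have HP j : (j < d.+1)%N -> piecewise_arcf R j.
  move=> jd; apply: piecewise_arcf_of => l lj; [apply: HD|apply: HT];
  exact: leq_trans lj jd.
have [m [al [a1 a2 a3]]] := line_cells sA dA.
have cst_saf (c : R) : saf (fun _ : env => c) by [].
have cst_dep (c : R) : dep d (fun _ : env => c) by [].
have sq_saf : saf (fun e : env => e 0%N ^+ 2) by exact: safX.
have sq_ana (g : R -> R) t : ana g t -> ana (fun x => g x ^+ 2) t by exact: anaX.
have id_ana (g : R -> R) t : ana g t -> ana (fun x => id (g x)) t by [].
have shal i : saf (fun e => al i (shift 1 e)) by exact: saf_shift.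
have depD (f g : env -> R) : dep d f -> dep d g -> dep d (fun e => f e + g e).
  by move=> hf hg e e' H; rewrite (hf e e') // (hg e e').
have depZ (c : R) (f : env -> R) : dep d f -> dep d (fun e => c * f e).
  by move=> hf e e' H; rewrite (hf e e').
have safZ (c : R) (f : env -> R) : saf f -> saf (fun e => c * f e) by exact: safM.
pose G i e := A (upd e d (al i e)) /\ e d = al i e.
have cG i : cov (@anyp R) d.+1 d.+1 (G i).
  apply: cov_graph => //; apply: (HD d (leqnn d)); first exact: sa_upd.
  exact: dep_fibres.
pose B2 i j e := al i e < al j e /\ forall z, al i e < z < al j e -> A (upd e d z).
have cB2 i j : cov (@anyp R) d d.+1 (B2 i j).
  apply: (HD d (leqnn d)).
    apply: sa_and; first exact: sa_lt.
    apply: (@sa_forall_fibre d A (fun z e => al i e < z < al j e)) => //.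
    apply: (@sa_ext _ (fun e => al i (shift 1 e) < e 0%N /\ e 0%N < al j (shift 1 e))).
      by move=> e; split => /andP.
    by apply: sa_and; exact: sa_lt.
  have D1 : dep d (fun e => forall z, al i e < z < al j e -> A (upd e d z)).
    by apply: (@dep_forall_fibre d A (fun z e => al i e < z < al j e)) => // z e e' H;
      rewrite (a2 i e e') // (a2 j e e').
  by move=> e e' H; rewrite /B2 (a2 i e e') // (a2 j e e') //; congr (_ /\ _);
    move: (D1 e e' H); rewrite (a2 i e e') // (a2 j e e').
pose W i j e := 2^-1 * (al j e + -1 * al i e).
have sW i j : saf (W i j) by apply: (safZ); apply: safD => //; exact: (safZ).
have dW i j : dep d (W i j) by apply: (depZ); apply: (depD) => //; exact: (depZ).
have dW' i j : dep d (fun e => -1 * W i j e) by exact: (depZ).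
have c2a i j := @cov_band d d.+1 _ (al i) (W i j) (fun s => (1 + s ^+ 2)^-1) HP (a1 i) (a2 i) (sW i j) (dW i j)
   saf_rho_inv ana_rho_inv (cB2 i j).
have c2b i j := @cov_band d d.+1 _ (al j) (fun e => -1 * W i j e) (fun s => (1 + s ^+ 2)^-1) HP (a1 j) (a2 j)
   (safZ _ _ (sW i j)) (dW' i j) saf_rho_inv ana_rho_inv (cB2 i j).
pose B3 i e := forall z, al i e < z -> A (upd e d z).
have cB3 i : cov (@anyp R) d d.+1 (B3 i).
  apply: (HD d (leqnn d)).
    by apply: (@sa_forall_fibre d A (fun z e => al i e < z)) => //; exact: sa_lt.
  by apply: (@dep_forall_fibre d A (fun z e => al i e < z)) => // z e e' H;
    rewrite (a2 i e e').
have c3a i := @cov_band d d.+1 _ (al i) (fun _ => 1) (fun s => (1 + s ^+ 2)^-1) HP (a1 i) (a2 i) (cst_saf 1) (cst_dep 1)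
   saf_rho_inv ana_rho_inv (cB3 i).
have c3b i := @cov_band d d.+1 _ (fun e => al i e + 1) (fun _ => 1) (fun s => s ^+ 2) HP
   (safD (a1 i) (cst_saf 1)) (depD _ _ (a2 i) (cst_dep 1)) (cst_saf 1) (cst_dep 1)
   sq_saf sq_ana (cB3 i).
pose B4 i e := forall z, z < al i e -> A (upd e d z).
have cB4 i : cov (@anyp R) d d.+1 (B4 i).
  apply: (HD d (leqnn d)).
    by apply: (@sa_forall_fibre d A (fun z e => z < al i e)) => //; exact: sa_lt.
  by apply: (@dep_forall_fibre d A (fun z e => z < al i e)) => // z e e' H;
    rewrite (a2 i e e').
have c4a i := @cov_band d d.+1 _ (al i) (fun _ => -1) (fun s => (1 + s ^+ 2)^-1) HP (a1 i) (a2 i) (cst_saf (-1)) (cst_dep (-1))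
   saf_rho_inv ana_rho_inv (cB4 i).
have c4b i := @cov_band d d.+1 _ (fun e => al i e + -1) (fun _ => -1) (fun s => s ^+ 2) HP
   (safD (a1 i) (cst_saf (-1))) (depD _ _ (a2 i) (cst_dep (-1))) (cst_saf (-1)) (cst_dep (-1))
   sq_saf sq_ana (cB4 i).
pose B5 e := forall z, True -> A (upd e d z).
have cB5 : cov (@anyp R) d d.+1 B5.
  apply: (HD d (leqnn d)).
    by apply: (@sa_forall_fibre d A (fun _ _ => True)) => //; exact: sa_cst.
  exact: (@dep_forall_fibre d A (fun _ _ => True)).
have c5 := @cov_band d d.+1 _ (fun _ => 0) (fun _ => 1) id HP (cst_saf 0) (cst_dep 0)
   (cst_saf 1) (cst_dep 1) (saf_var _ 0%N) id_ana cB5.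
have U1 := cov_bigU (m := m) (fun i _ => cov_mono (leqnSn _) (cG i)).
have U2 := cov_bigU (m := m) (fun i _ => cov_bigU (m := m) (fun j _ => covU (c2a i j) (c2b i j))).
have U3 := cov_bigU (m := m) (fun i _ => covU (c3a i) (c3b i)).
have U4 := cov_bigU (m := m) (fun i _ => covU (c4a i) (c4b i)).
apply: cov_ext (covU U1 (covU U2 (covU U3 (covU U4 c5)))) => e.
have Ae y : e d = y -> A (upd e d y) -> A e by move=> <-; rewrite upd_id.
split.
- case=> [[i im [h1 h2]]|]; first exact: Ae h2 h1.
  have rb s := rho_inv_bound s.
  case=> [[i im [j jm [|] [[ij hB] [s es]]]]|]; last first.
    case=> [[i im [|] [hB [s es]]]|].
    + by apply: Ae es _; apply: hB; have /andP[] := rb s; rewrite mul1r ltrDl.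
    + apply: Ae es _; apply: hB; rewrite mul1r -addrA ltrDl.
      by rewrite ltr_pwDl // sqr_ge0.
    case=> [[i im [|] [hB [s es]]]|].
    + by apply: Ae es _; apply: hB; have /andP[] := rb s; rewrite mulN1r gtrBl.
    + apply: Ae es _; apply: hB; rewrite mulN1r -addrA -opprD gtrBl.
      by rewrite ltr_pwDl // sqr_ge0.
    by move=> [hB _]; apply: (Ae (e d)) => //; exact: hB.
  + apply: Ae es _; apply: hB; rewrite /W; have /andP[] := rb s.
    set r := (_)^-1 => r0 r1; apply/andP; split; nra.
  + apply: Ae es _; apply: hB; rewrite /W; have /andP[] := rb s.
    set r := (_)^-1 => r0 r1; apply/andP; split; nra.
move=> hA; have := a3 e (e d); rewrite upd_id => /(_ hA).
case=> [[i im ei]|[]].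
- by left; exists i => //; split => //; rewrite -ei upd_id.
- move=> [i [j [im jm /andP[iy yj] H]]]; right; left; exists i => //; exists j => //.
  have ij := lt_trans iy yj.
  have w0 : 0 < W i j e by rewrite /W; lra.
  have hB : B2 i j e by split.
  have [hm|hm] := leP (e d) (al i e + W i j e); [left|right]; split => //.
    have [|s hs] := @rho_inv_range ((e d - al i e) / W i j e).
      by rewrite divr_gt0 ?subr_gt0 //= ler_pdivrMr // mul1r lerBlDl.
    by exists s; rewrite -hs mulrC divfK ?gt_eqF // addrC subrK.
  have [|s hs] := @rho_inv_range ((al j e - e d) / W i j e).
    rewrite divr_gt0 ?subr_gt0 //= ler_pdivrMr // mul1r.
    by move: hm; rewrite /W; lra.
  exists s; rewrite -hs -mulrA [W _ _ _ * _]mulrC divfK ?gt_eqF //; lra.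
- move=> [i [im iy H]]; right; right; left; exists i => //.
  have hB : B3 i e by [].
  have [hm|hm] := leP (e d) (al i e + 1); [left|right]; split => //.
    have [|s hs] := @rho_inv_range (e d - al i e); first by rewrite subr_gt0 iy /= lerBlDl.
    by exists s; rewrite mul1r -hs addrC subrK.
  exists (Num.sqrt (e d - (al i e + 1))); rewrite mul1r sqr_sqrtr ?subr_ge0 ?ltW //.
  by rewrite addrC subrK.
- move=> [i [im iy H]]; right; right; right; left; exists i => //.
  have hB : B4 i e by [].
  have [hm|hm] := leP (al i e + -1) (e d); [left|right]; split => //.
    have [|s hs] := @rho_inv_range (al i e - e d).
      by rewrite subr_gt0 iy /= lerBlDl -lerBlDr.
    by exists s; rewrite mulN1r -hs opprB addrC subrK.
  exists (Num.sqrt (al i e + -1 - e d)); rewrite mulN1r sqr_sqrtr ?subr_ge0 ?ltW //.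
  by rewrite opprB addrC subrK.
- move=> H; right; right; right; right; split; first by move=> z _; exact: H.
  by exists (e d); rewrite add0r mul1r.
Qed.

(** A function that does not vanish identically vanishes on whole lines in the
    last direction only over a thin part of the base, where its value at one
    height is zero. On the remaining lines its zeros contain no interval, by
    the identity theorem, hence lie on finitely many sections. *)
Lemma thin_zeros_step d : (forall j, (j <= d)%N -> decomposable R j) ->
  (forall j, (j <= d)%N -> thin_zeros R j) -> thin_zeros R d.+1.
Proof.
move=> HD HT h sh dh ah [e0 he0].
have HP j : (j < d.+1)%N -> piecewise_arcf R j.
  move=> jd; apply: piecewise_arcf_of => l lj; [apply: HD|apply: HT];
  exact: leq_trans lj jd.
have hline e t : ana (fun y => h (upd e d y)) t.
  apply: (ah (fun y => upd e d y)) => i; rewrite /upd; case: (i == d).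
    exact: ana_id.
  exact: ana_cst.
pose h0 e := h (upd e d (e0 d)).
have sh0 : saf h0 by apply: (saf_comp sh) => i; exact: saf_upd.
have dh0 : dep d h0.
  by move=> e e' H; apply: dh => i; rewrite ltnS /upd; case: (ltngtP i d) => // id _; exact: H.
have ah0 : arcf h0.
  apply: arcf_comp ah _ => i; rewrite /upd; case: (i == d); first exact: arcf_cst.
  exact: arcf_var.
pose B e := forall y, h (upd e d y) = 0.
have sZ : sa (fun e => h e = 0) by exact: sa_eq.
have dZ : dep d.+1 (fun e => h e = 0) by move=> e e' H; rewrite (dh e e').
have sB : sa B.
  apply: (@sa_forall _ (fun y e => h (upd e d y) = 0)).
  by apply: (sa_subst sZ) => i; exact: polyf_upd_shift.
have hupd e e' y : (forall i, (i < d)%N -> e i = e' i) -> h (upd e d y) = h (upd e' d y).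
  by move=> H; apply: dh => i; rewrite ltnS /upd; case: (ltngtP i d) => // id _; exact: H.
have dB : dep d B.
  move=> e e' H; apply/propext; split => hB y; [rewrite -(hupd e)|rewrite (hupd e e')] => //.
have cB : cov (@anyp R) d d B.
  apply: (@cov_sub _ _ _ _ (fun e => h0 e = 0)) => //.
  - by move=> j jd; apply: HD; exact: ltnW.
  - by apply: HT => //; exists e0; rewrite /h0 upd_id.
  - by move=> e hB; exact: hB.
have cB' := @cov_band d d _ (fun _ => 0) (fun _ => 1) id
   (fun j jd => HP j (ltnW jd)) (saf_cst 0) (fun _ _ _ => erefl)
   (saf_cst 1) (fun _ _ _ => erefl) (saf_var _ 0%N) (fun _ _ H => H) cB.
pose C e := h e = 0 /\ ~ B e.
have sC : sa C by apply: sa_and => //; exact: sa_not.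
have dC : dep d.+1 C.
  by move=> e e' H; rewrite /C (dh e e') // (dB e e') // => i id; apply: H; exact: ltnW.
have [m [al [a1 a2 a3]]] := line_cells sC dC.
have int_false e (y z : R) : y < z -> (forall x, y < x < z -> C (upd e d x)) -> False.
  move=> yz H.
  have mid : y < (y + z) / 2 < z by rewrite midf_lt //; apply/andP; split; lra.
  have [_] := H _ mid; apply.
  suff : B e by rewrite (dep_upd _ _ dB).
  apply: (@ana_identityT _ (fun x => h (upd e d x)) ((y + z) / 2)) => //.
  have := near_in_itvoo (_ : (y + z) / 2 \in `]y, z[); rewrite in_itv /= => /(_ mid).
  by apply: filterS => x; rewrite in_itv /= => /H [].
have onsec e : C e -> exists2 i, (i < m)%N & e d = al i e.
  move=> Ce; have := a3 e (e d); rewrite upd_id => /(_ Ce) [//|[]].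
  - by move=> [i [j [_ _ /andP[i1 i2] H]]]; case: (int_false e _ _ (lt_trans i1 i2) H).
  - move=> [i [_ i1 H]]; case: (int_false e (al i e) (al i e + 1)); first by rewrite ltrDl.
    by move=> x /andP[hx _]; exact: H.
  - move=> [i [_ i1 H]]; case: (int_false e (al i e - 1) (al i e)); first by rewrite gtrBl.
    by move=> x /andP[_ hx]; exact: H.
  - by move=> H; case: (int_false e 0 1 ltr01).
have cG i : cov (@anyp R) d.+1 d.+1 (fun e => C (upd e d (al i e)) /\ e d = al i e).
  apply: cov_graph => //; apply: (HD d (leqnn d)); first exact: sa_upd.
  exact: dep_fibres.
apply: cov_ext (covU cB' (cov_bigU (m := m) (fun i _ => cG i))) => e.
split => [[[hB _]|[i im [[h1 _] h2]]]|he].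
- by have := hB (e d); rewrite upd_id.
- by move: h1; rewrite -h2 upd_id.
- have [hB|nB] := pselect (B e).
    by left; split => //; exists (e d); rewrite add0r mul1r.
  have Ce : C e by [].
  by right; have [i im ei] := onsec e Ce; exists i => //; split => //; rewrite -ei upd_id.
Qed.

Theorem decomposition d : decomposable R d /\ thin_zeros R d.
Proof.
elim/ltn_ind: d => -[_|d IH].
  by split; [exact: decomposable0|exact: thin_zeros0].
split; [apply: decomposable_step|apply: thin_zeros_step] => j jd;
  by have [] := IH j jd.
Qed.

End Decomposition.

(** * Newton polygons and Puiseux's theorem *)

Section Puiseux.
Variable R : realType.
Implicit Types (P Q : R -> Prop) (xi eta y z : R -> R) (A B C : R -> {poly R}).

(** A property that holds eventually, as the variable decreases to zero. *)
Definition ev P := exists2 e, 0 < e & forall t : R, 0 < t < e -> P t.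

Lemma ev_and P Q : ev P -> ev Q -> ev (fun t => P t /\ Q t).
Proof.
move=> [a a0 ha] [b b0 hb]; exists (Num.min a b); first by rewrite lt_min a0.
move=> t /andP[t0]; rewrite lt_min => /andP[ta tb].
by split; [apply: ha|apply: hb]; rewrite t0.
Qed.

Lemma ev_imp P Q : (forall t, 0 < t -> P t -> Q t) -> ev P -> ev Q.
Proof.
move=> PQ [a a0 ha]; exists a => // t /andP[t0 ta]; apply: PQ => //.
by apply: ha; rewrite t0.
Qed.

Lemma ev_all P : (forall t, 0 < t -> P t) -> ev P.
Proof. by move=> h; exists 1 => // t /andP[t0 _]; exact: h. Qed.

Lemma ev_ex P : ev P -> exists2 t, 0 < t & P t.
Proof.
move=> [a a0 ha]; exists (a / 2); first by rewrite divr_gt0.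
by apply: ha; rewrite divr_gt0 //= ltr_pdivrMr // ltr_pMr // ltr1n.
Qed.

Lemma ev_near0 P : (\forall t \near (0 : R), P t) -> ev P.
Proof.
move=> [e /= e0 h]; exists e => // t /andP[t0 te]; apply: h.
by rewrite /ball /= sub0r normrN gtr0_norm.
Qed.

Lemma ev_nearP P : (\forall t \near (0 : R)^'+, P t) <-> ev P.
Proof.
split => [[e /= e0 h]|[e e0 h]].
  exists e => // t /andP[t0 te]; apply: h => //.
  by rewrite /ball /= sub0r normrN gtr0_norm.
exists e => //= t; rewrite /ball /= sub0r normrN => te t0; apply: h.
by rewrite t0 /=; apply: le_lt_trans te; exact: ler_norm.
Qed.

Lemma ev_pow q P : (0 < q)%N -> ev P -> ev (fun s => P (s ^+ q)).
Proof.
move=> q0 [e e0 h]; exists (Num.min 1 e); first by rewrite lt_min ltr01.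
move=> s /andP[s0]; rewrite lt_min => /andP[s1 se]; apply: h.
rewrite exprn_gt0 //=; apply: le_lt_trans se.
by rewrite -[leRHS]expr1 ler_wiXn2l // ltW.
Qed.

Lemma ev_fin n (P : nat -> R -> Prop) : (forall i, (i < n)%N -> ev (P i)) ->
  ev (fun t => forall i, (i < n)%N -> P i t).
Proof.
elim: n => [_|n IH H]; first exact: ev_all.
apply: ev_imp (ev_and (IH (fun i ni => H i (ltnW ni))) (H n (ltnSn n))) => t _ [h1 h2] i.
by rewrite ltnS leq_eqVlt => /orP[/eqP ->|/h1].
Qed.

Definition elim0 xi (l : R) := forall eps, 0 < eps -> ev (fun t => `|xi t - l| < eps).

Lemma elim0P xi (l : R) : elim0 xi l <-> (xi t @[t --> (0 : R)^'+] --> l).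
Proof.
split => [h|h].
  apply/cvgrPdist_lt => eps /h /ev_nearP; apply: filterS => t.
  by rewrite distrC.
move=> eps e0; apply/ev_nearP.
by have /cvgrPdist_lt/(_ eps e0) := h; apply: filterS => t; rewrite distrC.
Qed.

Lemma elim0_ana g : ana g 0 -> elim0 g (g 0).
Proof. by move=> /ana_cvg h; apply/elim0P; exact: (cvg_at_right_filter h). Qed.

Lemma elim0_pow q xi l : (0 < q)%N -> elim0 xi l -> elim0 (fun s => xi (s ^+ q)) l.
Proof. by move=> q0 h eps e0; exact: (ev_pow q0 (h eps e0)). Qed.

Lemma elim0_horner N A y (l : R) : (forall t, (size (A t) <= N)%N) ->
  (forall i, elim0 (fun t => (A t)`_i) (A 0)`_i) -> elim0 y l ->
  elim0 (fun t => (A t).[y t]) (A 0).[l].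
Proof.
move=> hN hA /elim0P hy; apply/elim0P.
by apply: (@cvg_horner_coef _ _ _ N A (A 0)) => // i; apply/elim0P; exact: hA.
Qed.

Lemma elim0_neq xi (l v : R) : elim0 xi l -> l != v ->
  exists2 c, 0 < c & ev (fun t => c <= `|xi t - v|).
Proof.
move=> h lv; exists (`|l - v| / 2); first by rewrite divr_gt0 // normr_gt0 subr_eq0.
have [|e e0 he] := h (`|l - v| / 2); first by rewrite divr_gt0 // normr_gt0 subr_eq0.
exists e => // t /he.
have := ler_distD (xi t) l v; rewrite [`|l - xi t|]distrC; lra.
Qed.

Lemma elim0_zero xi (l : R) : elim0 xi l -> ev (fun t => xi t = 0) -> l = 0.
Proof.
move=> h h0; apply/eqP; apply: contraT => l0.
have [c c0 hc] := elim0_neq h l0.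
have [t _ [h1 h2]] := ev_ex (ev_and h0 hc).
by move: h2; rewrite h1 subrr normr0 leNgt c0.
Qed.

Definition evcont xi := ev (fun t => xi x @[x --> t] --> xi t).

Lemma evcont_ana g : ana g 0 -> evcont g.
Proof. by move=> /ana_recenter/ev_near0; apply: ev_imp => t _; exact: ana_cvg. Qed.

Lemma evcontB xi eta : evcont xi -> evcont eta -> evcont (fun t => xi t - eta t).
Proof. by move=> h1 h2; apply: ev_imp (ev_and h1 h2) => t _ [a b]; apply: cvgB. Qed.

Lemma evcont_rescale xi q p : (0 < q)%N -> evcont xi ->
  evcont (fun s => xi (s ^+ q) / s ^+ p).
Proof.
move=> q0 /(ev_pow q0); apply: ev_imp => s s0 h; apply: cvgM; last first.
  by apply: cvgV; [rewrite expf_neq0 // gt_eqF|apply: cvg_exp; exact: cvg_id].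
apply: (cvg_comp (fun x : R => x ^+ q) xi _ h).
by apply: cvg_exp; exact: cvg_id.
Qed.

(** By the intermediate value theorem, a value that is avoided is eventually on
    one side. *)
Lemma evcont_side z (v : R) : evcont z -> ev (fun t => z t != v) ->
  ev (fun t => z t < v) \/ ev (fun t => v < z t).
Proof.
move=> h1 h2; have [e e0 he] := ev_and h1 h2.
have side a b : 0 < a < e -> 0 < b < e -> z a < v -> z b < v.
  move=> ha hb za; rewrite ltNge; apply/negP => zb.
  pose u := Num.min a b; pose w := Num.max a b.
  have uw : u <= w by rewrite ge_min le_max !lexx.
  have in_e x : u <= x <= w -> 0 < x < e.
    move: ha hb => /andP[a0 ae] /andP[b0 be]; rewrite ge_min le_max => /andP[h3 h4].
    apply/andP; split.
      by case/orP: h3; apply: lt_le_trans.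
    by case/orP: h4 => /le_lt_trans; apply.
  have cw : {within `[u, w], continuous z}.
    apply: continuous_in_subspaceT => x; rewrite inE /= in_itv /= => /in_e /he [].
    by [].
  have [|c] := IVT uw cw (v := v).
    rewrite ge_min le_max /u /w; have [ab|ab] := leP a b.
      by rewrite (ltW za) zb orbT.
    by rewrite (ltW za) zb orbT.
  rewrite in_itv /= => /in_e /he [_ /eqP]. by [].
have m0 : 0 < e / 2 < e by rewrite divr_gt0 //= ltr_pdivrMr // ltr_pMr // ltr1n.
have [_ zm] := he _ m0.
have [zv|zv|zv] := ltgtP (z (e / 2)) v; last by rewrite zv eqxx in zm.
  by left; exists e => // t ht; exact: side m0 ht zv.
right; exists e => // t ht; have [_ zt] := he _ ht.
rewrite lt_neqAle eq_sym zt /= leNgt; apply/negP => /(side _ _ ht m0).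
by rewrite ltNge (ltW zv).
Qed.

(** Bounded continuous roots of a family of polynomials have a limit, since all
    their limit points are among the finitely many roots of the limit polynomial. *)
Lemma root_limit N A z (M : R) : (forall t, (size (A t) <= N)%N) ->
  (forall i, elim0 (fun t => (A t)`_i) (A 0)`_i) -> A 0 != 0 ->
  evcont z -> ev (fun t => `|z t| <= M) -> ev (fun t => (A t).[z t] = 0) ->
  exists2 l, elim0 z l & (A 0).[l] = 0.
Proof.
move=> hN hA A0 cz zM Az.
have side v : (A 0).[v] != 0 -> ev (fun t => z t < v) \/ ev (fun t => v < z t).
  move=> Av; apply: evcont_side => //.
  have cv : elim0 (fun _ => v) v.
    by move=> eps eps0; apply: ev_all => t _; rewrite subrr normr0.
  have [c c0 hc] := elim0_neq (elim0_horner hN hA cv) Av.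
  apply: ev_imp (ev_and hc Az) => t _ [h1 h2]; apply/eqP => zv.
  by move: h1; rewrite -zv h2 subrr normr0 leNgt c0.
pose E := [set v | ev (fun t => v < z t)].
have E0 : E (- M - 1).
  by apply: ev_imp zM => t _; rewrite ler_norml => /andP[h _]; lra.
have EM : ubound E M.
  move=> v Ev; have [t _ [h1 h2]] := ev_ex (ev_and Ev zM).
  by move: h2; rewrite ler_norml => /andP[_ h2]; lra.
have supE : has_sup E by split; [exists (- M - 1)|exists M].
have lim : elim0 z (sup E).
  move=> eps e0.
  have [v Ev vE] := sup_adherent e0 supE.
  have [s _ hs] := poly_roots_seq A0.
  have [w [w1 w2 w3]] : exists w, [/\ sup E < w, w < sup E + eps & (A 0).[w] != 0].
    have [[x [xs x1 x2]]|hn] := pselect (exists x, [/\ x \in s, sup E < x & x < sup E + eps]).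
      have [|m [ms m1] hm] := @seq_min R (fun x => x \in s /\ sup E < x) s; first by exists x.
      have mx := hm x xs (conj xs x1).
      exists ((sup E + m) / 2); split; try lra.
      apply/eqP => /hs h; have h' : sup E < (sup E + m) / 2 by lra.
      have := hm _ h (conj h h'); lra.
    exists (sup E + eps / 2); split; try lra.
    by apply/eqP => /hs h; apply: hn; exists (sup E + eps / 2); split => //; lra.
  have [h|h] := side w w3; last first.
    by have := ub_le_sup (ex_intro _ M EM) h; rewrite leNgt w1.
  apply: ev_imp (ev_and Ev h) => t _ [h1 h2].
  by rewrite ltr_norml; apply/andP; split; lra.
exists (sup E) => //; exact: (elim0_zero (elim0_horner hN hA lim)).
Qed.

(** Taylor's formula; the normalized derivatives are the coefficients. *)
Lemma coef_comp_addC (p : {poly R}) c i : (p \Po ('X + c%:P))`_i = p^`N(i).[c].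
Proof.
rewrite comp_polyE coef_sum.
have h j : (('X + c%:P : {poly R}) ^+ j)`_i = c ^+ (j - i) *+ 'C(j, i).
  rewrite addrC exprDn coef_sum.
  case: (leqP i j) => ij; last first.
    rewrite bin_small // mulr0n big1 // => l _.
    rewrite coefMn -polyC_exp coefCM coefXn gtn_eqF ?mulr0 ?mul0rn //.
    by apply: leq_ltn_trans ij; rewrite -ltnS.
  rewrite (bigD1 (inord i)) //= inordK ?ltnS // coefMn -polyC_exp coefCM coefXn eqxx mulr1.
  rewrite big1 ?addr0 // => l li; rewrite coefMn -polyC_exp coefCM coefXn.
  have -> : (i == l :> nat) = false.
    by apply: contraNF li => /eqP E; apply/eqP/val_inj; rewrite /= E inordK.
  by rewrite mulr0 mul0rn.
under eq_bigr do rewrite coefZ h.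
rewrite (@horner_coef_wide _ (size p) (p^`N(i))); last first.
  by apply/leq_sizeP => j hj; rewrite coef_nderivn nth_default ?mul0rn // (leq_trans hj) // leq_addl.
case: (leqP (size p) i) => hi.
  rewrite !big1 // => j _; rewrite ?coef_nderivn.
    by rewrite nth_default ?mul0rn ?mul0r // (leq_trans hi) // leq_addr.
  by rewrite bin_small ?mulr0n ?mulr0 // (leq_trans (ltn_ord j)).
rewrite -[in LHS](subnKC (ltnW hi)) big_split_ord /= big1 ?add0r; last first.
  by move=> j _; rewrite bin_small ?mulr0n ?mulr0.
rewrite [RHS](bigID (fun j : 'I_(size p) => (j < size p - i)%N)) /=.
rewrite [X in _ + X]big1 ?addr0; last first.
  move=> j; rewrite -leqNgt => hj; rewrite coef_nderivn nth_default ?mul0rn ?mul0r //.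
  by rewrite -leq_subLR.
rewrite (big_ord_narrow (leq_subr i (size p))).
apply: eq_bigr => j _ /=.
by rewrite coef_nderivn addKn mulrnAl mulrnAr.
Qed.

Lemma pana_nderivn A n a : pana A a -> pana (fun t => (A t)^`N(n)) a.
Proof.
move=> [[N hN] hA]; split.
  exists N => t; apply/leq_sizeP => j hj.
  rewrite coef_nderivn nth_default ?mul0rn // (leq_trans (hN t)) //.
  by rewrite (leq_trans hj) // leq_addl.
move=> i; apply: (@ana_ext _ (fun t => 'C(n + i, n)%:R * (A t)`_(n + i))).
  by move=> t; rewrite coef_nderivn mulr_natl.
by apply: anaZ.
Qed.

Lemma pana_coef_elim0 A i : pana A 0 -> elim0 (fun t => (A t)`_i) (A 0)`_i.
Proof. by move=> [_ h]; exact: (elim0_ana (h i)). Qed.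

(** A smallest slope of the Newton polygon is the one for which the rescaled
    coefficients remain analytic. *)
Lemma min_slope m (J : nat -> Prop) (o : nat -> nat) : (exists2 j, (j < m)%N & J j) ->
  exists j0, [/\ (j0 < m)%N, J j0 &
    forall j, (j < m)%N -> J j -> (o j0 * (m - j) <= o j * (m - j0))%N].
Proof.
move=> [i im Ji].
pose sl j : R := (o j)%:R / (m - j)%:R.
have [|x [j0 [j0m Jj0 xj0]] hx] := @seq_min R (fun x => exists j, [/\ (j < m)%N, J j & x = sl j]) [seq sl j | j <- iota 0 m].
  by exists (sl i); [rewrite map_f // mem_iota /= add0n|exists i].
exists j0; split => // j jm Jj.
have /hx : sl j \in [seq sl j | j <- iota 0 m] by rewrite map_f // mem_iota /= add0n.
move=> /(_ (ex_intro _ j (And3 jm Jj erefl))); rewrite xj0 /sl.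
rewrite ler_pdivrMr ?ltr0n ?subn_gt0 // mulrAC ler_pdivlMr ?ltr0n ?subn_gt0 //.
by rewrite -!natrM ler_nat.
Qed.

Lemma coef_ev_zero_or_order A i : pana A 0 ->
  exists o (u : R -> R), ((\forall t \near (0:R), (A t)`_i = 0) \/
    [/\ ana u 0, u 0 != 0 & \forall t \near (0:R), (A t)`_i = t ^+ o * u t]).
Proof.
move=> [_ hA]; have [h | [ o [u [h1 h2 h3]]]] := ana_order (hA i).
  by exists 0%N, (fun _ => 0); left.
exists o, u; right; split => //.
by apply: filterS h3 => t; rewrite subr0.
Qed.

Definition puiseux_germ xi := exists (q : nat) (eta : R -> R),
  [/\ (0 < q)%N, ana eta 0 & ev (fun t => xi (t ^+ q) = eta t)].

(** One step of Newton's method. With the smallest slope [p / q], the rescaled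
    root [xi(s^q) / s^p] is bounded and satisfies an equation with analytic
    coefficients, so it has a limit [l]. At the origin this equation has a
    nonzero coefficient of degree less than [m] and none of degree [m - 1];
    hence [l] is not a root of multiplicity [m], and [m] decreases. *)
Lemma puiseux_step m A xi :
  (forall k, (k < m)%N -> forall A xi, pana A 0 ->
    (forall i, (i < k)%N -> (A 0)`_i = 0) -> (A 0)`_k != 0 ->
    evcont xi -> elim0 xi 0 -> ev (fun t => (A t).[xi t] = 0) -> puiseux_germ xi) ->
  pana A 0 -> (forall i, (i < m)%N -> (A 0)`_i = 0) -> (A 0)`_m != 0 ->
  (\forall t \near (0 : R), (A t)`_m.-1 = 0) ->
  evcont xi -> elim0 xi 0 -> ev (fun t => (A t).[xi t] = 0) -> (0 < m)%N ->
  puiseux_germ xi.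
Proof.
move=> IH hA A0 Am Am1 cxi xi0 Axi m0.
have [[N hN] hcA] := hA.
have [ o Ho] := choice (fun i => coef_ev_zero_or_order i hA).
have [u {}Ho] := choice Ho.
pose J j := ~ (\forall t \near (0 : R), (A t)`_j = 0).
have HJ j : J j -> [/\ ana (u j) 0, u j 0 != 0 & \forall t \near (0:R), (A t)`_j = t ^+ (o j) * u j t].
  by move=> Jj; case: (Ho j).
have HnJ j : ~ J j -> \forall t \near (0 : R), (A t)`_j = 0 by move=> /contrapT.
pose g t := (drop_poly m (A t)).[xi t].
have glim : elim0 g (A 0)`_m.
  have -> : (A 0)`_m = (drop_poly m (A 0)).[0] by rewrite horner_coef0 coef_drop_poly.
  apply: (@elim0_horner N (fun t => drop_poly m (A t))) => //.
    move=> t; apply: leq_trans (hN t); rewrite size_drop_poly; exact: leq_subr.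
  move=> i; rewrite coef_drop_poly; under eq_fun do rewrite coef_drop_poly.
  exact: pana_coef_elim0.
have Adec t : (A t).[xi t] = \sum_(j < m) (A t)`_j * xi t ^+ j + g t * xi t ^+ m.
  rewrite -{1}(poly_take_drop m (A t)) hornerD hornerM hornerXn; congr (_ + _).
  rewrite (@horner_coef_wide _ m) ?size_take_poly //; apply: eq_bigr => j _.
  by rewrite coef_take_poly ltn_ord.
have [gc gc0 hg] := elim0_neq glim Am.
have g0 : ev (fun t => g t != 0).
  by apply: ev_imp hg => t _; rewrite subr0 -normr_gt0; apply: lt_le_trans.
have [exJ|nJ] := pselect (exists2 j, (j < m)%N & J j); last first.
  exists 1%N, (fun _ => 0); split => //; first exact: ana_cst.
  have z : ev (fun t => forall j, (j < m)%N -> (A t)`_j = 0).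
    apply: ev_fin => j jm; apply: ev_near0; apply: HnJ => Jj.
    by apply: nJ; exists j.
  apply: ev_imp (ev_and z (ev_and Axi g0)) => t _ [z1 []].
  rewrite expr1 Adec big1 ?add0r; last by move=> j _; rewrite z1 ?mul0r.
  by move=> /eqP; rewrite mulf_eq0 => + gn; rewrite (negbTE gn) /= expf_eq0 => /andP[_ /eqP].
have [j0 [j0m Jj0 hj0]] := min_slope o exJ.
pose q := (m - j0)%N; pose p := o j0.
have q0 : (0 < q)%N by rewrite subn_gt0.
have [anau0 u00 hu0] := HJ _ Jj0.
have p0 : (0 < p)%N.
  rewrite lt0n; apply/eqP => p0; have := nbhs_singleton hu0.
  by rewrite -/p p0 expr0 mul1r A0 // => /esym /eqP; rewrite (negbTE u00).
have mN : (m < N)%N.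
  by rewrite ltnNge; apply/negP => h; move: Am; rewrite nth_default ?eqxx // (leq_trans (hN 0)).
pose b j s := if (j < m)%N then
    (if `[< J j >] then s ^+ (q * o j - p * (m - j)) * u j (s ^+ q) else 0)
  else s ^+ (p * (j - m)) * (A (s ^+ q))`_j.
pose C s := \poly_(j < N) b j s.
have hC : pana C 0.
  split; first by exists N => t; exact: size_poly.
  move=> j; apply: (@ana_ext _ (fun s => if (j < N)%N then b j s else 0)).
    by move=> t; rewrite coef_poly.
  case: (j < N)%N; last exact: ana_cst.
  rewrite /b; case: (j < m)%N.
    case: asboolP => Jj; last exact: ana_cst.
    have [h _ _] := HJ _ Jj; apply: anaM; first by apply: anaX; exact: ana_id.
    exact: ana_comp_exp.
  apply: anaM; first by apply: anaX; exact: ana_id.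
  exact: (@ana_comp_exp _ (fun t => (A t)`_j)).
pose z s := xi (s ^+ q) / s ^+ p.
have bA : ev (fun s => forall j, (j < N)%N -> s ^+ (p * m) * b j s = (A (s ^+ q))`_j * s ^+ (p * j)).
  apply: ev_fin => j jN; rewrite /b; case: ltnP => jm.
    case: asboolP => Jj.
      have [_ _ /ev_near0 /(ev_pow q0)] := HJ _ Jj; apply: ev_imp => s s0 ->.
      have hle := hj0 j jm Jj.
      rewrite mulrA -exprD -exprM mulrAC -exprD; congr (_ ^+ _ * _).
      have pm : (p * m = p * (m - j) + p * j)%N by rewrite -mulnDr subnK // ltnW.
      by rewrite pm mulnC in hle *; rewrite -/p -/q in hle; lia.
    have /ev_near0 /(ev_pow q0) := HnJ _ Jj; apply: ev_imp => s s0 ->.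
    by rewrite mulr0 mul0r.
  apply: ev_all => s s0; rewrite mulrA -exprD mulrC; congr (_ * _ ^+ _).
  by rewrite -mulnDr subnKC.
have zxi s : 0 < s -> xi (s ^+ q) = s ^+ p * z s.
  by move=> s0; rewrite /z mulrC divfK // expf_neq0 // gt_eqF.
have cz : evcont z by exact: evcont_rescale.
clearbody z.
have Cz : ev (fun s => (C s).[z s] = 0).
  apply: ev_imp (ev_and bA (ev_pow q0 Axi)) => s s0 [h1 h2].
  apply: (@mulfI _ (s ^+ (p * m))); first by rewrite expf_neq0 // gt_eqF.
  rewrite mulr0 -h2 (@horner_coef_wide _ N) ?size_poly // (@horner_coef_wide _ N (A _)) //.
  rewrite mulr_sumr; apply: eq_bigr => j _.
  by rewrite coef_poly ltn_ord mulrA h1 // zxi // exprMn -exprM mulrA.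
have C0m : (C 0)`_m = (A 0)`_m.
  by rewrite coef_poly mN /b ltnn subnn muln0 expr0 mul1r expr0n gtn_eqF.
have C0big j : (m < j)%N -> (C 0)`_j = 0.
  move=> mj; rewrite coef_poly; case: ifP => // jN.
  rewrite /b ltnNge (ltnW mj) /= expr0n.
  by rewrite muln_eq0 (gtn_eqF p0) subn_eq0 leqNgt mj /= mul0r.
have C0n : C 0 != 0 by apply/eqP => h; move: Am; rewrite -C0m h coef0 eqxx.
have C0j0 : (C 0)`_j0 != 0.
  rewrite coef_poly (ltn_trans j0m mN) /b j0m (asboolT Jj0) /q /p [(o j0 * _)%N]mulnC subnn.
  by rewrite expr0 mul1r expr0n gtn_eqF.
have C0m1 : (C 0)`_m.-1 = 0.
  rewrite coef_poly; case: ifP => // _; rewrite /b ltn_predL m0.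
  by case: asboolP => // Jm; case: Jm.
have hCl i : elim0 (fun t => (C t)`_i) (C 0)`_i by exact: pana_coef_elim0.
(* The terms of degree at least m add up to z ^ m times a factor away from zero,
   which bounds z. *)
have [M zM] : exists M, ev (fun s => `|z s| <= M).
  pose K := \sum_(j < m) (`|(C 0)`_j| + 1).
  have K0 : 0 <= K by apply: sumr_ge0 => j _; rewrite addr_ge0.
  exists (1 + K / gc).
  have hCb : ev (fun s => forall j, (j < m)%N -> `|(C s)`_j| <= `|(C 0)`_j| + 1).
    apply: ev_fin => j jm; apply: ev_imp (hCl j 1 ltr01) => s _ h.
    by have := ler_dist_dist (C s)`_j (C 0)`_j; rewrite ler_norml => /andP[_ h2]; lra.
  apply: ev_imp (ev_and (ev_and hCb bA) (ev_pow q0 (ev_and hg Axi))).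
  move=> s s0 [[h1 h2] [h3 h4]]; rewrite subr0 in h3.
  have sp : s ^+ (p * m) != 0 by rewrite expf_neq0 // gt_eqF.
  have rel : \sum_(j < m) (C s)`_j * z s ^+ j + g (s ^+ q) * z s ^+ m = 0.
    apply: (mulfI sp); rewrite mulr0; apply: etrans h4.
    rewrite Adec mulrDr; congr (_ + _).
      rewrite mulr_sumr; apply: eq_bigr => j _; have jN := ltn_trans (ltn_ord j) mN.
      by rewrite coef_poly jN mulrA h2 // zxi // exprMn -exprM mulrA.
    by rewrite zxi // exprMn -exprM mulrCA.
  have [z1|z1] := lerP `|z s| 1.
    by apply: le_trans z1 _; rewrite lerDl divr_ge0 // ltW.
  have zm0 : 0 < `|z s| ^+ m.-1 by rewrite exprn_gt0 // (lt_trans ltr01).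
  apply: (@le_trans _ _ (K / gc)); last by rewrite lerDr.
  rewrite ler_pdivlMr // mulrC -(ler_pM2r zm0) -mulrA -exprS prednK //.
  apply: (@le_trans _ _ (`|g (s ^+ q)| * `|z s| ^+ m)).
    by rewrite ler_wpM2r // exprn_ge0.
  have -> : `|g (s ^+ q)| * `|z s| ^+ m = `|\sum_(j < m) (C s)`_j * z s ^+ j|.
    rewrite -normrX -normrM -normrN; congr `|_|.
    by apply/eqP; rewrite eqr_oppLR -addr_eq0 addrC rel.
  apply: le_trans (ler_norm_sum _ _ _) _; rewrite mulr_suml; apply: ler_sum => j _.
  rewrite normrM normrX; apply: ler_pM => //; first exact: h1.
  by rewrite ler_weXn2l ?ltW // -ltnS prednK.
have [l zl Cl] := root_limit (fun t => size_poly _ _) hCl C0n cz zM Cz.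
pose C' s := C s \Po ('X + l%:P).
have hC' : pana C' 0 by apply: pana_comp => //; exact: pana_cst.
have C'i i : (C' 0)`_i = (C 0)^`N(i).[l] by exact: coef_comp_addC.
have ex : exists i, (C' 0)`_i != 0 /\ (i < m)%N.
  have [l0|l0] := eqVneq l 0.
    by exists j0; rewrite C'i l0 horner_coef0 coef_nderivn addn0 binn mulr1n.
  exists m.-1; rewrite ltn_predL m0; split => //.
  rewrite C'i (@horner_coef_wide _ 2); last first.
    apply/leq_sizeP => j j2; rewrite coef_nderivn C0big ?mul0rn //.
    by rewrite -(prednK m0); lia.
  rewrite !big_ord_recr big_ord0 /= !coef_nderivn addn0 binn addn1 prednK //.
  rewrite C0m1 mulr1n !mul0r !add0r expr1 mulf_neq0 // -mulr_natl mulf_neq0 ?C0m //.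
  by rewrite pnatr_eq0 -lt0n bin_gt0 leq_pred.
have ex' : exists i, (C' 0)`_i != 0 by have [i [h _]] := ex; exists i.
case: (ex_minnP ex') => k hk kmin.
have km : (k < m)%N.
  by have [i [h im]] := ex; apply: leq_ltn_trans im; exact: kmin.
have [|||||q' [eta [q'0 heta Heta]]] := IH k km C' (fun s => z s - l) hC'.
- by move=> i ik; apply/eqP; apply: contraT => /kmin; rewrite leqNgt ik.
- exact: hk.
- by apply: evcontB => //; apply: evcont_ana; exact: ana_cst.
- by move=> eps eps0; apply: ev_imp (zl eps eps0) => t _; rewrite subr0.
- apply: ev_imp Cz => s _; rewrite /C' horner_comp hornerD hornerX hornerC subrK.
  by [].
exists (q' * q)%N, (fun s => (s ^+ q') ^+ p * (eta s + l)); split.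
- by rewrite muln_gt0 q'0.
- apply: anaM; first by do 2!apply: anaX; exact: ana_id.
  by apply: anaD => //; exact: ana_cst.
apply: ev_imp Heta => s s0 <-; rewrite subrK exprM zxi //.
exact: exprn_gt0.
Qed.

End Puiseux.

(** * Puiseux expansions of semialgebraic functions *)

Section PuiseuxSemialgebraic.
Variable R : realType.
Notation env := (env R).

(** By induction on the number [m] of roots that tend to zero. The analytic
    root of the derivative of order [m - 1] is to first order the mean of
    these roots; translating by it makes the coefficient of degree [m - 1]
    vanish, as the Newton step requires. *)
Theorem puiseux m (A : R -> {poly R}) (xi : R -> R) : pana A 0 ->
  (forall i, (i < m)%N -> (A 0)`_i = 0) -> (A 0)`_m != 0 ->
  evcont xi -> elim0 xi 0 -> ev (fun t => (A t).[xi t] = 0) -> puiseux_germ xi.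
Proof.
elim/ltn_ind: m A xi => m IH A xi hA A0 Am cxi xi0 Axi.
have [[N hN] _] := hA.
have hAl i : elim0 (fun t => (A t)`_i) (A 0)`_i by exact: pana_coef_elim0.
case: m IH A0 Am => [|m] IH A0 Am.
  have := elim0_zero (elim0_horner hN hAl xi0) Axi.
  by rewrite horner_coef0 => /eqP; rewrite (negbTE Am).
have hD : pana (fun t => (A t)^`N(m)) 0 by exact: pana_nderivn.
have [||et [het et0 Det]] := @implicit_function _ _ 0 0 hD.
- by rewrite horner_coef0 coef_nderivn addn0 A0 // mul0rn.
- rewrite horner_coef0 coef_deriv mulr1n coef_nderivn addn1 -mulr_natl mulf_neq0 //.
  by rewrite pnatr_eq0 -lt0n bin_gt0.
pose B t := A t \Po ('X + (et t)%:P).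
have hB : pana B 0.
  by apply: pana_comp => //; apply: panaD; [exact: pana_cst|exact: panaC].
have B0 : B 0 = A 0 by rewrite /B et0 addr0 comp_polyXr.
have [|||||||q [eta [q0 heta Heta]]] :=
  @puiseux_step _ m.+1 B (fun t => xi t - et t) IH hB; rewrite ?B0 //.
- by apply: filterS Det => t h; rewrite /= /B coef_comp_addC.
- by apply: evcontB => //; exact: evcont_ana.
- move=> eps eps0; have e2 : 0 < eps / 2 by rewrite divr_gt0.
  have := elim0_ana het; rewrite et0 => /(_ _ e2) h.
  apply: ev_imp (ev_and h (xi0 _ e2)) => t _ []; rewrite !subr0 => h1 h2.
  by have := ler_normB (xi t) (et t); lra.
- apply: ev_imp Axi => t _.
  by rewrite /B horner_comp hornerD hornerX hornerC subrK.
exists q, (fun t => eta t + et (t ^+ q)); split => //.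
  by apply: anaD => //; exact: ana_comp_exp.
by apply: ev_imp Heta => t _ <-; rewrite subrK.
Qed.

Definition env1 (t : R) : env := upd (fun _ => 0) 0 t.

(** Along a half-line membership changes at finitely many points only. *)
Lemma sa_ev (P : env -> Prop) : sa P -> dep 1 P ->
  ev (fun t => P (env1 t)) \/ ev (fun t => ~ P (env1 t)).
Proof.
move=> sP dP; have [n [A [_ _ H]]] := sa_line sP dP.
pose e0 : env := fun _ => 0.
have [del del0 hdel] : exists2 del, 0 < del & forall i, (i < n)%N -> A i e0 != 0 ->
    forall x, 0 < x <= del -> (A i e0).[x] != 0.
  have := @common_radius R n (fun i del => A i e0 != 0 ->
    forall x, 0 < x <= del -> (A i e0).[x] != 0).
  apply => i iN; have [A0|A0] := eqVneq (A i e0) 0; first by exists 1 => // x _ /eqP.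
  have [s _ hs] := poly_roots_seq A0.
  have [[y ys y0]|hn] := pselect (exists2 y, y \in s & 0 < y); last first.
    exists 1 => // x _ _ y /andP[y0 _]; apply/eqP => /hs ys.
    by apply: hn; exists y.
  have [|m [ms m0] hm] := @seq_min R (fun x => x \in s /\ 0 < x) s; first by exists y.
  exists (m / 2); first by rewrite divr_gt0.
  move=> x /andP[_ xm] _ y' /andP[y'0 y'x]; apply/eqP => /hs y's.
  by have := hm _ y's (conj y's y'0); lra.
have E t : 0 < t <= del -> P (env1 t) = P (env1 del).
  move=> /andP[t0 td]; apply: (H e0 t del td) => i iN A0 x /andP[x1 x2].
  by apply: hdel => //; rewrite x2 andbT (lt_le_trans t0).
have [h|h] := pselect (P (env1 del)); [left|right]; exists del => // t /andP[t0 td];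
  by rewrite E // t0 ltW.
Qed.

Lemma ana_polyf1 (f : env -> R) t0 : polyf f -> ana (fun t => f (env1 t)) t0.
Proof.
move=> hf; apply: (arcf_poly hf) => i; rewrite /env1 /upd.
by case: (i == 0%N); [exact: ana_id|exact: ana_cst].
Qed.

(** The set of discontinuities has no interior, so it does not contain all
    small positive numbers; it is semialgebraic, so it contains no number that
    is small enough. *)
Lemma ev_continuous (xi : env -> R) : saf xi -> dep 1 xi -> evcont (fun t => xi (env1 t)).
Proof.
move=> hxi dxi.
have sd := sa_discont 1 hxi; have dd := dep_discont dxi.
have [[e e0 he]|] := sa_ev sd dd.
  have [|u hu nd] := @discont_no_interior R 1 xi (env1 (e / 2)) (e / 2) hxi dxi.
    by rewrite divr_gt0.
  exfalso; apply: nd; have := hu 0%N isT; rewrite /env1 upd_same => h.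
  rewrite (dd u (env1 (u 0%N))); last by case=> // _; rewrite /env1 upd_same.
  by apply: he; move: h; rewrite ltr_norml => /andP[h1 h2]; apply/andP; split; lra.
apply: ev_imp => t _ nd; apply/cvgrPdist_lt => eps eps0.
have [del del0 hdel] := not_discont dxi nd eps0.
have := near_dist t del0; apply: filterS => s hs; rewrite distrC.
by apply: hdel => -[|//] _; rewrite /env1 !upd_same.
Qed.

(** A semialgebraic function of one variable is near [0] a root of one fixed
    polynomial; dividing the latter by a power of the variable makes it nonzero
    at the origin. *)
Theorem saf_puiseux (xi : env -> R) (l : R) : saf xi -> dep 1 xi ->
  elim0 (fun t => xi (env1 t)) l ->
  exists (q : nat) (eta : R -> R),
   [/\ (0 < q)%N, ana eta 0, eta 0 = l & ev (fun t => xi (env1 (t ^+ q)) = eta t)].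
Proof.
move=> hxi dxi lim.
have [n [A [A1 A2 A3]]] := saf_root hxi dxi.
pose Q i (e : env) := A i e != 0 /\ (A i e).[xi e] = 0.
have sQ i : sa (Q i).
  by apply: sa_and; [exact: sa_neq0|apply: sa_eq => //; exact: saf_horner].
have dQ i : dep 1 (Q i) by move=> e e' H; rewrite /Q (A2 i e e') // (dxi e e').
have hroot e : exists2 i, (i < n)%N & Q i e.
  by have [i [iN A0 Ax]] := A3 e; exists i.
have [i iN Qi] : exists2 i, (i < n)%N & ev (fun t => Q i (env1 t)).
  apply: contrapT => hn.
  have h : ev (fun t => forall i, (i < n)%N -> ~ Q i (env1 t)).
    apply: ev_fin => i iN; have [h|//] := sa_ev (sQ i) (dQ i).
    by exfalso; apply: hn; exists i.
  have [t _ ht] := ev_ex h; have [i iN Qi] := hroot (env1 t).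
  exact: ht Qi.
pose A' t := A i (env1 t).
have [cA [N hN]] := A1 i.
have hA' : pana A' 0.
  by split; [exists N => t; exact: hN|move=> j; exact: (ana_polyf1 0 (cA j))].
have [ o Ho] := choice (fun j => coef_ev_zero_or_order j hA').
have [u {}Ho] := choice Ho.
pose J j := ~ (\forall t \near (0 : R), (A' t)`_j = 0).
have [j1 [j1N Jj1 j1min]] : exists j1, [/\ (j1 < N)%N, J j1 & forall j, (j < N)%N -> J j -> (o j1 <= o j)%N].
  have [exJ|nJ] := pselect (exists2 j, (j < N)%N & J j); last first.
    have h : ev (fun t => forall j, (j < N)%N -> (A' t)`_j = 0).
      apply: ev_fin => j jN; apply: ev_near0; apply: contrapT => Jj.
      by apply: nJ; exists j.
    have [t _ [h1 [h2 _]]] := ev_ex (ev_and h Qi).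
    exfalso; move/eqP: h2; apply; apply/polyP => j; rewrite coef0.
    case: (ltnP j N) => jN; first exact: h1.
    by rewrite nth_default // (leq_trans (hN _)).
  have [j jN Jj] := exJ.
  have [|x [j1 [j1N Jj1 xj1]] hx] :=
    @seq_min R (fun x => exists j, [/\ (j < N)%N, J j & x = (o j)%:R]) [seq (o j)%:R | j <- iota 0 N].
    by exists (o j)%:R; [apply: (map_f (fun j => (o j)%:R)); rewrite mem_iota /= add0n|exists j].
  exists j1; split => // j' jN' Jj'.
  have /hx : ((o j')%:R : R) \in [seq (o j)%:R | j <- iota 0 N].
    by apply: (map_f (fun j => (o j)%:R)); rewrite mem_iota /= add0n.
  by move=> /(_ (ex_intro _ j' (And3 jN' Jj' erefl))); rewrite xj1 ler_nat.
have HJ j : J j -> [/\ ana (u j) 0, u j 0 != 0 & \forall t \near (0:R), (A' t)`_j = t ^+ (o j) * u j t].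
  by move=> Jj; case: (Ho j).
pose b j t := if `[< J j >] then t ^+ (o j - o j1) * u j t else 0.
pose B t := \poly_(j < N) b j t.
have hB : pana B 0.
  split; first by exists N => t; exact: size_poly.
  move=> j; apply: (@ana_ext _ (fun s => if (j < N)%N then b j s else 0)).
    by move=> t; rewrite coef_poly.
  case: (j < N)%N; last exact: ana_cst.
  rewrite /b; case: asboolP => Jj; last exact: ana_cst.
  have [h _ _] := HJ _ Jj; apply: anaM => //; apply: anaX; exact: ana_id.
have Bx : ev (fun t => (B t).[xi (env1 t)] = 0).
  have h : ev (fun t => forall j, (j < N)%N -> t ^+ (o j1) * b j t = (A' t)`_j).
    apply: ev_fin => j jN; rewrite /b; case: asboolP => Jj.
      have [_ _ /ev_near0] := HJ _ Jj; apply: ev_imp => t t0 ->.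
      by rewrite mulrA -exprD subnKC // j1min.
    move: Jj => /contrapT /ev_near0; apply: ev_imp => t t0 ->.
    by rewrite mulr0.
  apply: ev_imp (ev_and h Qi) => t t0 [h1 [_ h2]].
  apply: (@mulfI _ (t ^+ o j1)); first by rewrite expf_neq0 // gt_eqF.
  rewrite mulr0; apply: etrans h2.
  rewrite (@horner_coef_wide _ N) ?size_poly // (@horner_coef_wide _ N (A i _)) ?hN //.
  rewrite mulr_sumr; apply: eq_bigr => j _.
  by rewrite coef_poly ltn_ord mulrA h1.
have B0 : B 0 != 0.
  have [_ h _] := HJ _ Jj1; apply/eqP => /polyP/(_ j1) /eqP.
  by rewrite coef0 coef_poly j1N /b (asboolT Jj1) subnn expr0 mul1r (negbTE h).
pose C t := B t \Po ('X + l%:P).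
have hC : pana C 0 by apply: pana_comp => //; exact: pana_cst.
have ex : exists m, (C 0)`_m != 0.
  apply: contrapT => hn; move/eqP: B0; apply.
  have : C 0 = 0.
    by apply/polyP => m; rewrite coef0; apply: contrapT => /eqP h; apply: hn; exists m.
  move=> /(congr1 (fun p => p \Po ('X - l%:P))).
  by rewrite /C -comp_polyA comp_polyD comp_polyX comp_polyC subrK comp_polyXr comp_poly0.
case: (ex_minnP ex) => m Cm mmin.
have [||||q [eta [q0 heta Heta]]] := @puiseux m C (fun t => xi (env1 t) - l) hC _ Cm.
- by move=> k km; apply/eqP; apply: contraT => /mmin; rewrite leqNgt km.
- apply: evcontB; first exact: ev_continuous.
  by apply: evcont_ana; exact: ana_cst.
- by move=> eps eps0; apply: ev_imp (lim eps eps0) => t _; rewrite subr0.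
- apply: ev_imp Bx => t _.
  by rewrite /C horner_comp hornerD hornerX hornerC subrK.
exists q, (fun t => eta t + l); split => //.
- by apply: anaD => //; exact: ana_cst.
- have h1 : elim0 (fun t => xi (env1 (t ^+ q)) - (eta t + l)) (l - (eta 0 + l)).
    apply/elim0P; apply: cvgB; first exact/elim0P/(elim0_pow q0 lim).
    by apply: cvgD; [exact/elim0P/elim0_ana|exact: cvg_cst].
  have hz : ev (fun t => xi (env1 (t ^+ q)) - (eta t + l) = 0).
    by apply: ev_imp Heta => t _ <-; rewrite subrK subrr.
  by apply/esym/eqP; rewrite -subr_eq0; apply/eqP; exact: elim0_zero h1 hz.
- by apply: ev_imp Heta => t _ <-; rewrite subrK.
Qed.

End PuiseuxSemialgebraic.

(** * Curve selection and a uniform exponent *)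

Section CurvesAndInequality.
Variable R : realType.
Notation env := (env R).
Implicit Types (e : env) (A P Q : env -> Prop) (f g h : env -> R).

Lemma dep_exists_upd d P : dep d.+1 P -> dep d (fun e => exists y, P (upd e d y)).
Proof.
move=> dP e e' H; apply/propext.
have E y : P (upd e d y) = P (upd e' d y).
  by apply: dP => i; rewrite ltnS /upd; case: (ltngtP i d) => // id _; exact: H.
by split => -[y hy]; exists y; move: hy; rewrite E.
Qed.

(** Definable choice for [n] variables, one after the other. *)
Lemma sa_choice_block b n P : sa P -> dep (b + n) P ->
  exists c : nat -> env -> R, [/\ forall i, saf (c i), forall i, dep b (c i) &
    forall e, (exists2 u, agree b u e & P u) ->
      P (fun i => if (i < b)%N then e i else c i e)].
Proof.
elim: n P => [|n IH] P sP; rewrite ?addn0 ?addnS => dP.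
  exists (fun _ _ => 0); split => // e [u ue Pu].
  by rewrite (dP _ u) // => i ib; rewrite ib ue.
have [c [c1 c2 c3]] := IH _ (sa_proj (b + n) sP) (dep_exists_upd dP).
have [g [g1 g2 g3]] := sa_choice sP dP.
pose mrg e : env := fun i => if (i < b)%N then e i else c i e.
exists (fun i e => if i == (b + n)%N then g (mrg e) else c i e); split.
- move=> i; case: (i == (b + n)%N) => //.
  by apply: (saf_comp g1) => j; rewrite /mrg; case: (j < b)%N.
- move=> i; case: (i == (b + n)%N) => // e e' H; congr g; apply/funext => j.
  by rewrite /mrg (c2 j e e') //; case: ifP => // /H.
move=> e [u ue Pu].
have [|y Py] := c3 e.
  by exists u => //; exists (u (b + n)%N); rewrite upd_id.
have := g3 _ _ Py; congr P; apply/funext => i; rewrite /upd.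
by case: eqP => // ->; rewrite ltnNge leq_addr.
Qed.

(** Definable choice gives a semialgebraic curve through points of [A] close to
    [x0]; by Puiseux's theorem its coordinates become analytic after the
    substitution of a power for the parameter, and an even power makes the curve
    stay in [A] on both sides. *)
Theorem curve_selection n A (x0 : env) : sa A -> dep n A ->
  (forall eps, 0 < eps -> exists2 u, A u & box n x0 eps u) ->
  exists ga : R -> env, [/\ forall i, ana (fun t => ga t i) 0,
    agree n (ga 0) x0 & exists2 d, 0 < d & forall t, 0 < `|t| < d -> A (ga t)].
Proof.
move=> sA dA H.
pose P e := A (shift 1 e) /\ forall i, (i < n)%N -> `|shift 1 e i - x0 i| < e 0%N.
have sP : sa P.
  apply: sa_and; first exact: sa_shift.
  by apply: (@sa_box_rel R n (fun i e => shift 1 e i) (fun i _ => x0 i) (fun e => e 0%N)) => // i;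
    exact: (saf_var _ (i + 1)%N).
have dP : dep (1 + n) P.
  move=> e e' E; rewrite /P; congr (_ /\ _).
    by apply: dA => i id; rewrite /shift E // addn1 ltnS.
  apply/propext; split => h i iN; have := h i iN;
  by rewrite (E 0%N) // /shift E // addn1 ltnS.
have [c [c1 c2 c3]] := sa_choice_block sP dP.
pose x i t := c i.+1 (env1 t).
pose pt t : env := fun i => x i t.
have hx t : 0 < t -> A (pt t) /\ forall i, (i < n)%N -> `|x i t - x0 i| < t.
  move=> t0; have [u Au hu] := H t t0.
  have := c3 (env1 t); case.
    exists (fun i => if i is j.+1 then u j else t); first by case.
    have E : shift 1 (fun i => if i is j.+1 then u j else t) = u.
      by apply/funext => i; rewrite /shift addn1.
    by rewrite /P E.
  have E : shift 1 (fun i => if (i < 1)%N then env1 t i else c i (env1 t)) = pt t.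
    by apply/funext => i; rewrite /shift addn1.
  by rewrite E /= /env1 upd_same.
have hq i : exists (q : nat) (eta : R -> R), (i < n)%N ->
   [/\ (0 < q)%N, ana eta 0, eta 0 = x0 i & ev (fun t => x i (t ^+ q) = eta t)].
  case: (ltnP i n) => iN; last by exists 0%N, (fun _ => 0).
  have [|q [eta h]] := @saf_puiseux R (c i.+1) (x0 i) (c1 i.+1) (c2 i.+1).
    move=> eps e0; exists eps => // t /andP[t0 te].
    by have [_ h] := hx t t0; apply: lt_trans te; exact: h.
  by exists q, eta.
have [q {}hq] := choice hq; have [eta {}hq] := choice hq.
(* A common multiple of the exponents of all the coordinates. *)
pose Q := (\prod_(i < n) q i)%N.
have Q0 : (0 < Q)%N by apply: prodn_gt0 => i; have [] := hq i (ltn_ord i).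
pose k i := (Q %/ q i)%N.
have kq i : (i < n)%N -> (k i * q i = Q)%N.
  by move=> iN; rewrite divnK // /Q (bigD1 (Ordinal iN)) //= dvdn_mulr.
have k0 i : (i < n)%N -> (0 < k i)%N.
  by move=> iN; have := kq i iN; case: (k i) => // E; move: Q0; rewrite -E mul0n.
have hev : ev (fun r => forall i, (i < n)%N -> x i (r ^+ Q) = eta i (r ^+ k i)).
  apply: ev_fin => i iN; have [_ _ _ /(ev_pow (k0 i iN))] := hq i iN.
  by apply: ev_imp => r _ <-; rewrite -exprM kq.
have [d d0 hd] := hev.
pose ga t : env := fun i => if (i < n)%N then eta i (t ^+ (2 * k i)) else 0.
exists ga; split.
- move=> i; rewrite /ga; case: ltnP => iN; last exact: ana_cst.
  have [_ h _ _] := hq i iN; apply: ana_comp_exp => //.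
  by rewrite muln_gt0 k0.
- move=> i iN; rewrite /ga iN expr0n muln_eq0 /= gtn_eqF ?k0 //.
  by have [_ _ -> _] := hq i iN.
exists (Num.min 1 d); first by rewrite lt_min ltr01.
move=> t /andP[t0]; rewrite lt_min => /andP[t1 td].
have s0 : 0 < t ^+ 2 by rewrite exprn_even_gt0 //= -normr_gt0.
have sd : t ^+ 2 < d.
  apply: le_lt_trans td.
  have -> : t ^+ 2 = `|t| ^+ 2 by rewrite -normrX ger0_norm // sqr_ge0.
  by rewrite expr2 ler_piMl // ltW.
have [h _] := hx _ (exprn_gt0 Q s0).
rewrite (dA _ (pt (t ^+ 2 ^+ Q))) // => i iN.
by rewrite /ga /pt iN hd ?s0 // exprM.
Qed.

(** A nonzero polynomial is equivalent at the origin to its lowest monomial,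
    whose degree is less than [N]. *)
Lemma poly_lower_bound N (p : {poly R}) : p != 0 -> (size p <= N)%N ->
  exists2 c, 0 < c & ev (fun u => c * u ^+ N <= `|p.[u]|).
Proof.
move=> p0 pN.
have ex : exists i, p`_i != 0.
  by exists (size p).-1; rewrite -lead_coefE lead_coef_eq0.
case: (ex_minnP ex) => o po omin.
have oN : (o <= N)%N.
  rewrite leqNgt; apply/negP => h; move: po.
  by rewrite nth_default ?eqxx // (leq_trans pN) // ltnW.
have tk : take_poly o p = 0.
  apply/polyP => i; rewrite coef_take_poly coef0; case: ltnP => // io.
  by apply/eqP; apply: contraT => /omin; rewrite leqNgt io.
have pE u : p.[u] = (drop_poly o p).[u] * u ^+ o.
  by rewrite -{1}(poly_take_drop o p) tk add0r hornerM hornerXn.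
have lim : elim0 (fun u => (drop_poly o p).[u]) p`_o.
  have -> : p`_o = (drop_poly o p).[0] by rewrite horner_coef0 coef_drop_poly.
  apply/elim0P; apply: cvg_at_right_filter; exact: (@continuous_horner R (drop_poly o p) 0).
have [c c0 hc] := elim0_neq lim po.
exists c => //; have e1 : ev (fun u : R => u < 1) by exists 1 => // t /andP[].
apply: ev_imp (ev_and hc e1) => u u0 []; rewrite subr0 => h u1.
rewrite pE normrM (ger0_norm (exprn_ge0 _ (ltW u0))).
apply: ler_pM; [exact: ltW|by apply: exprn_ge0; exact: ltW|exact: h|].
by rewrite ler_wiXn2l // ltW.
Qed.

(** The lowest nonzero term dominates the others at small arguments. *)
Lemma poly_no_small_root (q : {poly R}) (a K : R) j0 v : 0 < a -> 0 <= K ->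
  (forall i, (i < j0)%N -> q`_i = 0) -> a <= `|q`_j0| ->
  (forall i, `|q`_i| <= K) -> 0 < v -> v <= 1 -> v * (K * (size q)%:R + 1) <= a -> q.[v] != 0.
Proof.
move=> a0 K0 q0 qa qK v0 v1 va.
have tk : take_poly j0 q = 0.
  by apply/polyP => i; rewrite coef_take_poly coef0; case: ltnP => // /q0.
have -> : q.[v] = (q`_j0 + (drop_poly j0.+1 q).[v] * v) * v ^+ j0.
  have qE : q = (q`_j0)%:P * 'X^j0 + drop_poly j0.+1 q * 'X * 'X^j0.
    apply/polyP => i; rewrite coefD coefCM coefXn coefMXn coefMX.
    case: (ltngtP i j0) => [ij|ij|->].
    - by rewrite mulr0 addr0 q0.
    - rewrite mulr0 add0r coef_drop_poly subn_eq0 leqNgt ij /=.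
      by congr (q`_ _); lia.
    - by rewrite mulr1 subnn eqxx addr0.
  by rewrite {1}qE hornerD !hornerM hornerC hornerX hornerXn mulrDl.
apply: mulf_neq0; last by rewrite expf_neq0 // gt_eqF.
have : `|(drop_poly j0.+1 q).[v] * v| < `|q`_j0|.
  apply: lt_le_trans qa; rewrite normrM (gtr0_norm v0).
  apply: (@le_lt_trans _ _ (K * (size q)%:R * v)).
    rewrite ler_wpM2r ?(ltW v0) //.
    rewrite (@horner_coef_wide _ (size q)); last first.
      by rewrite size_drop_poly leq_subr.
    apply: le_trans (ler_norm_sum _ _ _) _.
    rewrite mulr_natr -[X in _ *+ X](card_ord (size q)) -sumr_const.
    apply: ler_sum => i _; rewrite coef_drop_poly normrM -[leRHS]mulr1.
    apply: ler_pM => //; rewrite normrX (gtr0_norm v0).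
    by apply: exprn_ile1 => //; exact: ltW.
  by move: va; rewrite mulrDr mulr1 mulrC; lra.
by apply: contraTneq => /eqP; rewrite addr_eq0 => /eqP ->; rewrite normrN ltxx.
Qed.

(** Near [u = 0] the places where membership in [M] can change along the last
    variable [v] are roots of polynomials in [v] whose coefficients are polynomials
    in [u] of bounded degree, so positive roots are at least a fixed power of [u];
    the exponent does not depend on the parameters. *)
Theorem uniform_gap k (M : env -> Prop) : sa M -> dep k.+2 M -> exists N : nat,
  forall e, (forall u, 0 < u -> exists2 v0, 0 < v0 & forall v, 0 < v < v0 ->
       ~ M (upd (upd e k u) k.+1 v)) ->
  exists2 c, 0 < c & ev (fun u => forall v, 0 < v < c * u ^+ N ->
       ~ M (upd (upd e k u) k.+1 v)).
Proof.
move=> sM dM; have [n [A [A1 A2 A3]]] := sa_line sM dM.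
have [B hB] := choice (fun i => (A1 i).2).
have hco (ij : nat * nat) : exists a : env -> {poly R},
   [/\ pX a, forall e y, a (upd e k y) = a e &
       forall e y, (A ij.1 (upd e k y))`_ij.2 = (a e).[y]].
  by have [h _] := A1 ij.1; exact: (polyf_uni k (h ij.2)).
have {hco} [a ha] := choice hco.
have [Sz hSz] := choice (fun ij => let: And3 (conj _ h) _ _ := ha ij in h).
pose N := (\max_(i < n) \max_(j < B i) Sz (i : nat, j : nat))%N.
have hN i j e : (i < n)%N -> (j < B i)%N -> (size (a (i, j) e) <= N)%N.
  move=> iN jB; apply: leq_trans (hSz (i, j) e) _.
  apply: leq_trans (@leq_bigmax _ (fun i : 'I_n => \max_(j < B i) Sz (i : nat, j : nat))%N (Ordinal iN)).
  exact: (@leq_bigmax _ (fun j : 'I_(B i) => Sz (i, j : nat)) (Ordinal jB)).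
exists N => e He.
have claim i : (i < n)%N -> exists2 c, 0 < c & forall c', 0 < c' <= c ->
   ev (fun u => A i (upd e k u) != 0 ->
    forall v, 0 < v < c' * u ^+ N -> (A i (upd e k u)).[v] != 0).
  move=> iN.
  have [exj|nj] := pselect (exists j, (j < B i)%N && (a (i, j) e != 0)); last first.
    exists 1 => // c' _; apply: ev_all => u u0 /eqP A0; exfalso; apply: A0.
    apply/polyP => j; rewrite coef0; have [_ _ h] := ha (i, j).
    case: (ltnP j (B i)) => jB; last by rewrite nth_default // (leq_trans (hB i _)).
    rewrite (h e u); apply: contrapT => hne; apply: nj; exists j; rewrite jB /=.
    by apply/eqP => h0; apply: hne; rewrite h0 horner0.
  case: (ex_minnP exj) => j0 /andP[j0B aj0] jmin.
  have [c1 c10 hc1] := poly_lower_bound aj0 (hN _ _ e iN j0B).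
  pose K := \sum_(j < B i) pnorm 1 (a (i, j : nat) e).
  have K0 : 0 <= K by apply: sumr_ge0 => j _; exact: pnorm_ge0.
  have D0 : 0 < K * (B i)%:R + 1 by rewrite ltr_wpDl // mulr_ge0.
  exists (Num.min 1 (c1 / (K * (B i)%:R + 1))).
    by rewrite lt_min ltr01 divr_gt0.
  move=> c' /andP[c'0]; rewrite le_min => /andP[c'1 c'2].
  have e1 : ev (fun u : R => u < 1) by exists 1 => // t /andP[].
  apply: ev_imp (ev_and hc1 e1) => u u0 [h1 u1] A0 v /andP[v0 vc].
  have uN : u ^+ N <= 1 by rewrite exprn_ile1 // ltW.
  have uN0 : 0 < u ^+ N by exact: exprn_gt0.
  have coe j : (A i (upd e k u))`_j = (a (i, j) e).[u] by have [_ _ ->] := ha (i, j).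
  apply: (@poly_no_small_root _ (c1 * u ^+ N) K j0) => //.
  - exact: mulr_gt0.
  - move=> j jj; rewrite coe.
    have -> : a (i, j) e = 0; last by rewrite horner0.
    apply/eqP; apply: contraT => h.
    by have := jmin j; rewrite h (ltn_trans jj j0B) leqNgt jj => /(_ isT).
  - by rewrite coe.
  - move=> j; case: (ltnP j (B i)) => jB; last first.
      by rewrite nth_default ?normr0 // (leq_trans (hB i _)).
    rewrite coe; apply: (@le_trans _ _ (pnorm 1 (a (i, j) e))).
      by apply: normr_horner_le; rewrite ger0_norm ltW.
    rewrite /K (bigD1 (Ordinal jB)) //= lerDl.
    by apply: sumr_ge0 => l _; exact: pnorm_ge0.
  - by apply: ltW; apply: lt_le_trans vc _; apply: mulr_ile1 => //; exact: ltW.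
  - apply: (@le_trans _ _ (v * (K * (B i)%:R + 1))).
      rewrite ler_wpM2l ?(ltW v0) // lerD2r ler_wpM2l // ler_nat; exact: hB.
    apply: (@le_trans _ _ (c' * u ^+ N * (K * (B i)%:R + 1))).
      by rewrite ler_wpM2r // ltW.
    rewrite mulrAC ler_wpM2r ?(ltW uN0) //.
    by rewrite -ler_pdivlMr.
have [c c0 hc] := @common_radius R n (fun i c => ev (fun u => A i (upd e k u) != 0 ->
    forall v, 0 < v < c * u ^+ N -> (A i (upd e k u)).[v] != 0)) claim.
exists c => //.
apply: ev_imp (ev_fin hc) => u u0 h v /andP[v0 vc].
have [w w0 hw] := He u u0.
pose z := Num.min v (w / 2).
have z0 : 0 < z by rewrite lt_min v0 divr_gt0.
have zw : z < w.
  by apply: (@le_lt_trans _ _ (w / 2)); [rewrite ge_min lexx orbT|lra].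
have zv : z <= v by rewrite ge_min lexx.
have <- : M (upd (upd e k u) k.+1 z) = M (upd (upd e k u) k.+1 v).
  apply: A3 => // i iN A0 x /andP[zx xv]; apply: h => //.
  by rewrite (lt_le_trans z0 zx) (le_lt_trans xv).
by apply: hw; rewrite z0.
Qed.

End CurvesAndInequality.

(** * Row vectors and sequences *)

Section Bridge.
Variables (R : realType) (n : nat).
Notation env := (env R).
Implicit Types (e : env) (x y : 'rV[R]_n).

Definition toE x : env := fun i => if insub i is Some j then x ord0 j else 0.
Definition ofE e : 'rV[R]_n := \row_j e j.

Lemma toE_ord x (j : 'I_n) : toE x j = x ord0 j.
Proof. by rewrite /toE valK. Qed.

Lemma ofEK x : ofE (toE x) = x.
Proof. by apply/rowP => j; rewrite mxE toE_ord. Qed.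

Lemma toE_ofE e i : (i < n)%N -> toE (ofE e) i = e i.
Proof. by move=> iN; rewrite -[i]/(nat_of_ord (Ordinal iN)) toE_ord mxE. Qed.

Lemma dep_ofE (T : Type) (F : 'rV[R]_n -> T) : dep n (fun e => F (ofE e)).
Proof. by move=> e e' H; congr F; apply/rowP => j; rewrite !mxE H. Qed.

Lemma polyf_prod (I : Type) (s : seq I) (H : I -> env -> R) :
  (forall i, polyf (H i)) -> polyf (fun e => \prod_(i <- s) H i e).
Proof.
move=> h; elim: s => [|i s IH].
  by under eq_fun do rewrite big_nil; exact: polyf_cst.
by under eq_fun do rewrite big_cons; exact: polyfM.
Qed.

Lemma polyf_meval (p : mpoly.mpoly n R) :
  polyf (fun e => mpoly.meval (fun i => ofE e ord0 i) p).
Proof.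
under eq_fun do rewrite mpoly.mevalE.
apply: polyf_sum => m; apply: polyfM; first exact: polyf_cst.
apply: polyf_prod => i; apply: polyfX.
by under eq_fun do rewrite mxE; exact: polyf_var.
Qed.

Lemma semialgebraic_sa (A : set 'rV[R]_n) : semialgebraic A -> sa (fun e => A (ofE e)).
Proof.
elim => [p|B _ hB|B C _ hB _ hC].
- by apply: sa_pos; exact: polyf_meval.
- exact: sa_not hB.
- exact: sa_or hB hC.
Qed.

Lemma meval_polyf (f : env -> R) : polyf f ->
  exists p : mpoly.mpoly n R, forall x, mpoly.meval (fun i => x ord0 i) p = f (toE x).
Proof.
elim => [c|i|g h _ [p hp] _ [q hq]|g h _ [p hp] _ [q hq]].
- by exists (mpoly.mpolyC n c) => x; rewrite mpoly.mevalC.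
- case: (ltnP i n) => iN.
    exists (mpoly.mpolyX R (mpoly.mnm1 (Ordinal iN))) => x.
    by rewrite mpoly.mevalXU -[i in RHS]/(nat_of_ord (Ordinal iN)) toE_ord.
  exists (mpoly.mpolyC n 0) => x; rewrite mpoly.mevalC /toE insubF //.
  by rewrite ltnNge iN.
- eexists => x; rewrite -hp -hq.
  exact: (mpoly.mevalD (fun i => x ord0 i) p q).
- eexists => x; rewrite -hp -hq.
  exact: (mpoly.mevalM (fun i => x ord0 i) p q).
Qed.

Lemma sa_semialgebraic (P : env -> Prop) : sa P ->
  semialgebraic (fun x : 'rV[R]_n => P (toE x)).
Proof.
elim => [f /meval_polyf [p hp]|Q _ hQ|Q Q' _ hQ _ hQ'].
- have -> : (fun x => 0 < f (toE x)) =
      [set x : 'rV[R]_n | 0 < mpoly.meval (fun i => x ord0 i) p] :> set _.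
    by apply/funext => x; rewrite /mkset hp.
  exact: semialgebraic_pos.
- exact: semialgebraicC hQ.
- exact: semialgebraicU hQ hQ'.
Qed.

End Bridge.

(** * Functions on a subset as total functions *)

Section Functions.
Variables (R : realType) (n : nat) (X : set 'rV[R]_n).
Notation env := (env R).
Implicit Types (e : env) (x : X) (f g : X -> R).

Definition pointE e (h : X (ofE n e)) : X := SigSub (mem_set h).

(** Extension by zero, to which the calculus of total semialgebraic functions
    applies. *)
Definition ext f e : R :=
  if pselect (X (ofE n e)) is left h then f (pointE h) else 0.

Lemma ext_in f e x : ofE n e = set_val x -> ext f e = f x.
Proof.
move=> ex; rewrite /ext; case: pselect => [h|[]].
  by congr f; apply: val_inj; rewrite /= ex.
by rewrite ex; exact: set_valP.
Qed.

Lemma ext_toE f x : ext f (toE (set_val x)) = f x.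
Proof. by apply: ext_in; exact: ofEK. Qed.

Lemma ext_out f e : ~ X (ofE n e) -> ext f e = 0.
Proof. by rewrite /ext; case: pselect. Qed.

Lemma ext_pointE f e (h : X (ofE n e)) : ext f e = f (pointE h).
Proof. exact: ext_in. Qed.

Lemma dep_ext f : dep n (ext f).
Proof.
move=> e e' H; have E : ofE n e = ofE n e' by apply/rowP => j; rewrite !mxE H.
have [h|h] := pselect (X (ofE n e)).
  by rewrite (ext_pointE f h) (@ext_in f e' (pointE h)) // -E.
by rewrite !ext_out // -E.
Qed.

Lemma saf_ext f : semialgebraic X -> semialgebraic_fun f -> saf (ext f).
Proof.
move=> /semialgebraic_sa sX /semialgebraic_sa sf.
have h1 := @sa_subst R _ (fun i e => if (i < n)%N then e i.+1 else e 0%N) sf _.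
have {}h1 := h1 (fun i => _).
have sX1 : sa (fun e => X (ofE n (shift 1 e))) by exact: sa_shift sX.
have s0 : sa (fun e : env => e 0%N = 0) by apply: sa_eq.
have h2 : sa (fun e => X (ofE n (shift 1 e)) /\ e 0%N = ext f (shift 1 e)).
  apply: sa_ext (h1 _) => [e|i]; last by case: (i < n)%N; exact: polyf_var.
  split => [[x _ hx]|[hX e0]].
    have ex : ofE n (shift 1 e) = set_val x.
      apply/rowP => j; have := congr1 (fun M : 'rV_(n + 1) => M ord0 (lshift 1 j)) hx.
      by rewrite /= row_mxEl !mxE /= ltn_ord /shift addn1.
    split; first by rewrite ex; exact: set_valP.
    rewrite (ext_in f ex).
    have := congr1 (fun M : 'rV_(n + 1) => M ord0 (rshift n ord0)) hx.
    by rewrite /= row_mxEr !mxE /= addn0 ltnn.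
  exists (pointE hX) => //; apply/rowP => i.
  case: (split_ordP i) => j ->.
    by rewrite row_mxEl !mxE /= ltn_ord /shift addn1.
  by rewrite row_mxEr !mxE /= ltnNge leq_addr /= e0 (ext_pointE f hX).
apply: sa_ext (sa_or h2 (sa_and (sa_not sX1) s0)) => e; split.
  by case=> [[_ ->]|[h ->]] //; rewrite ext_out.
move=> e0; have [h|h] := pselect (X (ofE n (shift 1 e))); first by left.
by right; split => //; rewrite e0 ext_out.
Qed.

Lemma semialgebraic_fun_of_saf (F : env -> R) f : semialgebraic X -> saf F -> dep n F ->
  (forall x, f x = F (toE (set_val x))) -> semialgebraic_fun f.
Proof.
move=> /semialgebraic_sa sX sF dF fF.
have h : sa (fun e => X (ofE n e) /\ e n = F e) by apply: sa_and => //; exact: sa_eq.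
have := @sa_semialgebraic R (n + 1) _ h; congr semialgebraic.
apply/funext => M; apply/propext.
have toEl j : toE M (nat_of_ord (j : 'I_n)) = M ord0 (lshift 1 j).
  by rewrite -[nat_of_ord j]/(nat_of_ord (lshift 1 j)) toE_ord.
have toEr : toE M n = M ord0 (rshift n ord0).
  by rewrite -(toE_ord M (rshift n ord0)) /= addn0.
split => [[hX hF]|[x _ xM]].
  exists (pointE hX) => //; apply/rowP => i; case: (split_ordP i) => j ->.
    by rewrite row_mxEl !mxE toEl.
  rewrite row_mxEr !mxE (ord1 j) -toEr hF fF; apply: dF => l lN.
  by rewrite toE_ofE.
have ex : ofE n (toE M) = set_val x.
  by apply/rowP => j; rewrite mxE toEl -xM row_mxEl.
split; first by rewrite ex; exact: set_valP.
have Mf : M ord0 (rshift n ord0) = f x by rewrite -xM row_mxEr mxE.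
rewrite toEr Mf fF; apply: dF => l lN.
by rewrite -ex toE_ofE.
Qed.

End Functions.

(** * The Lojasiewicz inequality and divisibility *)

Section Regularity.
Variables (R : realType) (n : nat).
Notation env := (env R).
Implicit Types (X S : set 'rV[R]_n).

(** Arc-analyticity is a property of germs of arcs: a germ with values in [X]
    is analytic on a small interval, which is rescaled to the interval from
    [-1] to [1]. *)
Lemma arc_ext X (f : X -> R) (ga : R -> env) t0 : arc_analytic f ->
  (forall i, (i < n)%N -> ana (fun t => ga t i) t0) ->
  (\forall t \near t0, X (ofE n (ga t))) ->
  ana (fun t => ext f (ga t)) t0.
Proof.
move=> hf hga hX.
have [d d0 hd] : exists2 d, 0 < d & forall t, `|t - t0| < d ->
    X (ofE n (ga t)) /\ forall i : 'I_n, ana (fun t => ga t i) t.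
  have : \forall t \near t0, X (ofE n (ga t)) /\ forall i : 'I_n, ana (fun t => ga t i) t.
    apply: filterI => //.
    apply: (@filter_forall R 'I_n (fun i t => ana (fun t => ga t i) t) (nbhs t0)
      (nbhs_filter t0)) => i.
    exact: ana_recenter (hga i (ltn_ord i)).
  move=> [d /= d0 h]; exists d => // t td; apply: h.
  by rewrite /ball /= distrC.
have X0 : X (ofE n (ga t0)) by have [] := hd t0; rewrite ?subrr ?normr0.
pose del (s : R) : X := if pselect (X (ofE n (ga (d * s + t0)))) is left h then pointE h
  else pointE X0.
have dist (s : R) : `|s| < 1 -> `|(d * s + t0) - t0| < d.
  by move=> s1; rewrite addrK normrM (gtr0_norm d0) gtr_pMr.
have delE (s : R) : `|s| < 1 -> set_val (del s) = ofE n (ga (d * s + t0)).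
  move=> s1; rewrite /del; case: pselect => [h|[]] //.
  by have [] := hd _ (dist s s1).
have arc : analytic_arc del.
  move=> i a; rewrite /= in_itv /= => a1.
  have a1' : `|a| < 1 by rewrite ltr_norml.
  apply: (@ana_near _ (fun s => ga (d * s + t0) i)).
    have : \forall s \near a, `|s| < 1.
      have := near_dist a (_ : 0 < 1 - `|a|); rewrite subr_gt0 => /(_ a1').
      apply: filterS => s hs; have := ler_normD (s - a) a; rewrite subrK; lra.
    by apply: filterS => s s1; rewrite (delE s s1) mxE.
  apply: (@ana_affine _ (fun t => ga t i)).
  by have [_ h] := hd _ (dist a a1'); exact: h.
have := hf del arc 0; rewrite /= in_itv /= ltr01 oppr_lt0 ltr01 => /(_ isT) h.
have h' : ana (f \o del) (d^-1 * t0 + - (d^-1 * t0)) by rewrite subrr.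
have := ana_affine h'; apply: ana_near.
have := near_dist t0 d0; apply: filterS => t td.
have s1 : `|d^-1 * t + - (d^-1 * t0)| < 1.
  by rewrite -mulrBr normrM normfV (gtr0_norm d0) mulrC ltr_pdivrMr // mul1r.
rewrite /= -(@ext_in _ _ _ f (ga t)) // delE //; congr (ofE n (ga _)).
by rewrite mulrDr mulrN !mulrA divff ?gt_eqF // !mul1r subrK.
Qed.

(** Otherwise the points where [f] differs from [f x0] by at least [eps]
    accumulate at [x0], and curve selection gives an analytic arc to [x0]
    along which [f] is discontinuous. *)
Lemma aA_continuous X (f : X -> R) : semialgebraic X -> aA X f ->
  forall (x0 : X) eps, 0 < eps -> exists2 del, 0 < del & forall x : X,
    box n (toE (set_val x0)) del (toE (set_val x)) -> `|f x - f x0| < eps.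
Proof.
move=> sX [sf af] x0 eps eps0; apply: contrapT => hn.
pose A (e : env) := X (ofE n e) /\ eps <= `|ext f e - f x0|.
have sA : sa A.
  apply: sa_and; first exact: semialgebraic_sa.
  by apply: sa_le => //; apply: saf_abs; apply: safB => //; exact: saf_ext.
have dA : dep n A.
  move=> e e' H; rewrite /A (dep_ext f H); congr (_ /\ _).
  exact: (@dep_ofE R n Prop X).
have [|ga [g1 g2 [d d0 hd]]] := curve_selection (x0 := toE (set_val x0)) sA dA.
  move=> del del0; apply: contrapT => hn'; apply: hn; exists del => // x hx.
  rewrite ltNge; apply/negP => h; apply: hn'; exists (toE (set_val x)) => //.
  by split; [rewrite ofEK; exact: set_valP|rewrite ext_toE].
have E0 : ofE n (ga 0) = set_val x0.
  by apply/rowP => j; rewrite mxE g2 // toE_ord.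
have hX : \forall t \near (0 : R), X (ofE n (ga t)).
  have := near_dist 0 d0; apply: filterS => t; rewrite subr0 => td.
  have [->|t0] := eqVneq t 0; first by rewrite E0; exact: set_valP.
  by have [] := hd t; rewrite ?normr_gt0 ?t0.
have := elim0_ana (arc_ext af (fun i _ => g1 i) hX).
rewrite (ext_in f E0) => /(_ _ eps0) h.
have [t t0 [h1 h2]] := ev_ex (ev_and h (ev_near0 (near_dist 0 d0))).
rewrite subr0 in h2.
by have [_] := hd t (introT andP (conj (etrans (normr_gt0 t) (lt0r_neq0 t0)) h2)); rewrite leNgt h1.
Qed.

(** Local compactness, in the form needed to find limit points in [X] of
    families [D v] that shrink with [v]. It is inherited by closed subsets of
    [X]. *)
Definition box_compact X := forall x0 : X, exists2 rho, 0 < rho &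
  forall D : R -> X -> Prop,
    (forall v, 0 < v -> exists x, D v x) ->
    (forall v w x, 0 < v -> v <= w -> D v x -> D w x) ->
    (forall v x, 0 < v -> D v x -> forall i, (i < n)%N ->
        `|toE (set_val x) i - toE (set_val x0) i| <= rho) ->
    exists xh : X, forall del v, 0 < del -> 0 < v ->
      exists2 x, D v x & box n (toE (set_val xh)) del (toE (set_val x)).

Lemma near_box (a : 'rV[R]_n) del : 0 < del ->
  nbhs a [set y : 'rV[R]_n | forall j, `|y ord0 j - a ord0 j| < del].
Proof.
move=> del0; apply/nbhs_ballP; exists del => //= y [_ h] j.
by have := h ord0 j; rewrite /ball /= distrC.
Qed.

(** A closed box around the point that lies in the open set is compact, and
    limit points stay in the closed set. *)
Lemma locally_closed_box_compact S : locally_closed S -> box_compact S.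
Proof.
move=> [U [F [oU cF SUF]]] x0.
have Sx (x : S) : U (set_val x) /\ F (set_val x).
  by have := set_valP x; rewrite {1}SUF.
have : nbhs (set_val x0 : 'rV[R]_n) U.
  by move: oU; rewrite openE => /(_ (set_val x0)); apply; have [] := Sx x0.
move=> /nbhs_ballP [e /= e0 he].
exists (e / 2); first by rewrite divr_gt0.
move=> D D1 D2 D3.
pose K := [set v : 'rV[R]_n | forall i, `[(set_val x0) ord0 i - e / 2,
   (set_val x0) ord0 i + e / 2]%classic (v ord0 i)].
have cK : compact K by apply: (@rV_compact R n (fun i => `[(set_val x0) ord0 i - e / 2,
   (set_val x0) ord0 i + e / 2]%classic)) => i; exact: segment_compact.
pose Fl := filter_from [set v : R | 0 < v] (fun v => set_val @` [set x | D v x]).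
have FlF : ProperFilter Fl.
  apply: filter_from_proper; last first.
    by move=> v v0; have [x hx] := D1 v v0; exists (set_val x); exists x.
  apply: filter_from_filter; first by exists 1; exact: ltr01.
  move=> v w v0 w0; exists (Num.min v w); first by rewrite /= lt_min v0.
  have m0 : 0 < Num.min v w by rewrite lt_min v0.
  by move=> _ [x hx <-]; split; exists x => //; apply: D2 m0 _ hx;
    rewrite ge_min lexx ?orbT.
have KFl : Fl K.
  exists 1; first exact: ltr01.
  move=> _ [x hx <-] i; have := D3 1 x ltr01 hx i (ltn_ord i).
  by rewrite !toE_ord /= in_itv /= ler_distl.
have [a [Ka Fa]] := cK Fl FlF KFl.
have Ua : U a.
  apply: he; split => // i j; rewrite (ord1 i) /ball /= distrC.
  by have := Ka j; rewrite /= in_itv /= -ler_distl => h; apply: le_lt_trans h _; lra.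
have cl v del : 0 < v -> 0 < del -> exists2 x, D v x &
    forall j, `|(set_val x) ord0 j - a ord0 j| < del.
  move=> v0 del0.
  have [|y [[x hx <-] hy]] := Fa (set_val @` [set x | D v x]) _ _ (near_box a del0).
    by exists v.
  by exists x.
have Fa' : F a.
  apply: cF => B /nbhs_ballP [del /= del0 hB].
  have [x hx xa] := cl 1 del ltr01 del0.
  exists (set_val x); split; first by have [] := Sx x.
  by apply: hB; split => // i j; rewrite (ord1 i) /ball /= distrC.
have Sa : S a by rewrite SUF.
exists (SigSub (mem_set Sa)) => del v del0 v0.
have [x hx xa] := cl v del v0 del0; exists x => // i iN.
by have := xa (Ordinal iN); rewrite -!toE_ord.
Qed.

(** The zero set of an arc-analytic function is relatively closed, as the
    function is continuous. *)
Lemma zero_set_box_compact S X (f : S -> R) : semialgebraic S -> aA S f ->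
  set_val @` [set x | f x = 0] = X -> box_compact S -> box_compact X.
Proof.
move=> sS hf fX cS x0.
have inS (x : X) : S (set_val x).
  have : (set_val @` [set x | f x = 0]) (set_val x) by rewrite fX; exact: set_valP.
  by move=> [s _ <-]; exact: set_valP.
pose inc (x : X) : S := SigSub (mem_set (inS x)).
have fz (x : X) : f (inc x) = 0.
  have : (set_val @` [set x | f x = 0]) (set_val x) by rewrite fX; exact: set_valP.
  move=> [s fs sx].
  by have -> : inc x = s by apply: val_inj; exact: esym sx.
have [rho rho0 hrho] := cS (inc x0); exists rho => // D D1 D2 D3.
have [|||xh hxh] := hrho (fun v s => exists2 x : X, inc x = s & D v x).
- by move=> v /D1 [x hx]; exists (inc x); exists x.
- by move=> v w s v0 vw [x xs hx]; exists x => //; exact: D2 hx.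
- by move=> v s v0 [x <- hx] i iN; exact: D3 hx i iN.
have f0 : f xh = 0.
  apply/eqP; apply: contraT => nz.
  have nz' : 0 < `|f xh| by rewrite normr_gt0.
  have [del del0 hdel] := aA_continuous sS hf xh nz'.
  have [_ [x <- _] /hdel] := hxh del 1 del0 ltr01.
  by rewrite fz sub0r normrN ltxx.
have Xh : X (set_val xh) by rewrite -fX; exists xh.
exists (SigSub (mem_set Xh)) => del v del0 v0.
by have [_ [x <- hx] hb] := hxh del v del0 v0; exists x.
Qed.

(** If [f] and [g] take values [u] and at most [v] at a common point near
    [x0], then [v] cannot tend to zero while [u > 0] is fixed, because a limit
    point would be a zero of [g] and not of [f]. The possible pairs [u], [v]
    form a semialgebraic family, to which the uniform gap applies with an
    exponent that does not depend on [x0]. *)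
Theorem lojasiewicz X (f g : X -> R) : semialgebraic X -> box_compact X ->
  aA X f -> aA X g -> (forall x, g x = 0 -> f x = 0) ->
  exists N : nat, forall x0 : X, g x0 = 0 -> exists c del, [/\ 0 < c, 0 < del &
    forall x : X, box n (toE (set_val x0)) del (toE (set_val x)) -> f x != 0 ->
      c * `|f x| ^+ N <= `|g x|].
Proof.
move=> sX cX hf hg fg.
have sF : saf (ext f) by have [h _] := hf; exact: saf_ext.
have sG : saf (ext g) by have [h _] := hg; exact: saf_ext.
have sXe := semialgebraic_sa sX.
(* The entries of [e] are the centre, then a radius, a value of [|f|] and a bound
   for [|g|]; [u] is a point of [X] that realizes them. *)
pose Q (u e : env) := [/\ X (ofE n u), forall i, (i < n)%N -> `|u i - e i| <= e n,
   `|ext f u| = e n.+1 & `|ext g u| <= e n.+2].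
pose M (e : env) := exists u, Q (trunc n u) e.
have shvar i : saf (fun e : env => shift n e i) by exact: (saf_var _ (i + n)%N).
have trvar i : saf (fun e : env => trunc n e i).
  by rewrite /trunc; case: (i < n)%N.
have sM : sa M.
  apply: (@sa_exists_env R n Q).
  have h1 : sa (fun e : env => X (ofE n (trunc n e))) by exact: (sa_comp sXe).
  have h2 : sa (fun e : env => forall i, (i < n)%N -> `|trunc n e i - shift n e i| <= shift n e n).
    have h k : sa (fun e : env => forall i, (i < k)%N -> `|trunc n e i - shift n e i| <= shift n e n).
      elim: k => [|k IH]; first by apply: sa_ext (sa_cst _ True) => e; split.
      have hk : sa (fun e : env => `|trunc n e k - shift n e k| <= shift n e n).
        by apply: sa_le => //; apply: saf_abs; exact: safB.
      apply: sa_ext (sa_and IH hk) => e; split => [[a b] i|a].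
        by rewrite ltnS leq_eqVlt => /orP[/eqP ->|/a].
      by split => [i ik|]; apply: a => //; rewrite ltnW.
    exact: h.
  have h3 : sa (fun e : env => `|ext f (trunc n e)| = shift n e n.+1).
    by apply: sa_eq => //; apply: saf_abs; exact: saf_trunc.
  have h4 : sa (fun e : env => `|ext g (trunc n e)| <= shift n e n.+2).
    by apply: sa_le => //; apply: saf_abs; exact: saf_trunc.
  by apply: sa_ext (sa_and (sa_and h1 h2) (sa_and h3 h4)) => e; split => [[[? ?] [? ?]]|[]].
have dM : dep n.+3 M.
  have one (e e' : env) : (forall i, (i < n.+3)%N -> e i = e' i) -> M e -> M e'.
    move=> H [u [a1 a2 a3 a4]]; exists u; split => //.
    - by move=> i iN; rewrite -(H i) -?(H n); [exact: a2|lia|lia].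
    - by rewrite -H.
    - by rewrite -H.
  move=> e e' H; apply/propext; split; apply: one => // i iN; by rewrite H.
have [N hN] := uniform_gap sM dM; exists N => x0 g0.
have [rho rho0 hrho] := cX x0.
pose e : env := fun i => if (i < n)%N then toE (set_val x0) i else rho.
pose pt (u v : R) : env := upd (upd e n.+1 u) n.+2 v.
have ME (u v : R) : M (pt u v) <-> exists x : X,
    [/\ forall i, (i < n)%N -> `|toE (set_val x) i - toE (set_val x0) i| <= rho,
       `|f x| = u & `|g x| <= v].
  have p1 i : (i < n)%N -> pt u v i = toE (set_val x0) i.
    by move=> iN; rewrite /pt /upd /e iN !ltn_eqF // ?leqW // ltnW // leqW.
  have p2 : pt u v n = rho by rewrite /pt /upd /e ltnn !ltn_eqF.
  have p3 : pt u v n.+1 = u by rewrite /pt /upd ltn_eqF // eqxx.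
  have p4 : pt u v n.+2 = v by rewrite /pt upd_same.
  split => [[w [hX a1 a2 a3]]|[x [a1 a2 a3]]].
    rewrite p3 in a2; rewrite p4 in a3.
    exists (pointE hX); rewrite -!ext_pointE; split => // i iN.
    by have := a1 i iN; rewrite p1 // p2 /= toE_ofE.
  have tr : trunc n (toE (set_val x)) = toE (set_val x).
    apply/funext => i; rewrite /trunc; case: ltnP => // iN.
    by rewrite /toE insubF // ltnNge iN.
  exists (toE (set_val x)); rewrite /Q tr ofEK !ext_toE p2 p3 p4; split => //.
    exact: set_valP.
  by move=> i iN; rewrite p1 //; exact: a1.
have [|c c0 [u0 u00 hc]] := hN e.
  move=> u u0; apply: contrapT => hn.
  pose D (v : R) (x : X) :=
    [/\ forall i, (i < n)%N -> `|toE (set_val x) i - toE (set_val x0) i| <= rho,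
       `|f x| = u & `|g x| < v].
  have [|||xh hxh] := hrho D.
  - move=> v v0; apply: contrapT => hx; apply: hn; exists v => // w /andP[w0 wv].
    move=> /ME [x [a1 a2 a3]]; apply: hx; exists x; split => //.
    exact: le_lt_trans a3 wv.
  - by move=> v w x v0 vw [a1 a2 a3]; split => //; exact: lt_le_trans vw.
  - by move=> v x _ [].
  have gh : g xh = 0.
    apply/eqP; apply: contraT => nz.
    have nz2 : 0 < `|g xh| / 2 by rewrite divr_gt0 // normr_gt0.
    have [del del0 hdel] := aA_continuous sX hg xh nz2.
    have [x [_ _ gx] /hdel h] := hxh del _ del0 nz2.
    have := ler_distD (g x) (g xh) 0; rewrite !subr0 distrC; lra.
  have fh := fg _ gh.
  have [del del0 hdel] := aA_continuous sX hf xh u0.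
  have [x [_ fx _] /hdel] := hxh del 1 del0 ltr01.
  by rewrite fh subr0 fx ltxx.
have [del del0 hdel] := aA_continuous sX hf x0 u00.
exists c, (Num.min del rho); split => //; first by rewrite lt_min del0.
move=> x hx fx; rewrite leNgt; apply/negP => gx.
have fx0 : 0 < `|f x| by rewrite normr_gt0.
have gx0 : 0 < `|g x|.
  by rewrite normr_gt0; apply/eqP => /fg /eqP; rewrite (negbTE fx).
have fu : `|f x| < u0.
  have := hdel x _; rewrite (fg _ g0) subr0; apply => i iN.
  by have := hx i iN; rewrite lt_min => /andP[].
have := hc `|f x|; rewrite fx0 fu => /(_ isT `|g x|); rewrite gx0 gx => /(_ isT).
apply; apply/ME; exists x; split => // i iN.
by have := hx i iN; rewrite lt_min => /andP[_ /ltW].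
Qed.

(** Comparing orders of vanishing: the inequality [c |f| ^ N <= |g|] bounds
    the order of [g] by [N] times that of [f], so [f ^ N.+1] has a strictly
    larger order. The quotient is then analytic and vanishes at [t0], in
    agreement with the convention that division by zero gives zero. *)
Lemma ana_quotient (f g : R -> R) t0 N c : ana f t0 -> ana g t0 -> 0 < c -> g t0 = 0 -> f t0 = 0 ->
  (\forall t \near t0, f t != 0 -> c * `|f t| ^+ N <= `|g t|) ->
  (\forall t \near t0, g t = 0 -> f t = 0) ->
  ana (fun t => f t ^+ N.+1 / g t) t0.
Proof.
move=> hf hg c0 g0 f0 hfg hz.
have [zg|[b [psi [hpsi psi0 gE]]]] := ana_order hg.
  apply: ana_near (ana_cst 0 t0); near=> t.
  have -> : g t = 0 by near: t.
  by rewrite invr0 mulr0.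
have [zf|[a [phi [hphi phi0 fE]]]] := ana_order hf.
  apply: ana_near (ana_cst 0 t0); near=> t.
  have -> : f t = 0 by near: t.
  by rewrite expr0n mul0r.
have a0 : (0 < a)%N.
  rewrite lt0n; apply/eqP => a0; have := nbhs_singleton fE.
  by rewrite a0 expr0 mul1r f0 => /esym /eqP; rewrite (negbTE phi0).
have b0 : (0 < b)%N.
  rewrite lt0n; apply/eqP => b0; have := nbhs_singleton gE.
  by rewrite b0 expr0 mul1r g0 => /esym /eqP; rewrite (negbTE psi0).
have nphi : \forall t \near t0, phi t != 0 by exact: (cvgr_neq0 _ (ana_cvg hphi) phi0).
have npsi : \forall t \near t0, psi t != 0 by exact: (cvgr_neq0 _ (ana_cvg hpsi) psi0).
have ab : (b <= a * N)%N.
  rewrite leqNgt; apply/negP => ab.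
  have lim : (t - t0) ^+ (b - a * N) * psi t / phi t ^+ N @[t --> t0] -->
      (t0 - t0) ^+ (b - a * N) * psi t0 / phi t0 ^+ N.
    have h : ana (fun t => (t - t0) ^+ (b - a * N) * psi t / phi t ^+ N) t0.
      apply: ana_div; last by rewrite expf_neq0.
        apply: anaM => //; apply: anaX; apply: anaB; [exact: ana_id|exact: ana_cst].
      exact: anaX.
    exact: (ana_cvg h).
  rewrite subrr expr0n subn_eq0 leqNgt ab /= mul0r mul0r in lim.
  have /cvgrPdist_lt/(_ c c0) := lim.
  move=> hlim.
  have : \forall t \near t0, [/\ `|0 - (t - t0) ^+ (b - a * N) * psi t / phi t ^+ N| < c,
     phi t != 0, f t = (t - t0) ^+ a * phi t, g t = (t - t0) ^+ b * psi t &
     (f t != 0 -> c * `|f t| ^+ N <= `|g t|)].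
    by near=> t; split; near: t.
  move=> [d /= d0 /(_ (t0 + d / 2))].
  have d2 : 0 < d / 2 by rewrite divr_gt0.
  have dt : t0 + d / 2 - t0 = d / 2 by rewrite addrAC subrr add0r.
  rewrite /ball /= distrC dt (gtr0_norm d2) ltr_pdivrMr // ltr_pMr // ltr1n => /(_ isT).
  rewrite sub0r normrN => -[h1 h2 h3 h4 h5].
  have : f (t0 + d / 2) != 0 by rewrite h3 mulf_neq0 // expf_neq0 // gt_eqF.
  move=> /h5; rewrite h3 h4 !normrM !normrX (gtr0_norm d2) => h6.
  have pN : 0 < `|phi (t0 + d / 2)| ^+ N by rewrite exprn_gt0 // normr_gt0.
  have dN : 0 < (d / 2) ^+ (a * N) by rewrite exprn_gt0.
  move: h1; rewrite !normrM normfV !normrX (gtr0_norm d2) ltr_pdivrMr // => h7.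
  have := h6; rewrite exprMn -exprM -(subnKC (ltnW ab)) exprD mulrCA -!mulrA ler_pM2l //.
  by rewrite leNgt h7.
have hab : (b < a * N.+1)%N.
  by rewrite mulnS; apply: leq_ltn_trans ab _; rewrite -[ltnLHS]add0n ltn_add2r.
apply: (@ana_near _ (fun t => (t - t0) ^+ (a * N.+1 - b) * (phi t ^+ N.+1 / psi t))).
  near=> t.
  have -> : f t = (t - t0) ^+ a * phi t by near: t.
  have -> : g t = (t - t0) ^+ b * psi t by near: t.
  have [->|tt0] := eqVneq t t0.
    by rewrite subrr !expr0n subn_eq0 leqNgt hab (gtn_eqF a0) /= !mul0r expr0n mul0r.
  have E : (t - t0) ^+ (a * N.+1) = (t - t0) ^+ (a * N.+1 - b) * (t - t0) ^+ b.
    by rewrite -exprD subnK // ltnW.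
  rewrite exprMn -exprM E.
  rewrite invfM; have tb : (t - t0) ^+ b != 0 by rewrite expf_neq0 // subr_eq0.
  move: tb; move: ((t - t0) ^+ b) ((t - t0) ^+ _) (phi t ^+ _) (psi t)^-1 => V U P q tb.
  by field.
apply: anaM; first by apply: anaX; apply: anaB; [exact: ana_id|exact: ana_cst].
by apply: ana_div => //; exact: anaX.
Unshelve. all: by end_near. Qed.

(** The quotient [f ^ N.+1 / g], with value zero where [g] vanishes, is
    semialgebraic, and it is arc-analytic because the Lojasiewicz inequality
    controls it along every arc through the zeros of [g]. *)
Theorem power_divisible X (f g : X -> R) : semialgebraic X -> box_compact X ->
  aA X f -> aA X g -> (forall x, g x = 0 -> f x = 0) ->
  exists N (h : X -> R), [/\ (0 < N)%N, aA X h & forall x, f x ^+ N = h x * g x].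
Proof.
move=> sX cX hf hg fg; have [N hN] := lojasiewicz sX cX hf hg fg.
exists N.+1, (fun x => f x ^+ N.+1 / g x); split => //; last first.
  move=> x; have [g0|g0] := eqVneq (g x) 0; last by rewrite divfK.
  by rewrite (fg _ g0) expr0n mul0r mul0r.
have [sf af] := hf; have [sg ag] := hg.
split.
  apply: (@semialgebraic_fun_of_saf R n X (fun e => ext f e ^+ N.+1 / ext g e)) => //.
  - by apply: safM; [apply: safX; exact: saf_ext|apply: safV; exact: saf_ext].
  - by move=> e e' H; rewrite (dep_ext f H) (dep_ext g H).
  - by move=> x; rewrite !ext_toE.
move=> ga hga a ha.
have haf : ana (f \o ga) a by exact: af.
have hag : ana (g \o ga) a by exact: ag.
have [g0|g0] := eqVneq (g (ga a)) 0; last by apply: ana_div => //; exact: (anaX N.+1 haf).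
have [c [del [c0 del0 h]]] := hN (ga a) g0.
apply: (@ana_quotient (f \o ga) (g \o ga) a N c) => //; first exact: fg.
  have hbox := @arc_near_box R n (fun t => toE (set_val (ga t))) a del.
  apply: filterS (hbox _ del0) => [t|i iN]; first exact: h.
  by apply: ana_ext (hga (Ordinal iN) a ha) => t; rewrite -toE_ord.
by near=> t; exact: fg.
Unshelve. all: by end_near. Qed.

End Regularity.

(** * Zero sets of ideals *)

Section Ideals.
Variables (R : realType) (n : nat) (X : set 'rV[R]_n) (I : set (X -> R)).
Notation env := (env R).
Hypotheses (sX : semialgebraic X) (idI : is_ideal I).

Lemma ideal_sq g : I g -> I (g * g).
Proof. by have [sub _ _ mul] := idI => Ig; apply: mul => //; exact: sub. Qed.

Definition same_zero_at (g : X -> R) (e : env) :=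
  ext g e = 0 -> forall g', I g' -> ext g' e = 0.

Lemma ext_sq2 (f g : X -> R) e : ext (f * f + g * g) e = ext f e ^+ 2 + ext g e ^+ 2.
Proof.
have [h|h] := pselect (X (ofE n e)); first by rewrite !(ext_pointE _ h) !expr2.
by rewrite !ext_out // expr0n addr0.
Qed.

Lemma same_zero_sq2 f g e : same_zero_at f e \/ same_zero_at g e -> same_zero_at (f * f + g * g) e.
Proof.
rewrite /same_zero_at ext_sq2 => H /eqP.
rewrite paddr_eq0 ?sqr_ge0 // !sqrf_eq0 => /andP[/eqP f0 /eqP g0].
by case: H => [/(_ f0)|/(_ g0)].
Qed.

Lemma ideal_sq2 f g : I f -> I g -> I (f * f + g * g).
Proof. by have [_ _ add _] := idI => hf hg; apply: add; exact: ideal_sq. Qed.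

(** Functions found for the finitely many maps of a cover are combined by sums
    of squares. *)
Lemma same_zero_cov d k phi (A : env -> Prop) : param d phi ->
  (forall j psi, (j < k)%N -> param j psi -> (forall u, X (ofE n (psi u))) ->
    exists2 g, I g & forall u, same_zero_at g (psi u)) ->
  cov (fun psi => anyp psi /\ forall u, X (ofE n (phi (psi u)))) d k A ->
  exists2 g, I g & forall e, A e -> same_zero_at g (phi e).
Proof.
move=> hphi IH; elim => [|j psi jk hpsi [_ hX]|P Q _ [f If hf] _ [g Ig hg]].
- by have [_ I0 _ _] := idI; exists 0.
- have [g Ig hg] := IH _ _ jk (param_comp hphi hpsi) hX.
  exists g => // e [u eu]; have [dphi _ _] := hphi.
  by rewrite (dphi _ _ eu).
- exists (f * f + g * g); first exact: ideal_sq2.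
  by move=> e [/hf|/hg] h; apply: same_zero_sq2; [left|right].
Qed.

(** Noetherian induction on the dimension of the source. If some element of
    the ideal does not vanish identically along [phi], its zeros are covered
    by spaces of smaller dimension, to which the induction hypothesis applies;
    otherwise zero will do. *)
Lemma same_zero_param k phi : param k phi -> (forall e, X (ofE n (phi e))) ->
  exists2 g, I g & forall e, same_zero_at g (phi e).
Proof.
elim/ltn_ind: k phi => k IH phi hphi hX.
have [all0|] := pselect (forall g, I g -> forall e, ext g (phi e) = 0).
  have [_ I0 _ _] := idI; exists 0 => // e _ g Ig; exact: all0.
move=> /existsNP [g1 /not_implyP [Ig1 /existsNP [e0 ne]]].
have [sub _ _ _] := idI; have [sg ag] := sub _ Ig1; have [dp sp ap] := hphi.
pose h e := ext g1 (phi e).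
have sh : saf h by apply: saf_comp => //; exact: saf_ext.
have dh : dep k h by move=> e e' H; rewrite /h (dp e e' H).
have ah : arcf h.
  move=> ga t0 H; apply: arc_ext ag _ _; first by move=> i _; exact: ap.
  by near=> t; exact: hX.
have h0 : exists e, h e != 0 by exists e0; apply/eqP.
have [_ thin] := decomposition R k.
have cz := cov_in (thin h sh dh ah h0) (A' := fun e => X (ofE n (phi e))) (fun e _ => hX e).
have [gA IgA hA] := same_zero_cov hphi (fun j psi jk => IH j jk psi) cz.
exists (g1 * g1 + gA * gA); first exact: ideal_sq2.
move=> e; have [he|he] := eqVneq (h e) 0; apply: same_zero_sq2; first by right; exact: hA.
by left => he'; rewrite /h he' eqxx in he.
Unshelve. all: by end_near. Qed.

Lemma param_trunc : param n (fun e : env => trunc n e).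
Proof.
split.
- by move=> e e' H; apply/funext => i; rewrite /trunc; case: ltnP => // /H.
- by move=> i; rewrite /trunc; case: (i < n)%N.
- move=> i; rewrite /trunc; case: (i < n)%N; [exact: arcf_var|exact: arcf_cst].
Qed.

(** One element of the ideal has the same zeros as the ideal, which replaces
    noetherianity. The set [X] is covered by images of affine spaces, on which
    the previous lemma applies. *)
Theorem ideal_zero_set : exists2 g, I g &
  forall x, g x = 0 -> forall g', I g' -> g' x = 0.
Proof.
have sXe := semialgebraic_sa sX.
have [dec _] := decomposition R n.
have dX : dep n (fun e : env => X (ofE n e)) by exact: (@dep_ofE R n Prop X).
have hX e : X (ofE n e) -> X (ofE n (trunc n e)).
  have -> // : ofE n (trunc n e) = ofE n e.
  by apply/rowP => j; rewrite !mxE /trunc ltn_ord.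
have cX := cov_in (dec _ sXe dX) hX.
have [g Ig hg] := same_zero_cov param_trunc (fun j psi _ => @same_zero_param j psi) cX.
exists g => // x gx g' Ig'; have tr : ofE n (trunc n (toE (set_val x))) = set_val x.
  by rewrite -[RHS]ofEK; apply/rowP => j; rewrite !mxE /trunc ltn_ord.
have Xx : X (ofE n (toE (set_val x))) by rewrite ofEK; exact: set_valP.
by have := hg _ Xx; rewrite /same_zero_at (ext_in g tr) => /(_ gx _ Ig'); rewrite (ext_in g' tr).
Qed.

End Ideals.

(** * Both parts of the theorem *)

Section Restriction.
Variables (R : realType) (n : nat).
Implicit Types S X Y : set 'rV[R]_n.

Lemma arc_near (f g : R -> R) : {in `]-1, 1[, f =1 g} ->
  real_analytic_on `]-1, 1[ f -> real_analytic_on `]-1, 1[ g.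
Proof.
move=> fg hf a ha; apply: (@ana_near _ f); last exact: hf.
have : `]-1, 1[%classic a by exact: ha.
have o1 : open (`]-1, 1[%classic : set R) by exact: interval_open.
move: o1; rewrite openE => /(_ a) /[apply]; apply: filterS => t ht.
by rewrite (fg t ht).
Qed.

(** An arc in [S] whose first half lies in [Y] lies in [X], so it is an arc in
    [X] and lies in [Y]. *)
Lemma AR_closed_trans S X Y : AR_closed S X -> AR_closed X Y -> AR_closed S Y.
Proof.
move=> [sX XS cX] [sY YX cY]; split => //; first exact: subset_trans XS.
move=> ga hga gaY.
have gaX : forall t, t \in `]-1, 1[ -> X (set_val (ga t)).
  by apply: cX => // t ht; apply: YX; exact: gaY.
have X0 : X (set_val (ga 0)) by apply: gaX; rewrite in_itv /= ltr01 oppr_lt0 ltr01.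
pose del (t : R) : X := if pselect (X (set_val (ga t))) is left h
  then SigSub (mem_set h) else SigSub (mem_set X0).
have delE t : t \in `]-1, 1[ -> set_val (del t) = set_val (ga t).
  by move=> /gaX h; rewrite /del; case: pselect.
have hdel : analytic_arc del.
  by move=> i; apply: arc_near (hga i) => t ht; rewrite delE.
have h01 t : t \in `]-1, 0[ -> t \in `]-1, 1[.
  by rewrite !in_itv /= => /andP[-> /lt_trans]; apply; exact: ltr01.
move=> t ht; rewrite -delE //; apply: cY => // s hs.
by rewrite delE ?h01 //; exact: gaY.
Qed.

Lemma aA_restrict S X (f : S -> R) : semialgebraic S -> semialgebraic X ->
  X `<=` S -> aA S f -> aA X (fun x => ext f (toE (set_val x))).
Proof.
move=> sS sX XS [sf af]; split.
  by apply: semialgebraic_fun_of_saf (saf_ext sS sf) (@dep_ext _ _ _ f) _.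
move=> ga hga a ha.
have inS x : S (ofE n (toE (set_val (ga x)))) by rewrite ofEK; apply: XS; exact: set_valP.
apply: (arc_ext (ga := fun t => toE (set_val (ga t))) af).
  by move=> i iN; apply: ana_ext (hga (Ordinal iN) a ha) => t; rewrite -toE_ord.
by near=> t; exact: inS.
Unshelve. all: by end_near. Qed.

(** The zero set property on [S] provides a function with zero set [Y], and
    its restriction to [X] is in the ideal of [Y]. *)
Lemma zeros_vanishing S X Y : semialgebraic S -> zero_set_property S ->
  AR_closed S X -> AR_closed X Y -> zeros (vanishing X Y) = Y.
Proof.
move=> sS zS cX cY; have [f hf fY] := zS _ (AR_closed_trans cX cY).
have [sX XS _] := cX; have [_ YX _] := cY.
apply/seteqP; split => [_ [x hx <-]|y Yy].
  have Sx : S (set_val x) by apply: XS; exact: set_valP.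
  pose x' : S := SigSub (mem_set Sx).
  have fE : ext f (toE (set_val x)) = f x' by apply: ext_in; exact: ofEK.
  rewrite -fY; exists x' => //=; rewrite -fE.
  apply: (hx (fun x => ext f (toE (set_val x)))); split; first exact: aA_restrict.
  move=> z; rewrite -{1}fY => -[s fs sz].
  by rewrite (@ext_in _ _ _ f _ s) // ofEK.
by exists (SigSub (mem_set (YX _ Yy))) => // f' [_]; exact.
Qed.

(** A function that vanishes on the zeros of the ideal vanishes on those of a
    single element [g] of it, so a power of the function is a multiple of [g].
    *)
Lemma vanishing_zeros S X (I : set (X -> R)) : semialgebraic S -> locally_closed S ->
  zero_set_property S -> AR_closed S X -> is_ideal I -> vanishing X (zeros I) = radical I.
Proof.
move=> sS lS zS cX idI; have [sX _ _] := cX.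
have expE (f : X -> R) k x : (f ^+ k) x = f x ^+ k.
  by elim: k => [|k IH]; rewrite ?expr0 // !exprS /= -IH.
apply/seteqP; split => f [hf]; last first.
  move=> [k k0 Ik]; split => // x [x' hx' xx'].
  have -> : x = x' by apply: val_inj; exact: esym xx'.
  by apply/eqP; have /eqP := hx' _ Ik; rewrite expE expf_eq0 k0.
move=> f0; split => //.
have [g Ig hg] := ideal_zero_set sX idI; have [sub _ _ mul] := idI.
have fg x : g x = 0 -> f x = 0.
  by move=> gx; apply: f0; exists x => // g' Ig'; exact: hg Ig'.
have [F hF FX] := zS X cX.
have bX := zero_set_box_compact sS hF FX (locally_closed_box_compact lS).
have [N [h [N0 hh E]]] := power_divisible sX bX hf (sub _ Ig) fg.
exists N => //; have -> : f ^+ N = h * g by apply/funext => x; rewrite expE E.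
exact: mul.
Qed.

End Restriction.

Theorem theorem6p4 (R : realType) (n : nat) (S X : set 'rV[R]_n)
    (S_semialg : semialgebraic S) (S_lc : locally_closed S)
    (S_zsp : zero_set_property S) (X_closed : AR_closed S X) :
  (forall Y : set 'rV[R]_n, AR_closed X Y -> zeros (vanishing X Y) = Y) /\
  (forall I : set (X -> R), is_ideal I -> vanishing X (zeros I) = radical I).
Proof.
split=> [Y|I]; first exact: (zeros_vanishing S_semialg S_zsp X_closed).
exact: (vanishing_zeros S_semialg S_lc S_zsp X_closed).
Qed.
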